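(* Let $\ell$ be a prime, $n\mid\ell-1$, $\chi:\mathbb{F}_\ell^*\to\mu_n$ a character of order $n$, and $k\in\mathbb{N}$. If $n$ is even, let $k$ be odd. Let $$r=\begin{cases}\min\{r:\frac{k+1+r}{6}\in\mathbb{N}\},& n\equiv1\bmod 2,\\ \min\{r:\frac{3(k+1)+2r}{12}\in\mathbb{N}\},& n\equiv0\bmod2,\end{cases}\qquad e_\Delta=\begin{cases}\frac{k+1+r}{6},& n\equiv1\bmod2,\\ \frac{3(k+1)+2r}{12},& n\equiv0\bmod2.\end{cases}$$ Then $$J_{\ell,n,\chi,k}(q)=\frac{G_{\ell,n,\chi}(q)^k\,G_{\ell,n,\chi^{-k}}(q)\,p_1(q)^r}{\Delta(q)^{e_\Delta}}$$ is a modular function of weight $0$ for $\Gamma_0(\ell)$ which is holomorphic on the upper half-plane $\mathbb{H}$ and whose Laurent coefficients in $q$ lie in $\mathbb{Q}[\zeta_n]$.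
   Context: $q=e^{2\pi i\tau}$, $\tau\in\mathbb{H}$; $\mu_n$ is the group of $n$-th roots of unity and $\zeta_m$ a primitive $m$-th root of unity. The minima are over nonnegative integers $r$. $\Gamma_0(\ell)$ is the subgroup of $\mathrm{SL}_2(\mathbb{Z})$ of matrices with lower-left entry divisible by $\ell$; a modular function of weight $0$ for it is a $\Gamma_0(\ell)$-invariant meromorphic function on $\mathbb{H}$, meromorphic at the cusps. Define $$x(w,q)=\tfrac1{12}+\tfrac{w}{(1-w)^2}+\sum_{i\ge1}\sum_{m\ge1}\big(m q^{im}(w^m+w^{-m})-2mq^{im}\big),$$ $$y(w,q)=\tfrac{w+w^2}{2(1-w)^3}+\tfrac12\sum_{i\ge1}\sum_{m\ge1}\tfrac{m(m+1)}2\big(q^{im}(w^m-w^{-m})+q^{i(m+1)}(w^{m+1}-w^{-(m+1)})\big).$$ For a character $\psi:\mathbb{F}_\ell^*\to\mu_n$ put $G_{\ell,n,\psi}(q)=\sum_{\lambda\in\mathbb{F}_\ell^*}\psi(\lambda)V(\zeta_\ell^\lambda,q)$, where $V=x$ if $n$ is odd and $V=y$ if $n$ is even. Further $p_1(q)=\sum_{\zeta\in\mu_\ell,\zeta\neq1}x(\zeta,q)$ and $\Delta(q)=\eta(q)^{24}$ is the modular discriminant, $\eta$ the Dedekind eta function. $J_{\ell,n,\chi,k}$ is called a universal elliptic Jacobi sum. *)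

(* Defs.v *)
From HB Require Import structures.
From mathcomp Require Import all_boot all_order all_algebra all_fingroup.
From mathcomp Require Import complex.
From mathcomp Require Import all_classical all_reals all_analysis.

Set Implicit Arguments.
Unset Strict Implicit.
Unset Printing Implicit Defensive.

Import Order.TTheory GRing.Theory Num.Theory.
Import numFieldNormedType.Exports.

Local Open Scope classical_set_scope.
Local Open Scope ring_scope.

(* The topology of the complex numbers R[i] is carried by the alias R[i]^o
   (R[i] as a normed module over itself): limits and derivatives below are
   taken there, so that derivability is complex differentiability. *)

Section ComplexAnalysis.
Variable R : realType.
Implicit Types (f g F : R[i] -> R[i]) (u : nat -> R[i]) (z t q w : R[i]).

(* The sum and the product over all i >= 1. *)
Definition csum1 u : R[i] :=
  limn (fun n => \sum_(1 <= i < n.+1) u i : R[i]^o).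

Definition cprod1 u : R[i] :=
  limn (fun n => \prod_(1 <= i < n.+1) u i : R[i]^o).

Definition cexp z : R[i] :=
  (expR (complex.Re z))%:C%C * (cos (complex.Im z) +i* sin (complex.Im z))%C.

Definition e2pi z : R[i] := cexp ((2 * pi)%:C%C * 'i%C * z).

Definition upper_half_plane : set R[i] := [set t | 0 < complex.Im t].

Definition complex_derivable f z : Prop :=
  derivable (f : R[i]^o -> R[i]^o) (z : R[i]^o) 1.

(* Meant for open U. *)
Definition holomorphic_on (U : set R[i]) f : Prop :=
  forall z, U z -> complex_derivable f z.

(* (w - z)^n f(w) extends holomorphically across z for some n; the value of f
   at z itself is irrelevant. *)
Definition meromorphic_at f z : Prop :=
  exists (n : nat) g,
    (\forall w \near (z : R[i]^o), complex_derivable g w) /\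
    (\forall w \near (z : R[i]^o)^', (w - z) ^+ n * f w = g w).

Definition meromorphic_on (U : set R[i]) f : Prop :=
  forall z, U z -> meromorphic_at f z.

Definition SL2Z : set 'M[int]_2 := [set A | \det A = 1].

Definition Gamma0 (l : nat) : set 'M[int]_2 :=
  [set A | SL2Z A /\ (l%:Z %| A 1%R 0%R)%Z].

Definition moebius (A : 'M[int]_2) t : R[i] :=
  ((A 0 0)%:~R * t + (A 0 1)%:~R) / ((A 1 0)%:~R * t + (A 1 1)%:~R).

(* At the cusp A(oo), f o A is, near i*oo, a function of exp(2 i pi t / h)
   that is meromorphic at 0, for some h > 0. *)
Definition meromorphic_at_cusps f : Prop :=
  forall A, SL2Z A ->
    exists (h : nat) F (B : R),
      [/\ (0 < h)%N, meromorphic_at F 0 &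
          forall t, upper_half_plane t -> B < complex.Im t ->
            f (moebius A t) = F (e2pi (t / h%:R))].

Definition modular_function (l : nat) f : Prop :=
  [/\ meromorphic_on upper_half_plane f,
      (forall A t, Gamma0 l A -> upper_half_plane t ->
         f (moebius A t) = f t) &
      meromorphic_at_cusps f].

(* f(t) = \sum_(m >= 0) c_m q^(m - N), q = exp(2 i pi t): c_m is the Laurent
   coefficient of f of index m - N. *)
Definition has_q_expansion f (N : nat) (c : nat -> R[i]) : Prop :=
  forall t, upper_half_plane t ->
    series (fun m => c m * e2pi t ^ (m%:Z - N%:Z) : R[i]^o) @ \oo
      --> (f t : R[i]^o).

Definition Q_adjoin z : set R[i] :=
  [set w | exists p : {poly rat}, w = (map_poly ratr p).[z]].

End ComplexAnalysis.

Definition is_min (P : nat -> Prop) (m : nat) : Prop :=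
  P m /\ forall s, P s -> (m <= s)%N.

Section JacobiSum.
Variable R : realType.
Implicit Types (w q t zeta : R[i]) (l n k r : nat).

Definition xser w q : R[i] :=
  12%:R^-1 + w / (1 - w) ^+ 2 +
  csum1 (fun i => csum1 (fun m =>
    m%:R * q ^+ (i * m) * (w ^+ m + w ^- m) - 2 * m%:R * q ^+ (i * m))).

Definition yser w q : R[i] :=
  (w + w ^+ 2) / (2 * (1 - w) ^+ 3) +
  2^-1 * csum1 (fun i => csum1 (fun m =>
    m%:R * (m + 1)%:R / 2 *
      (q ^+ (i * m) * (w ^+ m - w ^- m) +
       q ^+ (i * (m + 1)) * (w ^+ (m + 1) - w ^- (m + 1))))).

Definition eta t : R[i] :=
  e2pi (t / 24%:R) * cprod1 (fun m => 1 - e2pi t ^+ m).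

Definition Delta t : R[i] := eta t ^+ 24.

Definition p1 l q : R[i] :=
  \sum_(z \in [set z : R[i] | z ^+ l = 1 /\ z <> 1]) xser z q.

Definition mu_character l n (psi : {unit 'F_l} -> R[i]) : Prop :=
  (forall a b, psi (a * b)%g = psi a * psi b) /\
  (forall a, n.-unity_root (psi a)).

Definition character_order l n (psi : {unit 'F_l} -> R[i]) : Prop :=
  is_min (fun m => (0 < m)%N /\ forall a, psi a ^+ m = 1) n.

Definition Gsum l zeta n (psi : {unit 'F_l} -> R[i]) q : R[i] :=
  \sum_(a : {unit 'F_l})
    psi a * (if odd n then xser else yser) (zeta ^+ (val a : 'F_l)) q.

Definition r_admissible n k r : bool :=
  if odd n then (6 %| k + 1 + r)%N else (12 %| 3 * (k + 1) + 2 * r)%N.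

Definition e_Delta n k r : nat :=
  if odd n then ((k + 1 + r) %/ 6)%N else ((3 * (k + 1) + 2 * r) %/ 12)%N.

Definition jacobi_sum l zeta n (chi : {unit 'F_l} -> R[i]) k r t : R[i] :=
  let q := e2pi t in
  Gsum zeta n chi q ^+ k * Gsum zeta n (fun a => chi a ^- k) q * p1 l q ^+ r
    / Delta t ^+ e_Delta n k r.

End JacobiSum.

(* The minimum defining the exponent r exists. *)
Lemma r_admissible_ex (n k : nat) :
  (~~ odd n -> odd k) -> exists r, is_min (r_admissible n k) r.
Proof.
move=> kP.
have rP : exists r, r_admissible n k r.
  rewrite /r_admissible; case: (odd n) kP => [_|/(_ isT) ko].
    by exists (5 * (k + 1))%N; rewrite -mulSn dvdn_mulr.
  exists (9 * (k + 1)./2)%N.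
  have {1}-> : (k + 1 = 2 * (k + 1)./2)%N.
    by rewrite mul2n -[LHS]odd_double_half oddD ko.
  by rewrite !mulnA -mulnDl dvdn_mulr.
by exists (ex_minn rP); case: ex_minnP.
Qed.

(* Main.v *)
Require Import Defs.
From mathcomp Require Import all_boot all_order all_algebra all_fingroup.
From mathcomp Require Import complex.
From mathcomp Require Import all_classical all_reals all_analysis.
From mathcomp Require Import ring lra zify.

Set Implicit Arguments.
Unset Strict Implicit.
Unset Printing Implicit Defensive.

Import Order.TTheory GRing.Theory Num.Theory.
Import numFieldNormedType.Exports.

Local Open Scope classical_set_scope.
Local Open Scope ring_scope.

(** Put q = e2pi t and let u = mu / l run over the torsion points, w = e2pi u
    being a power of zeta_l.

    Weight. Up to powers of 2 i pi, x and y are the values at u of the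
    Weierstrass function and of half its derivative:
      (2 i pi)^2 x(w, q) = sum over the lattice points p of
                           1/(u + p)^2 - 1/p^2,
      - (2 i pi)^3 y(w, q) = sum over the lattice points p of 1/(u + p)^3,
    for the lattice Z t + Z, where 1/p^2 is 0 for p = 0 (wpt_xser,
    off3_yser). The sums are computed by rows with the partial fractions of
    1/sin^2 and of its derivative (pfrac2P, pfrac3P). A matrix A of SL2(Z)
    permutes the lattice up to the homothety j = c t + d, so that x and y have
    the weights 2 and 3, the torsion point mu / l being sent to (c t + d) mu / l (xser_moebius,
    yser_moebius). On Gamma0(l) this is multiplication of mu by d, and
    reindexing the sum G_psi multiplies it by psi(d)^-1; for general A
    the point becomes a root of unity times a power of e2pi (t / l), at which
    x and y have power series expansions in e2pi (t / l) (xser_division,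
    yser_division). Therefore the numerator of J has the weight
    w k + w + 2 r with w = 2 or 3, which is 12 e_Delta by the choice of r
    (e_Delta_weight), and the characters of G_chi^k and G_(chi^-k) cancel.

    Discriminant. Delta = q exp (- 24 L(q)) with L the sum of the
    - log (1 - q^i), a power series (DeltaE): it has no zero, and its powers
    are units up to a power of q. It has weight 12 (Delta_moebius): the
    logarithmic derivative of Delta is the Eisenstein series of weight 2,
    whose transformation under t |-> -1/t has an anomaly, which is the
    difference between the summations by rows and by columns of 1/u^2
    (rows_sub_columns). The quotient J is thus invariant, holomorphic on the
    upper half-plane and, at every cusp, a power series in e2pi (t / l)
    divided by a power of e2pi (t / l).

    Coefficients. The coefficients of G_psi are combinations of powers of
    zeta_l with coefficients in Q(zeta_n) that the substitution of zeta_l by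
    zeta_l^a multiplies by psi(a)^-1 (equivariant_gauss).
    Such classes multiply like the characters (equivariantM), so that the
    coefficients of the numerator of J are invariant by these substitutions,
    and therefore in Q(zeta_n) (equivariant_trivial); those of 1 / Delta are
    rational. *)

(** * The real modulus and complex derivatives *)

Section Modulus.
Variable R : realType.
Implicit Types (x y z w : R[i]) (r s : R).

(** The norm of R[i] is itself an element of R[i]; this is the same number
    in R, where it can be used with the tactics for ordered fields. *)
Definition cabs z : R := complex.Re `|z|.

Lemma normcE_cabs z : `|z| = (cabs z)%:C%C.
Proof. by rewrite /cabs normc_def. Qed.

Lemma cabs_ge0 z : 0 <= cabs z.
Proof. by rewrite -lecR -normcE_cabs normr_ge0. Qed.

Lemma cabs0 : cabs 0 = 0. Proof. by rewrite /cabs normr0. Qed.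
Lemma cabs1 : cabs 1 = 1. Proof. by rewrite /cabs normr1. Qed.

Lemma cabsM z w : cabs (z * w) = cabs z * cabs w.
Proof. by apply: complexI; rewrite rmorphM -!normcE_cabs normrM. Qed.

Lemma cabsN z : cabs (- z) = cabs z. Proof. by rewrite /cabs normrN. Qed.

Lemma cabsBC z w : cabs (z - w) = cabs (w - z).
Proof. by rewrite -cabsN opprB. Qed.

Lemma cabs_eq0 z : (cabs z == 0) = (z == 0).
Proof. by rewrite -(normr_eq0 z) normcE_cabs -(inj_eq (@complexI R)). Qed.

Lemma cabs_gt0 z : (0 < cabs z) = (z != 0).
Proof. by rewrite lt_neqAle cabs_ge0 andbT eq_sym cabs_eq0. Qed.

Lemma cabsV z : cabs z^-1 = (cabs z)^-1.
Proof.
have [->|z0] := eqVneq z 0; first by rewrite invr0 cabs0 invr0.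
have c0 : cabs z != 0 by rewrite cabs_eq0.
by apply: (mulfI c0); rewrite -cabsM !mulfV ?cabs1.
Qed.

Lemma cabsX z n : cabs (z ^+ n) = cabs z ^+ n.
Proof. by elim: n => [|n IH]; rewrite ?cabs1 // !exprS cabsM IH. Qed.

Lemma cabsD z w : cabs (z + w) <= cabs z + cabs w.
Proof. by rewrite -lecR rmorphD -!normcE_cabs ler_normD. Qed.

Lemma cabsB z w : cabs (z - w) <= cabs z + cabs w.
Proof. by rewrite -(cabsN w) cabsD. Qed.

Lemma cabsB_ge z w : cabs z - cabs w <= cabs (z - w).
Proof. by have := cabsD (z - w) w; rewrite subrK; lra. Qed.

Lemma cabs_sum (I : Type) (s : seq I) (P : pred I) (F : I -> R[i]) :
  cabs (\sum_(i <- s | P i) F i) <= \sum_(i <- s | P i) cabs (F i).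
Proof.
elim/big_ind2: _ => [|a b c d h1 h2|//]; first by rewrite cabs0.
by apply: (le_trans (cabsD _ _)); rewrite lerD.
Qed.

Lemma cabsR r : cabs r%:C%C = `|r|.
Proof. by rewrite /cabs normc_def /= expr0n addr0 sqrtr_sqr. Qed.

Lemma cabs_nat n : cabs n%:R = n%:R.
Proof. by rewrite -(rmorph_nat (real_complex R)) cabsR normr_nat. Qed.

Lemma cabs_sqr z : cabs z ^+ 2 = complex.Re z ^+ 2 + complex.Im z ^+ 2.
Proof. by rewrite /cabs normc_def sqr_sqrtr // addr_ge0 ?sqr_ge0. Qed.

Lemma cabs_Re z : `|complex.Re z| <= cabs z.
Proof.
rewrite -(@ler_pXn2r _ 2) ?nnegrE ?cabs_ge0 // cabs_sqr real_normK ?num_real //.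
by rewrite lerDl sqr_ge0.
Qed.

Lemma cabs_Im z : `|complex.Im z| <= cabs z.
Proof.
rewrite -(@ler_pXn2r _ 2) ?nnegrE ?cabs_ge0 // cabs_sqr real_normK ?num_real //.
by rewrite lerDr sqr_ge0.
Qed.

Lemma cabs_i : cabs 'i%C = 1.
Proof. by rewrite /cabs normc_def /= expr0n add0r expr1n sqrtr1. Qed.

Lemma cabs_leReIm z : cabs z <= `|complex.Re z| + `|complex.Im z|.
Proof.
rewrite {1}[z]complexE; apply: (le_trans (cabsD _ _)).
by rewrite cabsM cabs_i mul1r !cabsR.
Qed.

Lemma cabs_lt_eq0 z : (forall e : R, 0 < e -> cabs z <= e) -> z = 0.
Proof.
move=> h; apply/eqP; rewrite -cabs_eq0 eq_le cabs_ge0 andbT.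
by apply/ler_addgt0Pr => e e0; rewrite add0r h.
Qed.

End Modulus.

Section ComplexDerivative.
Variable R : realType.
Implicit Types (f g F : R[i] -> R[i]) (z w h D E : R[i]) (e d : R).

(** The increment form of complex differentiability, with real moduli. *)
Definition cderiv_at f z D := forall e, 0 < e -> exists2 d, 0 < d &
  forall h, cabs h < d -> cabs (f (z + h) - f z - h * D) <= e * cabs h.

Lemma cderiv_ext f g z D (r : R) : 0 < r ->
  (forall h, cabs h < r -> f (z + h) = g (z + h)) ->
  cderiv_at f z D -> cderiv_at g z D.
Proof.
move=> r0 fg fD e /fD[d d0 hd]; exists (Num.min d r).
  by rewrite lt_min d0.
move=> h; rewrite lt_min => /andP[h1 h2].
have <- : f z = g z by rewrite -[z]addr0 fg // cabs0.
by rewrite -fg // hd.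
Qed.

Lemma cderiv_eq f g z D : f =1 g -> cderiv_at f z D -> cderiv_at g z D.
Proof. by move=> fg; apply: (cderiv_ext (r := 1)). Qed.

Lemma cderiv_cst (a z : R[i]) : cderiv_at (fun=> a) z 0.
Proof.
move=> e e0; exists 1 => // h _.
by rewrite mulr0 subr0 subrr cabs0 mulr_ge0 ?cabs_ge0 // ltW.
Qed.

Lemma cderiv_id z : cderiv_at id z 1.
Proof.
move=> e e0; exists 1 => // h _.
have -> : z + h - z - h * 1 = 0 by ring.
by rewrite cabs0 mulr_ge0 ?cabs_ge0 // ltW.
Qed.

Lemma cderivD f g z D E : cderiv_at f z D -> cderiv_at g z E ->
  cderiv_at (fun w => f w + g w) z (D + E).
Proof.
move=> fD gE e e0; have e2 : 0 < e / 2 by rewrite divr_gt0.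
have [d d0 hd] := fD _ e2; have [d' d0' hd'] := gE _ e2.
exists (Num.min d d') => [|h]; first by rewrite lt_min d0.
rewrite lt_min => /andP[/hd h1 /hd' h2].
have -> : f (z + h) + g (z + h) - (f z + g z) - h * (D + E) =
  (f (z + h) - f z - h * D) + (g (z + h) - g z - h * E) by ring.
by apply: (le_trans (cabsD _ _)); lra.
Qed.

Lemma cderiv_lip f z D : cderiv_at f z D -> exists2 d, 0 < d &
  forall h, cabs h < d -> cabs (f (z + h) - f z) <= (cabs D + 1) * cabs h.
Proof.
move=> /(_ 1 ltr01)[d d0 hd]; exists d => // h /hd h1.
have -> : f (z + h) - f z = (f (z + h) - f z - h * D) + h * D by ring.
by apply: (le_trans (cabsD _ _)); rewrite cabsM; lra.
Qed.

Lemma cderiv_cont f z D : cderiv_at f z D -> forall e, 0 < e -> exists2 d, 0 < d &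
  forall h, cabs h < d -> cabs (f (z + h) - f z) <= e.
Proof.
move=> /cderiv_lip[d d0 hd] e e0.
have K0 : 0 < cabs D + 1 by have := cabs_ge0 D; lra.
exists (Num.min d (e / (cabs D + 1))) => [|h].
  by rewrite lt_min d0 divr_gt0.
rewrite lt_min => /andP[/hd h1 h2]; apply: (le_trans h1).
by rewrite mulrC -ler_pdivlMr // ltW.
Qed.

Lemma cderivM f g z D E : cderiv_at f z D -> cderiv_at g z E ->
  cderiv_at (fun w => f w * g w) z (D * g z + f z * E).
Proof.
move=> fD gE e e0.
have [d1 d10 H1] := cderiv_lip fD.
have K0 : 0 < cabs D + 1 by have := cabs_ge0 D; lra.
have G0 : 0 < cabs (g z) + 1 by have := cabs_ge0 (g z); lra.
have F0 : 0 < cabs (f z) + 1 by have := cabs_ge0 (f z); lra.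
have e3 : 0 < e / 3 by rewrite divr_gt0.
have [d2 d20 H2] := cderiv_cont gE (divr_gt0 e3 K0).
have [d3 d30 H3] := fD _ (divr_gt0 e3 G0).
have [d4 d40 H4] := gE _ (divr_gt0 e3 F0).
exists (Num.min (Num.min d1 d2) (Num.min d3 d4)) => [|h].
  by rewrite !lt_min d10 d20 d30.
rewrite !lt_min => /andP[/andP[/H1 h1 /H2 h2] /andP[/H3 h3 /H4 h4]].
have -> : f (z + h) * g (z + h) - f z * g z - h * (D * g z + f z * E) =
  (f (z + h) - f z) * (g (z + h) - g z) + (f (z + h) - f z - h * D) * g z
  + f z * (g (z + h) - g z - h * E) by ring.
have hh := cabs_ge0 h.
have a1 : cabs ((f (z + h) - f z) * (g (z + h) - g z)) <= e / 3 * cabs h.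
  rewrite cabsM; apply: (le_trans (ler_pM (cabs_ge0 _) (cabs_ge0 _) h1 h2)).
  by rewrite le_eqVlt; apply/orP; left; apply/eqP; field; lra.
have a2 : cabs ((f (z + h) - f z - h * D) * g z) <= e / 3 * cabs h.
  rewrite cabsM.
  apply: (le_trans (ler_pM (cabs_ge0 _) (cabs_ge0 _) h3 (_ : _ <= cabs (g z) + 1))).
    lra.
  by rewrite le_eqVlt; apply/orP; left; apply/eqP; field; lra.
have a3 : cabs (f z * (g (z + h) - g z - h * E)) <= e / 3 * cabs h.
  rewrite cabsM.
  apply: (le_trans (ler_pM (cabs_ge0 _) (cabs_ge0 _) (_ : _ <= cabs (f z) + 1) h4)).
    lra.
  by rewrite le_eqVlt; apply/orP; left; apply/eqP; field; lra.
by apply: (le_trans (cabsD _ _)); have := cabsD ((f (z + h) - f z) * (g (z + h) - g z))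
  ((f (z + h) - f z - h * D) * g z); lra.
Qed.

Lemma cderivMl f z D (a : R[i]) : cderiv_at f z D ->
  cderiv_at (fun w => a * f w) z (a * D).
Proof.
by move=> /(cderivM (cderiv_cst a z)); rewrite mul0r add0r.
Qed.

Lemma cderiv_comp f g z D E : cderiv_at f z D -> cderiv_at g (f z) E ->
  cderiv_at (fun w => g (f w)) z (E * D).
Proof.
move=> fD gE e e0.
have [d1 d10 H1] := cderiv_lip fD.
have K0 : 0 < cabs D + 1 by have := cabs_ge0 D; lra.
have G0 : 0 < cabs E + 1 by have := cabs_ge0 E; lra.
have e3 : 0 < e / 2 by rewrite divr_gt0.
have [d2 d20 H2] := gE _ (divr_gt0 e3 K0).
have [d3 d30 H3] := cderiv_cont fD d20.
have [d4 d40 H4] := fD _ (divr_gt0 e3 G0).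
have [d5 d50 H5] := cderiv_cont fD (divr_gt0 d20 (ltr0Sn R 1)).
exists (Num.min d1 (Num.min d5 d4)) => [|h].
  by rewrite !lt_min d10 d50.
rewrite !lt_min => /andP[/H1 h1 /andP[/H5 h5 /H4 h4]].
set k := f (z + h) - f z in h1 h5 h4.
have kd : cabs k < d2 by apply: (le_lt_trans h5); lra.
have := H2 _ kd; have -> : f z + k = f (z + h) by rewrite /k; ring.
move=> h2.
have -> : g (f (z + h)) - g (f z) - h * (E * D) =
  (g (f (z + h)) - g (f z) - k * E) + E * (k - h * D) by ring.
apply: (le_trans (cabsD _ _)); rewrite cabsM.
have a1 : e / 2 / (cabs D + 1) * cabs k <= e / 2 * cabs h.
  rewrite -mulrA ler_pM2l // mulrC ler_pdivrMr // mulrC //.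
have a2 : cabs E * cabs (k - h * D) <= e / 2 * cabs h.
  apply: (le_trans (ler_pM (cabs_ge0 _) (cabs_ge0 _) (_ : _ <= cabs E + 1) h4)).
    lra.
  by rewrite le_eqVlt; apply/orP; left; apply/eqP; field; lra.
lra.
Qed.

Lemma cderiv_inv z : z != 0 -> cderiv_at GRing.inv z (- z ^- 2).
Proof.
move=> z0 e e0; have c0 : 0 < cabs z by rewrite cabs_gt0.
have c3 : 0 < cabs z ^+ 3 by rewrite exprn_gt0.
exists (Num.min (cabs z / 2) (e * cabs z ^+ 3 / 2)) => [|h].
  by rewrite lt_min !divr_gt0 // mulr_gt0.
rewrite lt_min => /andP[h1 h2].
have zh : cabs z / 2 < cabs (z + h).
  by have := cabsB_ge z (- h); rewrite cabsN opprK; lra.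
have zh0 : z + h != 0 by rewrite -cabs_gt0; lra.
have -> : (z + h)^-1 - z^-1 - h * (- z ^- 2) = h * (h / (z ^+ 2 * (z + h))).
  by field; rewrite z0 zh0.
rewrite cabsM mulrC ler_wpM2r ?cabs_ge0 // cabsM cabsV cabsM cabsX.
rewrite ler_pdivrMr; last by rewrite mulr_gt0 ?exprn_gt0 //; lra.
apply: (le_trans (ltW h2)).
have -> : e * cabs z ^+ 3 / 2 = e * (cabs z ^+ 2 * (cabs z / 2)) by field.
by rewrite ler_wpM2l ?ltW // ltr_pM2l // exprn_gt0.
Qed.

Lemma cderivV f z D : f z != 0 -> cderiv_at f z D ->
  cderiv_at (fun w => (f w)^-1) z (- (f z) ^- 2 * D).
Proof. by move=> f0 fD; apply: cderiv_comp fD (cderiv_inv f0). Qed.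

Lemma cderivN f z D : cderiv_at f z D -> cderiv_at (fun w => - f w) z (- D).
Proof.
move=> /(cderivMl (-1)); rewrite mulN1r; apply: cderiv_eq => w.
by rewrite mulN1r.
Qed.

Lemma cderivB f g z D E : cderiv_at f z D -> cderiv_at g z E ->
  cderiv_at (fun w => f w - g w) z (D - E).
Proof. by move=> fD /cderivN gE; apply: cderivD. Qed.

Lemma cderivX f z D n : cderiv_at f z D ->
  cderiv_at (fun w => f w ^+ n) z (n%:R * f z ^+ n.-1 * D).
Proof.
move=> fD; elim: n => [|n IH].
  by rewrite mul0r mul0r; apply: cderiv_cst.
have := cderivM fD IH.
have -> : D * f z ^+ n + f z * (n%:R * f z ^+ n.-1 * D) = n.+1%:R * f z ^+ n.+1.-1 * D.
  by case: n {IH} => [|n]; rewrite /= ?exprS -?(natr1 _ n.+1); ring.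
by apply: cderiv_eq => w; rewrite exprS.
Qed.

Lemma cderiv_derivable f z D : cderiv_at f z D -> complex_derivable f z.
Proof.
move=> fD; rewrite /complex_derivable /derivable.
apply/cvg_ex; exists (D : R[i]^o).
apply/cvgrPdist_le => /= eps eps0.
have [e ee] : exists e : R, eps = e%:C%C.
  have := gtr0_real eps0 => /complex_realP[e ->]; by exists e.
move: eps0; rewrite ee ltcR => e0.
have [d d0 hd] := fD _ e0.
exists d%:C%C => /=; first by rewrite ltcR.
move=> h; rewrite /= sub0r normrN normcE_cabs ltcR => hl h0.
have := hd _ hl.
rewrite normcE_cabs lecR => H.
have -> : D - h^-1 *: (f (h *: 1 + z) - f z) = - h^-1 * (f (z + h) - f z - h * D).
  rewrite /GRing.scale /= mulr1 [h + z]addrC.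
  by field.
rewrite cabsM cabsN cabsV mulrC ler_pdivrMr ?cabs_gt0 //.
Qed.

End ComplexDerivative.

(** * From real to complex derivatives *)

Section RealDerivatives.
Variable R : realType.

(** Links the derivatives of the real exponential, sine and cosine to the
    increment form used for complex functions. *)
Lemma is_derive_incr (f : R -> R) (x D : R) :
  is_derive x 1 f D <-> forall e, 0 < e -> exists2 d, 0 < d &
    forall h, `|h| < d -> `|f (x + h) - f x - h * D| <= e * `|h|.
Proof.
split.
- case=> fx fD e e0.
  have : (h^-1 *: ((f \o shift x) (h *: 1) - f x) @[h --> 0^']) --> D.
    by rewrite -fD; exact: fx.
  move=> /cvgrPdist_le /(_ e e0) [d /= d0 hd].
  exists d => // h hl; have [->|h0] := eqVneq h 0.
    by rewrite addr0 subrr mul0r subr0 normr0 mulr0.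
  have := hd h; rewrite /= sub0r normrN => /(_ hl h0).
  rewrite /GRing.scale /= mulr1 => H.
  have -> : f (x + h) - f x - h * D = - h * (D - h^-1 * (f (h + x) - f x)).
    by rewrite [h + x]addrC; field.
  by rewrite normrM normrN mulrC ler_wpM2r.
- move=> H.
  suff C : (h^-1 *: ((f \o shift x) (h *: 1) - f x) @[h --> 0^']) --> D.
    by apply: DeriveDef; [apply: (cvgP D C)|apply: (cvg_lim _ C)].
  apply/cvgrPdist_le => e e0; have [d d0 hd] := H e e0.
  exists d => //= h; rewrite /= sub0r normrN => /hd {}H h0.
  rewrite /GRing.scale /= mulr1.
  have -> : D - h^-1 * (f (h + x) - f x) = - h^-1 * (f (x + h) - f x - h * D).
    by rewrite [h + x]addrC; field.
  by rewrite normrM normrN normfV mulrC ler_pdivrMr // normr_gt0.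
Qed.

(** From sin t = 2 sin (t/2) cos (t/2) and the mean value theorem for the
    factor sin (t/2), every cosine involved being at least cos (pi/4). *)
Lemma sin_ge_half (t : R) : 0 <= t <= pi / 2 -> t / 2 <= sin t.
Proof.
move=> /andP[t0 t1]; have pi0 := pi_gt0 R.
have hpi : (pi / 2 : R) <= pi by lra.
have c4 : cos (pi / 4 : R) ^+ 2 = 1 / 2.
  have := cos_mulr2n (pi / 4 : R).
  have -> : (pi / 4 : R) *+ 2 = pi / 2 by rewrite -mulr_natr; field.
  by rewrite cos_pihalf -mulr_natr; lra.
have [||c cI] := @MVT_segment R sin cos 0 (t / 2).
- by rewrite divr_ge0.
- by apply: continuous_subspaceT; exact: continuous_sin.
rewrite sin0 !subr0 => Hs.
have lecos (x : R) : 0 <= x <= t / 2 -> cos (pi / 4) <= cos x.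
  move=> /andP[x0 x1]; rewrite leNgt ltr_cos; [rewrite -leNgt; lra| |];
    rewrite in_itv /=; apply/andP; split; lra.
have cc : cos (pi / 4) <= cos c by apply: lecos; move: cI; rewrite in_itv.
have ct : cos (pi / 4) <= cos (t / 2) by apply: lecos; lra.
have c40 : 0 <= cos (pi / 4 : R) by apply: cos_ge0_pihalf; lra.
have -> : t = (t / 2) *+ 2 by rewrite -mulr_natr; field.
rewrite sin_mulr2n Hs -[_ *+ 2]mulr_natr.
have : cos (pi / 4) * cos (pi / 4) <= cos (t / 2) * cos c by apply: ler_pM.
rewrite -expr2 c4 => H.
have -> : cos (t / 2) * (cos c * (t / 2)) *+ 2 = t * (cos (t / 2) * cos c).
  by rewrite -[LHS]mulr_natr; field.
have -> : t / 2 * 2 / 2 = t * (1 / 2) by field.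
by rewrite ler_wpM2l.
Qed.

End RealDerivatives.

Section ZeroDerivative.
Variable R : realType.

(** Along a segment a function with vanishing derivative is constant, by the
    mean value theorem for its real and imaginary parts. *)
Lemma cderiv0_segment (g : R[i] -> R[i]) (a b : R[i]) :
  (forall s : R, 0 <= s <= 1 -> cderiv_at g (a + s%:C%C * b) 0) ->
  g (a + b) = g a.
Proof.
move=> H.
have aux (P : R[i] -> R) : (forall z w, P (z - w) = P z - P w) ->
    (forall z, `|P z| <= cabs z) -> P (g (a + b)) = P (g a).
  move=> PB Pn; pose f (s : R) := P (g (a + s%:C%C * b)).
  have fd (s : R) : 0 <= s <= 1 -> is_derive s 1 f 0.
    move=> /H sd; apply/is_derive_incr => e e0.
    have B0 : 0 < cabs b + 1 by have := cabs_ge0 b; lra.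
    have [d d0 hd] := sd _ (divr_gt0 e0 B0).
    exists (d / (cabs b + 1)) => [|h hl]; first by rewrite divr_gt0.
    rewrite mulr0 subr0 /f -PB; apply: (le_trans (Pn _)).
    have := hd (h%:C%C * b); rewrite cabsM cabsR mulr0 subr0.
    have -> : a + s%:C%C * b + h%:C%C * b = a + (s + h)%:C%C * b.
      by rewrite rmorphD /=; ring.
    have hb : `|h| * cabs b <= `|h| * (cabs b + 1) by rewrite ler_wpM2l //; lra.
    move=> H1; apply: (le_trans (H1 _)).
      by apply: (le_lt_trans hb); rewrite -ltr_pdivlMr.
    by rewrite -mulrA ler_pM2l // mulrC ler_pdivrMr.
  have [|||c _] := @MVT_segment R f (fun=> 0) 0 1.
  - exact: ler01.
  - by move=> x; rewrite in_itv /= => /andP[x0 x1]; apply: fd; rewrite !ltW.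
  - apply: derivable_within_continuous => x; rewrite in_itv /= => /fd.
    by case.
  by rewrite mul0r /f rmorph1 rmorph0 mul1r mul0r addr0 => /eqP; rewrite subr_eq0 => /eqP.
apply/eqP; rewrite eq_complex; apply/andP; split; apply/eqP.
  by apply: (aux (@complex.Re R)) => [[? ?] [? ?]|z] //; exact: cabs_Re.
by apply: (aux (@complex.Im R)) => [[? ?] [? ?]|z] //; exact: cabs_Im.
Qed.

End ZeroDerivative.

(** * The complex exponential *)

Section ComplexExponential.
Variable R : realType.
Implicit Types (z w u : R[i]).

Lemma cexpE (x y : R) : cexp (x +i* y)%C = (expR x * cos y +i* (expR x * sin y))%C.
Proof. by rewrite /cexp /=; simpc. Qed.

Lemma cexp0 : cexp (0 : R[i]) = 1.
Proof. by rewrite (cexpE 0 0) expR0 cos0 sin0 mulr1 mulr0. Qed.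

Lemma cexpD z w : cexp (z + w) = cexp z * cexp w.
Proof.
case: z w => [a b] [c d].
have -> : (a +i* b)%C + (c +i* d)%C = ((a + c) +i* (b + d))%C by [].
rewrite !cexpE expRD cosD sinD; apply/eqP; rewrite eq_complex /=.
by apply/andP; split; apply/eqP; ring.
Qed.

Lemma cabs_cexp z : cabs (cexp z) = expR (complex.Re z).
Proof.
have E0 := expR_ge0 (complex.Re z).
apply/eqP; rewrite -(@eqrXn2 _ 2) ?cabs_ge0 ?expR_ge0 //; apply/eqP.
case: z E0 => a b /= E0; rewrite cabs_sqr cexpE /=.
by rewrite !exprMn -mulrDr cos2Dsin2 mulr1.
Qed.

Lemma cexp_neq0 z : cexp z != 0.
Proof. by rewrite -cabs_gt0 cabs_cexp expR_gt0. Qed.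

Lemma cexpN z : cexp (- z) = (cexp z)^-1.
Proof.
by apply: (mulfI (cexp_neq0 z)); rewrite -cexpD subrr cexp0 mulfV ?cexp_neq0.
Qed.

Lemma cexpMn z n : cexp (n%:R * z) = cexp z ^+ n.
Proof.
elim: n => [|n IH]; first by rewrite mul0r cexp0.
by rewrite exprS -IH -cexpD -natr1; congr cexp; ring.
Qed.

Lemma cexp_sum (I : Type) (s : seq I) (F : I -> R[i]) :
  cexp (\sum_(i <- s) F i) = \prod_(i <- s) cexp (F i).
Proof.
elim: s => [|a s IH]; first by rewrite !big_nil cexp0.
by rewrite !big_cons cexpD IH.
Qed.

Lemma cderiv_cexp0 : cderiv_at (@cexp R) 0 1.
Proof.
move=> e e0.
(* The real and imaginary parts of the remainder have two terms each, bounded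
   by e', 2 e', 2 e' and 2 e' times the modulus of the increment. *)
have [e' [e'0 e'e e'1]] : exists e' : R, [/\ 0 < e', e' <= e / 10 & e' <= 1 / 2].
  exists (Num.min (e / 10) (1 / 2)); split; last 2 first.
  - by rewrite ge_min lexx.
  - by rewrite ge_min lexx orbT.
  by rewrite lt_min !divr_gt0.
have [d1 d10 H1] := (is_derive_incr (@expR R) 0 _).1 (is_derive_expR 0) _ e'0.
have [d2 d20 H2] := (is_derive_incr (@sin R) 0 _).1 (is_derive_sin 0) _ e'0.
have [d3 d30 H3] := (is_derive_incr (@cos R) 0 _).1 (is_derive_cos 0) _ e'0.
exists (Num.min (Num.min d1 (Num.min d2 d3)) e') => [|h].
  by rewrite !lt_min d10 d20 d30 e'0.
rewrite !lt_min => /andP[/andP[hd1 /andP[hd2 hd3]] he].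
have xh := cabs_Re h; have yh := cabs_Im h.
case: h hd1 hd2 hd3 he xh yh => x y /= hd1 hd2 hd3 he xh yh.
rewrite add0r cexp0 mulr1.
have := H1 x (le_lt_trans xh hd1); have := H2 y (le_lt_trans yh hd2).
have := H3 y (le_lt_trans yh hd3).
rewrite !add0r expR0 sin0 cos0 oppr0 mulr0 !mulr1 !subr0 addr0 => h3 h2 h1.
set N := cabs _ in he xh yh |- *.
have N0 : 0 <= N := cabs_ge0 _.
have ex : `|expR x - 1| <= 2 * N.
  have := ler_normD (expR x - 1 - x) x; rewrite subrK.
  have : e' * `|x| <= 1 * `|x| by rewrite ler_wpM2r //; lra.
  lra.
have e'x : e' * `|x| <= e' * N by rewrite ler_wpM2l // ltW.
have e'y : e' * `|y| <= e' * N by rewrite ler_wpM2l // ltW.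
have cy : `|cos y| <= 1 by exact: cos_max.
apply: (le_trans (cabs_leReIm _)); rewrite cexpE /=.
have -> : expR x * cos y - 1 - x =
  (expR x - 1 - x) * cos y + (1 + x) * (cos y - 1) by ring.
have -> : expR x * sin y - 0 - y =
  expR x * (sin y - y) + (expR x - 1) * y by ring.
have a1 : `|(expR x - 1 - x) * cos y| <= e' * N.
  by rewrite normrM -[leRHS]mulr1 ler_pM //; lra.
have a2 : `|(1 + x) * (cos y - 1)| <= 2 * (e' * N).
  rewrite normrM ler_pM //; last lra.
  by apply: (le_trans (ler_normD _ _)); rewrite normr1; lra.
have a3 : `|expR x * (sin y - y)| <= 2 * (e' * N).
  rewrite normrM ler_pM //; last lra.
  by have := ler_normD (expR x - 1) 1; rewrite subrK normr1; lra.
have a4 : `|(expR x - 1) * y| <= 2 * (e' * N).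
  rewrite normrM; apply: (le_trans (ler_pM _ _ ex yh)) => //.
  rewrite -mulrA ler_pM2l //; rewrite ler_wpM2r //; lra.
have e'N : e' * N <= e / 10 * N by rewrite ler_wpM2r.
have eN : 0 <= e * N by rewrite mulr_ge0 // ltW.
have e10 : e / 10 * N = (e * N) / 10 by field.
have := ler_normD ((expR x - 1 - x) * cos y) ((1 + x) * (cos y - 1)).
have := ler_normD (expR x * (sin y - y)) ((expR x - 1) * y).
lra.
Qed.

Lemma cderiv_cexp z : cderiv_at (@cexp R) z (cexp z).
Proof.
have h0 : cderiv_at (fun w => w - z) z (1 - 0).
  exact: cderivB (cderiv_id z) (cderiv_cst z z).
rewrite subr0 in h0.
have : cderiv_at (@cexp R) (z - z) 1 by rewrite subrr; exact: cderiv_cexp0.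
move=> /(cderiv_comp h0) /(cderivMl (cexp z)); rewrite !mulr1.
by apply: cderiv_eq => w; rewrite -cexpD; congr cexp; ring.
Qed.

(** 2 i pi, which is written c below. *)
Definition tpi : R[i] := (2 * pi)%:C%C * 'i%C.

Lemma tpi_neq0 : tpi != 0.
Proof.
rewrite -cabs_gt0 cabsM cabs_i mulr1 cabsR normr_gt0 mulf_neq0 //.
by rewrite gt_eqF // pi_gt0.
Qed.

Lemma e2piE z : e2pi z = cexp (tpi * z). Proof. by []. Qed.

Lemma e2piD z w : e2pi (z + w) = e2pi z * e2pi w.
Proof. by rewrite !e2piE mulrDr cexpD. Qed.

Lemma e2piN z : e2pi (- z) = (e2pi z)^-1.
Proof. by rewrite !e2piE mulrN cexpN. Qed.

Lemma e2pi_neq0 z : e2pi z != 0. Proof. exact: cexp_neq0. Qed.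

Lemma e2piMn z n : e2pi (n%:R * z) = e2pi z ^+ n.
Proof. by rewrite !e2piE mulrCA cexpMn. Qed.

Lemma e2pi1 : e2pi (1 : R[i]) = 1.
Proof.
rewrite e2piE mulr1 /tpi.
have -> : (2 * pi)%:C%C * 'i%C = (0 +i* (2 * pi))%C :> R[i] by simpc.
by rewrite cexpE expR0 !mul1r mulr_natl cos2pi sin2pi.
Qed.

Lemma e2pi_half : e2pi (2^-1 : R[i]) = -1.
Proof.
rewrite e2piE /tpi.
have -> : (2 * pi)%:C%C * 'i%C / 2 = (0 +i* pi)%C :> R[i].
  rewrite rmorphM /= rmorph_nat.
  have -> : 2 * pi%:C%C * 'i%C / 2 = pi%:C%C * 'i%C :> R[i] by field.
  by simpc.
by rewrite cexpE expR0 !mul1r cospi sinpi; apply/eqP; rewrite eq_complex /= oppr0 !eqxx.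
Qed.

Lemma e2pi_nat n : e2pi (n%:R : R[i]) = 1.
Proof. by rewrite -[n%:R]mulr1 e2piMn e2pi1 expr1n. Qed.

Lemma e2pi_int (n : int) : e2pi (n%:~R : R[i]) = 1.
Proof.
case: n => n; first exact: e2pi_nat.
by rewrite NegzE rmorphN e2piN [e2pi _](e2pi_nat n.+1) invr1.
Qed.

Lemma e2piDint z (n : int) : e2pi (z + n%:~R) = e2pi z.
Proof. by rewrite e2piD e2pi_int mulr1. Qed.

Lemma cabs_e2pi z : cabs (e2pi z) = expR (- (2 * pi * complex.Im z)).
Proof.
rewrite e2piE cabs_cexp; congr expR; rewrite /tpi.
by case: z => a b /=; ring.
Qed.

Lemma cabs_e2pi_lt1 z : (cabs (e2pi z) < 1) = (0 < complex.Im z).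
Proof.
by rewrite cabs_e2pi expR_lt1 oppr_lt0 pmulr_rgt0 // mulr_gt0 ?pi_gt0.
Qed.

(** The real part of z reduces modulo 1 to some x with cos (2 pi x) = 1, and
    cosine is injective on [0, pi], which contains 2 pi x or 2 pi (1 - x). *)
Lemma e2pi_eq1 z : e2pi z = 1 -> exists n : int, z = n%:~R.
Proof.
move=> h.
have pi0 := pi_gt0 R.
have : cabs (e2pi z) = 1 by rewrite h cabs1.
rewrite cabs_e2pi -[RHS](@expR0 R) => /expR_inj /eqP.
rewrite oppr_eq0 mulf_eq0 mulf_eq0 pnatr_eq0 (gt_eqF pi0) /= => /eqP Iz.
pose n := Num.floor (complex.Re z); exists n.
have [n1 n2] : n%:~R <= complex.Re z /\ complex.Re z < n%:~R + 1.
  split; first exact: ge_floor.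
  by rewrite -[1]/(1%:~R) -rmorphD /=; exact: lt_succ_floor.
pose x := complex.Re z - n%:~R.
have zx : z = x%:C%C + n%:~R.
  rewrite /x rmorphB /= rmorph_int subrK; case: z Iz {h n n1 n2 x} => a b /= ->.
  by [].
suff x0 : x = 0 by rewrite zx x0 add0r.
have := h; rewrite zx e2piDint e2piE /tpi.
have -> : (2 * pi)%:C%C * 'i%C * x%:C%C = (0 +i* (2 * pi * x))%C :> R[i] by simpc.
rewrite cexpE expR0 !mul1r => /eqP; rewrite eq_complex /= => /andP[/eqP c1 _].
have x01 : 0 <= x /\ x < 1 by rewrite /x; split; lra.
have c0 := @cos0 R.
have [xh|xh] := lerP x (1 / 2).
  have : 2 * pi * x = 0.
    apply: (@cos_inj R); last by rewrite c1 c0.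
      rewrite in_itv /=; have -> : 2 * pi * x = pi * (2 * x) by ring.
      rewrite mulr_ge0 ?(ltW pi0) //=; last lra.
      by rewrite -[leRHS]mulr1 ler_pM2l //; lra.
    by rewrite in_itv /= lexx ltW.
  by move=> /eqP; rewrite !mulf_eq0 pnatr_eq0 (gt_eqF pi0) /= => /eqP.
suff : 2 * pi * (1 - x) = 0.
  by move=> /eqP; rewrite !mulf_eq0 pnatr_eq0 (gt_eqF pi0) /= => /eqP; lra.
apply: (@cos_inj R).
- rewrite in_itv /=; have -> : 2 * pi * (1 - x) = pi * (2 * (1 - x)) by ring.
  rewrite mulr_ge0 ?(ltW pi0) //=; last lra.
  by rewrite -[leRHS]mulr1 ler_pM2l //; lra.
- by rewrite in_itv /= lexx ltW.
have -> : 2 * pi * (1 - x) = - (2 * pi * x) + pi *+ 2 by rewrite -mulr_natr; ring.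
by rewrite cosD2pi cosN c1 c0.
Qed.

Lemma cderiv_e2pi z : cderiv_at (@e2pi R) z (tpi * e2pi z).
Proof.
have h := cderivMl tpi (cderiv_id z).
have := cderiv_comp h (cderiv_cexp (tpi * z)).
by rewrite mulr1 mulrC.
Qed.

(** A lower bound of |sin (pi u)| on the strip: for u = x + i y the square of
    the right-hand side is (e^(pi y) - e^(- pi y))^2 + 4 sin (pi x)^2, whose two
    terms are at least 4 y^2 and 4 x^2. *)
Lemma e2pi_sub_ge u : - (1 / 2) <= complex.Re u <= 1 / 2 ->
  2 * cabs u <= cabs (e2pi (u / 2) - e2pi (- (u / 2))).
Proof.
case: u => x y /= xh; have pi0 := pi_gt0 R; have pi2 := pi_ge2 R.
have e (s : R) : e2pi (s%:C%C * (x +i* y)%C / 2) =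
    (expR (- (s * pi * y)) * cos (s * pi * x) +i* (expR (- (s * pi * y)) * sin
      (s * pi * x)))%C.
  rewrite e2piE -cexpE /tpi; congr cexp.
  have -> : (2 * pi)%:C%C * 'i%C * (s%:C%C * (x +i* y)%C / 2) =
     (s * pi)%:C%C * 'i%C * (x +i* y)%C.
    by rewrite !rmorphM /= rmorph_nat; field.
  by apply/eqP; rewrite eq_complex /=; apply/andP; split; apply/eqP; ring.
have := e 1; have := e (-1); rewrite rmorphN rmorph1 !mul1r !mulN1r mulNr => -> ->.
rewrite mulNr opprK mulNr cosN sinN.
rewrite -(@ler_pXn2r _ 2) ?nnegrE ?cabs_ge0 ?mulr_ge0 ?cabs_ge0 // exprMn !cabs_sqr /=.
set a := expR (- _); set b := expR _; set C := cos _; set S := sin _.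
have ab : a * b = 1 by rewrite /a /b mulrC expRxMexpNx_1.
have CS : C ^+ 2 + S ^+ 2 = 1 by exact: cos2Dsin2.
have -> : (a * C - b * C) ^+ 2 + (a * S - b * - S) ^+ 2 =
   (a - b) ^+ 2 * (C ^+ 2 + S ^+ 2) + 4 * (a * b) * S ^+ 2 by ring.
rewrite ab CS !mulr1.
have hy : `|2 * y| <= `|a - b|.
  rewrite normrM ger0_norm //.
  suff H (t : R) : 0 <= t -> t <= expR t - expR (- t).
    have y1 : 2 * `|y| <= `|pi * y| by rewrite normrM (gtr0_norm pi0) ler_wpM2r.
    apply: (le_trans y1); apply: (le_trans (H _ (normr_ge0 _))).
    rewrite /a /b; have [p0|p0] := lerP 0 (pi * y).
      by rewrite distrC ger0_norm // ler_norm.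
    by rewrite ltr0_norm // opprK ler_norm.
  move=> t0; have := expR_ge1Dx t; have : expR (- t) <= 1 by rewrite expR_le1 oppr_le0.
  lra.
have hx : `|2 * x| <= `|2 * S|.
  rewrite !normrM ler_pM2l ?normr_gt0 // /S.
  have px : 0 <= `|x| by [].
  have x2 : `|x| <= 1 / 2 by rewrite ler_norml; lra.
  have := @sin_ge_half R (pi * `|x|).
  have -> : 0 <= pi * `|x| <= pi / 2.
    apply/andP; split; first by rewrite mulr_ge0 // ltW.
    by rewrite ler_pM2l //; lra.
  move=> /(_ isT); have : 2 * `|x| <= pi * `|x| by rewrite ler_wpM2r.
  move=> H1 H2; have H : `|x| <= sin (pi * `|x|) by lra.
  apply: (le_trans H); case: (ger0P x) => _; first exact: ler_norm.
  by rewrite mulrN sinN -(normrN (sin _)) ler_norm.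
have {}hx : `|2 * x| ^+ 2 <= `|2 * S| ^+ 2 by rewrite ler_pXn2r ?nnegrE.
have {}hy : `|2 * y| ^+ 2 <= `|a - b| ^+ 2 by rewrite ler_pXn2r ?nnegrE.
move: hx hy; rewrite !real_normK ?num_real //.
lra.
Qed.

End ComplexExponential.

(** * Unconditional sums *)

Section UnconditionalSums.
Variable R : realType.
Local Notation C := R[i].

(** Unconditional summability: the partial sums over finite duplicate-free
    lists converge along inclusion. *)
Definition hs (I : eqType) (F : I -> C) (s : C) := forall e : R, 0 < e ->
  exists A0 : seq I, forall A, uniq A -> {subset A0 <= A} ->
    cabs (\sum_(i <- A) F i - s) <= e.

Definition asum (I : eqType) (F : I -> C) := exists M : R, forall A, uniq A ->
  \sum_(i <- A) cabs (F i) <= M.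

Section Basic.
Variable I : eqType.
Implicit Types (F G : I -> C) (A B : seq I).

Lemma hs_unique F s t : hs F s -> hs F t -> s = t.
Proof.
move=> Fs Ft; apply/eqP; rewrite -subr_eq0; apply/eqP.
apply: cabs_lt_eq0 => e e0; have e2 : 0 < e / 2 by rewrite divr_gt0.
have [A hA] := Fs _ e2; have [B hB] := Ft _ e2.
have u := undup_uniq (A ++ B).
have k1 : cabs (\sum_(i <- undup (A ++ B)) F i - s) <= e / 2.
  by apply: hA => // x xA; rewrite mem_undup mem_cat xA.
have k2 : cabs (\sum_(i <- undup (A ++ B)) F i - t) <= e / 2.
  by apply: hB => // x xB; rewrite mem_undup mem_cat xB orbT.
set S := \sum_(i <- _) _ in k1 k2.
have -> : s - t = (S - t) - (S - s) by ring.
by apply: (le_trans (cabsB _ _)); lra.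
Qed.

Lemma hs_ext F G s : F =1 G -> hs F s -> hs G s.
Proof.
move=> FG Fs e /Fs[A hA]; exists A => B uB AB.
by rewrite -(eq_bigr _ (fun i _ => FG i)) hA.
Qed.

Lemma hs0 : hs (fun _ : I => 0) 0.
Proof. by move=> e e0; exists [::] => A _ _; rewrite big1 // subrr cabs0 ltW. Qed.

Lemma hsD F G s t : hs F s -> hs G t -> hs (fun i => F i + G i) (s + t).
Proof.
move=> Fs Gt e e0; have e2 : 0 < e / 2 by rewrite divr_gt0.
have [A hA] := Fs _ e2; have [B hB] := Gt _ e2.
exists (A ++ B) => E uE sE; rewrite big_split /=.
have -> : \sum_(i <- E) F i + \sum_(i <- E) G i - (s + t) =
  (\sum_(i <- E) F i - s) + (\sum_(i <- E) G i - t) by ring.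
apply: (le_trans (cabsD _ _)).
have h1 : cabs (\sum_(i <- E) F i - s) <= e / 2.
  by apply: hA => // x xA; apply: sE; rewrite mem_cat xA.
have h2 : cabs (\sum_(i <- E) G i - t) <= e / 2.
  by apply: hB => // x xA; apply: sE; rewrite mem_cat xA orbT.
lra.
Qed.

Lemma hsZ F s (a : C) : hs F s -> hs (fun i => a * F i) (a * s).
Proof.
move=> Fs e e0; have a0 : 0 < cabs a + 1 by have := cabs_ge0 a; lra.
have [A hA] := Fs _ (divr_gt0 e0 a0); exists A => B uB AB.
rewrite -mulr_sumr -mulrBr cabsM.
have := hA _ uB AB; rewrite ler_pdivlMr // => h.
apply: (le_trans _ h); rewrite mulrC ler_wpM2l ?cabs_ge0 //; lra.
Qed.

Lemma hsZr F s (a : C) : hs F s -> hs (fun i => F i * a) (s * a).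
Proof.
by move=> /(hsZ a); rewrite mulrC; apply: hs_ext => i; rewrite mulrC.
Qed.

Lemma hsN F s : hs F s -> hs (fun i => - F i) (- s).
Proof.
by move=> /(hsZ (-1)); rewrite mulN1r; apply: hs_ext => i; rewrite mulN1r.
Qed.

Lemma hsB F G s t : hs F s -> hs G t -> hs (fun i => F i - G i) (s - t).
Proof. by move=> Fs /hsN; exact: hsD. Qed.

Lemma hs_le F s (M : R) : hs F s ->
  (forall A, uniq A -> cabs (\sum_(i <- A) F i) <= M) -> cabs s <= M.
Proof.
move=> Fs FM; apply/ler_addgt0Pr => e e0.
have [A hA] := Fs _ e0; have u := undup_uniq A.
have h : cabs (\sum_(i <- undup A) F i - s) <= e.
  by apply: hA => // x xA; rewrite mem_undup.
have := FM _ u; set S := \sum_(i <- _) _ in h * => SM.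
have -> : s = S - (S - s) by ring.
by apply: (le_trans (cabsB _ _)); lra.
Qed.

Lemma hs_bound F s (M : R) : hs F s ->
  (forall A, uniq A -> \sum_(i <- A) cabs (F i) <= M) -> cabs s <= M.
Proof.
by move=> Fs FM; apply: (hs_le Fs) => A uA; apply: (le_trans (cabs_sum _ _ _)); exact: FM.
Qed.

Lemma sub_sum_split (V : nmodType) (F : I -> V) A B : uniq A -> uniq B -> {subset A <=
  B} ->
  \sum_(i <- B) F i = \sum_(i <- A) F i + \sum_(i <- [seq x <- B | x \notin A]) F i.
Proof.
move=> uA uB AB; rewrite (bigID (mem A)) /= -(big_filter B
  (mem A)) -[X in _ + X = _]big_filter; congr (_ + _).
apply: perm_big; apply: uniq_perm => //; first exact: filter_uniq.
move=> x; rewrite mem_filter -[mem A x]/(x \in A).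
by case xA : (x \in A) => //=; rewrite (AB _ xA).
Qed.

Lemma sub_sum_le (f : I -> R) A B : uniq A -> uniq B -> {subset A <= B} ->
  (forall i, 0 <= f i) -> \sum_(i <- A) f i <= \sum_(i <- B) f i.
Proof.
by move=> uA uB AB f0; rewrite (sub_sum_split _ uA uB AB) lerDl sumr_ge0.
Qed.

Lemma asum_ext F G : F =1 G -> asum F -> asum G.
Proof.
move=> FG [M h]; exists M => A uA.
by rewrite (eq_bigr (fun i => cabs (F i))) ?h // => i _; rewrite FG.
Qed.

Lemma asum_le F G (K : R) : (forall i, cabs (F i) <= K * cabs (G i)) ->
  asum G -> asum F.
Proof.
move=> FG [M h]; exists (`|K| * M) => A uA.
have h1 : \sum_(i <- A) cabs (F i) <= \sum_(i <- A) `|K| * cabs (G i).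
  apply: ler_sum => i _; apply: (le_trans (FG i)).
  by rewrite ler_wpM2r ?cabs_ge0 // ler_norm.
by apply: (le_trans h1); rewrite -mulr_sumr ler_wpM2l // h.
Qed.

Lemma asumD F G : asum F -> asum G -> asum (fun i => F i + G i).
Proof.
move=> [M h] [N k]; exists (M + N) => A uA.
apply: (le_trans _ (lerD (h _ uA) (k _ uA))); rewrite -big_split /=.
by apply: ler_sum => i _; exact: cabsD.
Qed.

Lemma asumZ F a : asum F -> asum (fun i => a * F i).
Proof. by apply: asum_le (cabs a) _ => i; rewrite cabsM. Qed.

Lemma asumN F : asum F -> asum (fun i => - F i).
Proof. by apply: asum_le 1 _ => i; rewrite cabsN mul1r. Qed.

Lemma asumB F G : asum F -> asum G -> asum (fun i => F i - G i).
Proof. by move=> aF /asumN; exact: asumD. Qed.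

Lemma hs_nonneg (f : I -> R) (M : R) : (forall i, 0 <= f i) ->
  (forall A, uniq A -> \sum_(i <- A) f i <= M) ->
  exists S : R, hs (fun i => (f i)%:C%C) S%:C%C.
Proof.
move=> f0 fM; pose E := [set x | exists2 A : seq I, uniq A & x = \sum_(i <- A) f i].
have Esup : has_sup E.
  split; first by exists 0, [::] => //; rewrite big_nil.
  by exists M => x [A uA ->]; exact: fM.
exists (sup E) => e e0.
have [x [A uA ->] hA] := sup_adherent e0 Esup.
exists A => B uB AB; rewrite -rmorph_sum -rmorphB cabsR.
have h1 : \sum_(i <- B) f i <= sup E by apply: ub_le_sup; [case: Esup|exists B].
have h2 := sub_sum_le uA uB AB f0.
by rewrite ler_norml; apply/andP; split; lra.
Qed.

(** Completeness, reduced to sums of nonnegative reals through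
    g = (g + |F|) - |F| for the real and imaginary parts g of F. *)
Lemma asum_hs F : asum F -> exists s, hs F s.
Proof.
move=> [M FM].
have [S0 h0] := hs_nonneg (fun i => cabs_ge0 (F i)) FM.
have aux (g : I -> R) : (forall i, `|g i| <= cabs (F i)) ->
    exists s, hs (fun i => (g i)%:C%C) s.
  move=> gF; have [|A uA|S hS] := @hs_nonneg (fun i => g i + cabs (F i)) (M + M).
  - by move=> i; have := gF i; rewrite ler_norml => /andP[]; lra.
  - apply: (le_trans _ (lerD (FM _ uA) (FM _ uA))); rewrite -big_split /=.
    by apply: ler_sum => i _; have := gF i; rewrite ler_norml => /andP[]; lra.
  exists (S%:C%C - S0%:C%C); apply: hs_ext (hsB hS h0) => i /=.
  by rewrite rmorphD /= addrK.
have [a ha] := aux (fun i => complex.Re (F i)) (fun i => cabs_Re _).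
have [b hb] := aux (fun i => complex.Im (F i)) (fun i => cabs_Im _).
exists (a + 'i%C * b); apply: hs_ext (hsD ha (hsZ 'i%C hb)) => i /=.
by rewrite -complexE.
Qed.

End Basic.

(** The range of h need not be decidable: this is by excluded middle. *)
Lemma preim_list (I J : eqType) (h : J -> I) (A : seq I) : injective h ->
  exists2 B : seq J, uniq B & forall j, (j \in B) = (h j \in A).
Proof.
move=> hi; elim: A => [|a A [B uB hB]]; first by exists [::].
have [[j hj]|na] := pselect (exists j, h j = a); last first.
  exists B => // j; rewrite hB inE; case: eqP => // hj.
  by case: na; exists j.
exists (if j \in B then B else j :: B); first by case: ifP => //= ->.
move=> j'; rewrite inE -hj (inj_eq hi).
case: ifP => jB; last by rewrite inE hB.
by rewrite hB; case: eqP => // ->; rewrite -hB jB.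
Qed.

Lemma preim_sum (V : nmodType) (I J : eqType) (h : J -> I)
  (F : I -> V) A B : injective h ->
  uniq A -> uniq B -> (forall j, (j \in B) = (h j \in A)) ->
  (forall i, F i != 0 -> exists j, h j = i) ->
  \sum_(i <- A) F i = \sum_(j <- B) F (h j).
Proof.
move=> hi uA uB hB F0.
have mA : {subset map h B <= A} by move=> x /mapP[j jB ->]; rewrite -hB.
have umB : uniq (map h B) by rewrite map_inj_uniq.
rewrite (sub_sum_split _ umB uA mA) big_map [X in _ + X = _]big1_seq ?addr0 // => i.
rewrite mem_filter => /and3P[_ ni iA]; apply/eqP; apply: contraNT ni => /F0[j ji].
by apply/mapP; exists j => //; rewrite hB ji.
Qed.

Lemma hs_reindex (I J : eqType) (h : J -> I) (F : I -> C) s : injective h ->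
  (forall i, F i != 0 -> exists j, h j = i) ->
  hs F s <-> hs (fun j => F (h j)) s.
Proof.
move=> hi F0; split=> H e /H[A hA].
  have [B uB hB] := preim_list A hi; exists B => E uE BE.
  have uN : uniq (map h E ++ [seq x <- undup A | x \notin map h E]).
    rewrite cat_uniq map_inj_uniq // uE filter_uniq ?undup_uniq // andbT /=.
    by apply/hasPn => x; rewrite mem_filter => /andP[].
  have sN : {subset A <= map h E ++ [seq x <- undup A | x \notin map h E]}.
    by move=> x xA; rewrite mem_cat mem_filter mem_undup xA andbT orbN.
  have := hA _ uN sN; rewrite big_cat big_map /=.
  rewrite [X in _ + X - _]big1_seq ?addr0 // => i.
  rewrite mem_filter mem_undup => /and3P[_ ni iA]; apply/eqP.
  apply: contraNT ni => /F0[j ji]; apply/mapP; exists j => //.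
  by apply: BE; rewrite hB ji.
exists (map h A) => E uE AE; have [B uB hB] := preim_list E hi.
rewrite (preim_sum hi uE uB hB F0); apply: hA => // j jA.
by rewrite hB AE // map_f.
Qed.

Lemma hs_bij (I J : eqType) (h : J -> I) (g : I -> J) (F : I -> C) s :
  cancel h g -> cancel g h -> hs F s <-> hs (fun j => F (h j)) s.
Proof.
by move=> hg gh; apply: hs_reindex; [exact: can_inj hg|move=> i _; exists (g i)].
Qed.

Lemma asum_inj (I J : eqType) (h : J -> I) (F : I -> C) : injective h ->
  asum F -> asum (fun j => F (h j)).
Proof.
move=> hi [M FM]; exists M => A uA.
by rewrite -(big_map h predT (fun i => cabs (F i))) FM // map_inj_uniq.
Qed.

Lemma asum_reindex (I J : eqType) (h : J -> I) (F : I -> C) : injective h ->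
  (forall i, F i != 0 -> exists j, h j = i) ->
  asum (fun j => F (h j)) -> asum F.
Proof.
move=> hi F0 [M FM]; exists M => A uA; have [B uB hB] := preim_list A hi.
rewrite (preim_sum (F := fun i => cabs (F i)) hi uA uB hB) ?FM // => i.
by rewrite cabs_eq0; exact: F0.
Qed.

(** Bounds by inverse powers of integers or of lattice points do not cover
    the term at 0, but a single term is harmless. *)
Lemma asum_point (I : eqType) (F : I -> C) i0 :
  asum (fun i => if i == i0 then 0 else F i) -> asum F.
Proof.
move=> aF; pose d i : C := if i == i0 then F i else 0.
have ad : asum d.
  apply: (@asum_reindex _ unit (fun=> i0)) => [[] [] //|i|].
    by rewrite /d; case: (eqVneq i i0) => [-> _|_]; [exists tt|rewrite eqxx].
  exists (cabs (d i0)) => A uA; case: A uA => [|[] [|[] A]] //= _.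
    by rewrite big_nil cabs_ge0.
  by rewrite big_seq1.
apply: asum_ext (asumD aF ad) => i; rewrite /d.
by case: eqP => _; rewrite ?addr0 ?add0r.
Qed.

Section Split.
Variables (I J1 J2 : eqType) (h1 : J1 -> I) (h2 : J2 -> I).
Hypotheses (h1i : injective h1) (h2i : injective h2).
Hypothesis h12 : forall j j', h1 j <> h2 j'.
Hypothesis h1h2 : forall i, (exists j, h1 j = i) \/ (exists j, h2 j = i).

Let F1 (F : I -> C) i := if `[< exists j, h1 j = i >] then F i else 0.
Let F2 (F : I -> C) i := if `[< exists j, h1 j = i >] then 0 else F i.

Let F1h F j : F (h1 j) = F1 F (h1 j).
Proof. by rewrite /F1 asboolT //; exists j. Qed.

Let F2h F j : F (h2 j) = F2 F (h2 j).
Proof. by rewrite /F2 asboolF // => -[j' /h12]. Qed.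

Let F1s F i : F1 F i != 0 -> exists j, h1 j = i.
Proof. by rewrite /F1; case: asboolP => //; rewrite eqxx. Qed.

Let F2s F i : F2 F i != 0 -> exists j, h2 j = i.
Proof. by rewrite /F2; case: asboolP; rewrite ?eqxx //; case: (h1h2 i). Qed.

Let F12 F i : F1 F i + F2 F i = F i.
Proof. by rewrite /F1 /F2; case: ifP; rewrite ?addr0 ?add0r. Qed.

(** A family over the disjoint union of the ranges of h1 and h2 is the sum
    of its truncations to these ranges, each of which can be reindexed. *)
Lemma hs_split F a b :
  hs (fun j => F (h1 j)) a -> hs (fun j => F (h2 j)) b -> hs F (a + b).
Proof.
move=> /(hs_ext (F1h F)) /(hs_reindex _ h1i (@F1s F)) A.
move=> /(hs_ext (F2h F)) /(hs_reindex _ h2i (@F2s F)) B.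
by apply: hs_ext (hsD A B); exact: F12.
Qed.

Lemma asum_split F :
  asum (fun j => F (h1 j)) -> asum (fun j => F (h2 j)) -> asum F.
Proof.
move=> /(asum_ext (F1h F)) /(asum_reindex h1i (@F1s F)) A.
move=> /(asum_ext (F2h F)) /(asum_reindex h2i (@F2s F)) B.
by apply: asum_ext (asumD A B); exact: F12.
Qed.

End Split.

(** A large rectangle approximates both the double sum and the sum of the
    row sums. *)
Lemma hs_fubini (I J : eqType) (F : I * J -> C) (r : I -> C) s :
  hs F s -> (forall i, hs (fun j => F (i, j)) (r i)) -> hs r s.
Proof.
move=> Fs Fr e e0; have e2 : 0 < e / 2 by rewrite divr_gt0.
have [A0 hA0] := Fs _ e2; exists (map fst A0) => A uA AA.
pose d := e / 2 / (size A).+1%:R.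
have d0 : 0 < d by rewrite !divr_gt0.
have [B uB [sB hB]] : exists2 B : seq J, uniq B & {subset map snd A0 <= B} /\
    (forall i, i \in A -> cabs (\sum_(j <- B) F (i, j) - r i) <= d).
  have [B0 hB0] : exists B0 : seq J, forall i, i \in A -> forall B, uniq B ->
      {subset B0 <= B} -> cabs (\sum_(j <- B) F (i, j) - r i) <= d.
    elim: (A) => [|a l [B0 hB0]]; first by exists [::].
    have [B1 hB1] := Fr a _ d0; exists (B0 ++ B1) => i.
    rewrite inE => /predU1P[->|il] B uB sB.
      by apply: hB1 => // x xB; apply: sB; rewrite mem_cat xB orbT.
    by apply: hB0 => // x xB; apply: sB; rewrite mem_cat xB.
  exists (undup (B0 ++ map snd A0)); first exact: undup_uniq.
  split=> [x xA|i iA]; first by rewrite mem_undup mem_cat xA orbT.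
  apply: hB0 => //; first exact: undup_uniq.
  by move=> x xA; rewrite mem_undup mem_cat xA.
have uAB : uniq [seq (i, j) | i <- A, j <- B].
  by apply: allpairs_uniq => // -[? ?] [? ?] _ _.
have sAB : {subset A0 <= [seq (i, j) | i <- A, j <- B]}.
  move=> [i j] ij; apply/allpairsP; exists (i, j); split=> //.
    by apply: AA; apply/mapP; exists (i, j).
  by apply: sB; apply/mapP; exists (i, j).
have := hA0 _ uAB sAB; rewrite big_allpairs_dep => h1.
have h2 : cabs (\sum_(i <- A) r i - \sum_(i <- A) \sum_(j <- B) F (i, j)) <= e / 2.
  rewrite -sumrB; apply: (le_trans (cabs_sum _ _ _)).
  have : \sum_(i <- A) cabs (r i - \sum_(j <- B) F (i, j)) <= \sum_(i <- A) d.
    rewrite !big_seq; apply: ler_sum => i iA; rewrite cabsBC; exact: hB.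
  move=> /le_trans; apply; rewrite big_const_seq count_predT iter_addr addr0.
  rewrite -[d *+ _]mulr_natr /d mulrAC ler_pdivrMr ?ltr0n // ler_wpM2l ?ltW //.
  by rewrite ltr_nat.
set S := \sum_(i <- A) \sum_(j <- B) _ in h1 h2.
have -> : \sum_(i <- A) r i - s = (\sum_(i <- A) r i - S) + (S - s) by ring.
by apply: (le_trans (cabsD _ _)); lra.
Qed.

Lemma hs_swap (I J : eqType) (F : I * J -> C) s :
  hs F s -> hs (fun p => F (p.2, p.1)) s.
Proof.
by move=> /(hs_bij (h := fun p : J * I => (p.2, p.1)) (g := fun p => (p.2, p.1)) F s);
  apply => -[].
Qed.

Lemma asum_row (I J : eqType) (F : I * J -> C) i :
  asum F -> asum (fun j => F (i, j)).
Proof. by apply: (asum_inj (h := fun j => (i, j))) => j j' []. Qed.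

Lemma asum_hs_fubini (I J : eqType) (F : I * J -> C) : asum F ->
  exists (r : I -> C) s, [/\ hs F s, forall i, hs (fun j => F (i, j)) (r i) & hs r s].
Proof.
move=> aF; have [s hF] := asum_hs aF.
have h i : exists r, hs (fun j => F (i, j)) r by apply: asum_hs; exact: asum_row.
have [r hr] := choice h.
by exists r, s; split=> //; exact: hs_fubini hF hr.
Qed.

(** A finite set of pairs is contained in a finite rectangle, so that it is
    enough to bound the rows by a summable family. *)
Lemma asum_pair (I J : eqType) (F : I * J -> C) (r : I -> C) : asum r ->
  (forall i A, uniq A -> \sum_(j <- A) cabs (F (i, j)) <= cabs (r i)) -> asum F.
Proof.
move=> [M rM] Fr; exists M => A uA.
pose A1 := undup (map fst A); pose A2 := undup (map snd A).
have uAB : uniq [seq (i, j) | i <- A1, j <- A2].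
  by apply: allpairs_uniq; rewrite ?undup_uniq // => -[? ?] [? ?] _ _.
have sAB : {subset A <= [seq (i, j) | i <- A1, j <- A2]}.
  move=> [i j] ij; apply/allpairsP; exists (i, j); rewrite !mem_undup; split=> //.
    by apply/mapP; exists (i, j).
  by apply/mapP; exists (i, j).
apply: (le_trans (sub_sum_le uA uAB sAB (fun _ => cabs_ge0 _))).
rewrite big_allpairs_dep; apply: (le_trans _ (rM A1 (undup_uniq _))).
by apply: ler_sum => i _; apply: Fr; exact: undup_uniq.
Qed.

Lemma asum_prod (I J : eqType) (F : I -> C) (G : J -> C) : asum F -> asum G ->
  asum (fun p : I * J => F p.1 * G p.2).
Proof.
move=> aF [M GM]; apply: (asum_pair (r := fun i => M%:C%C * F i)).
  exact: asumZ.
move=> i A uA; rewrite /= (eq_bigr (fun j => cabs (F i) * cabs (G j))); last first.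
  by move=> j _; rewrite cabsM.
rewrite -mulr_sumr cabsM cabsR mulrC ler_wpM2r ?cabs_ge0 //.
exact: le_trans (GM _ uA) (ler_norm _).
Qed.

Lemma hs_prod (I J : eqType) (F : I -> C) (G : J -> C) s t : asum F -> asum G ->
  hs F s -> hs G t -> hs (fun p : I * J => F p.1 * G p.2) (s * t).
Proof.
move=> aF aG Fs Gt; have [r [v [h1 h2 h3]]] := asum_hs_fubini (asum_prod aF aG).
have -> : s * t = v => //.
have h4 : hs (fun i => F i * t) v.
  apply: hs_ext h3 => i; apply: hs_unique (h2 i) _; exact: (hsZ (F i) Gt).
exact: hs_unique (hsZr t Fs) h4.
Qed.

Lemma hs_finite (I : eqType) (F : I -> C) (A : seq I) : uniq A ->
  (forall i, i \notin A -> F i = 0) -> hs F (\sum_(i <- A) F i).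
Proof.
move=> uA F0 e e0; exists A => B uB AB.
rewrite (sub_sum_split _ uA uB AB) addrC addKr big_seq big1 ?cabs0 ?ltW // => i.
by rewrite mem_filter => /andP[/F0].
Qed.

(** * Sums over the naturals and the integers *)

Lemma hs_nat_recl (F : nat -> C) s :
  hs (fun n => F n.+1) s -> hs F (F 0%N + s).
Proof.
move=> h; apply: (@hs_split nat unit nat (fun=> 0%N) succn) => //.
- by case=> [] [].
- exact: succn_inj.
- by case=> [|n]; [left; exists tt|right; exists n].
have := @hs_finite unit (fun=> F 0%N) [:: tt] isT; rewrite big_seq1; apply.
by case.
Qed.

Lemma hs_nat_shift (F : nat -> C) s :
  hs F s -> hs (fun n => F n.+1) (s - F 0%N).
Proof.
move=> h; have h' : hs (fun n => if n is 0%N then F 0%N else 0) (F 0%N).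
  have := @hs_finite nat (fun n => if n is 0%N then F 0%N else 0) [:: 0%N] isT.
  by rewrite big_seq1; apply; case.
have := hsB h h'; move=> /(@hs_reindex _ _ succn _ _ succn_inj) H.
apply: hs_ext (H _) => [n|i]; first by rewrite subr0.
by case: i => [|n]; rewrite ?subrr ?eqxx //; exists n.
Qed.

Lemma hs_nat_partial (F : nat -> C) s : hs F s -> forall e : R, 0 < e ->
  exists N, forall n, (N <= n)%N -> cabs (\sum_(0 <= i < n) F i - s) <= e.
Proof.
move=> Fs e /Fs[A hA]; exists (\max_(i <- A) i).+1 => n nN.
apply: hA; first exact: iota_uniq.
move=> x xA; rewrite mem_index_iota /=; apply: leq_trans nN; rewrite ltnS.
exact: (@leq_bigmax_seq _ A predT id).
Qed.

Lemma hs_cvg (F : nat -> C) s : hs F s ->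
  (series (F : nat -> R[i]^o) @ \oo --> (s : R[i]^o)).
Proof.
move=> Fs; apply/cvgrPdist_le => /= eps eps0.
have [e ee] : exists e : R, eps = e%:C%C.
  by have := gtr0_real eps0 => /complex_realP[e ->]; exists e.
move: eps0; rewrite ee ltcR => e0.
have [N hN] := hs_nat_partial Fs e0; exists N => // n /= nN.
by rewrite normcE_cabs lecR cabsBC; exact: hN.
Qed.

Lemma limn_cabs (u : nat -> C) (s : C) : (forall e : R, 0 < e ->
    exists N, forall n, (N <= n)%N -> cabs (u n - s) <= e) ->
  limn (u : nat -> R[i]^o) = s.
Proof.
move=> h; apply: (@cvg_lim R[i]^o) => //.
apply/cvgrPdist_le => /= eps eps0.
have [e ee] : exists e : R, eps = e%:C%C.
  by have := gtr0_real eps0 => /complex_realP[e ->]; exists e.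
move: eps0; rewrite ee ltcR => e0.
have [N hN] := h _ e0; exists N => // n /= nN.
by rewrite normcE_cabs lecR cabsBC; exact: hN.
Qed.

Lemma csum1_hs (u : nat -> C) s : hs (fun n => u n.+1) s -> csum1 u = s.
Proof.
move=> us; apply: limn_cabs => e e0.
have [N hN] := hs_nat_partial us e0; exists N => n nN.
by rewrite big_add1 /=; exact: hN.
Qed.

Lemma Negz_inj : injective Negz. Proof. by move=> ? ? []. Qed.

Lemma hs_int (F : int -> C) a b : hs (fun n : nat => F n%:Z) a ->
  hs (fun n => F (Negz n)) b -> hs F (a + b).
Proof.
apply: hs_split => //; [by move=> ? ? []|exact: Negz_inj|].
by case=> n; [left|right]; exists n.
Qed.

Lemma asum_int (F : int -> C) : asum (fun n : nat => F n%:Z) ->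
  asum (fun n => F (Negz n)) -> asum F.
Proof.
apply: asum_split => //; [by move=> ? ? []|exact: Negz_inj|].
by case=> n; [left|right]; exists n.
Qed.

Lemma hs_int_parity (F : int -> C) a b : hs (fun n : int => F (2 * n)) a ->
  hs (fun n => F (2 * n + 1)) b -> hs F (a + b).
Proof.
apply: hs_split; [by move=> ? ? ?; lia|by move=> ? ? ?; lia|by move=> ? ? ?; lia|].
move=> i; have := divz_eq i 2; have : (i %% 2)%Z = 0 \/ (i %% 2)%Z = 1 by lia.
by case=> -> e; [left|right]; exists (i %/ 2)%Z; rewrite {2}e; lia.
Qed.

Lemma hs_int_shift (F : int -> C) s (k : int) :
  hs F s <-> hs (fun n => F (n + k)) s.
Proof. by apply: (hs_bij (g := fun n => n - k)) => n; rewrite ?addrK ?subrK. Qed.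

Lemma hs_int_opp (F : int -> C) s : hs F s <-> hs (fun n => F (- n)) s.
Proof. by apply: (hs_bij (g := fun n => - n)) => n; rewrite opprK. Qed.

(** A telescoping sum over all integers is a difference of two limits, which
    need not cancel; applied to the cotangent, whose limits at the two ends of
    the imaginary direction are opposite, this is the source of the anomaly of
    the Eisenstein series of weight 2. *)
Lemma hs_int_telescope (F g : int -> C) s a b : hs F s ->
  (forall n, F n = g (n + 1) - g n) ->
  (forall e : R, 0 < e -> exists N, forall n : nat, (N <= n)%N ->
     cabs (g n%:Z - a) <= e /\ cabs (g (- n%:Z) - b) <= e) ->
  s = a - b.
Proof.
move=> Fs Fg gab; apply/eqP; rewrite -subr_eq0; apply/eqP.
apply: cabs_lt_eq0 => e e0; have e3 : 0 < e / 3 by rewrite divr_gt0.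
have [A hA] := Fs _ e3; have [N hN] := gab _ e3.
pose n := (N + (\max_(i <- A) `|i|%N).+1)%N.
pose B := [seq i%:Z - n%:Z | i <- iota 0 (n + n)].
have uB : uniq B by rewrite map_inj_uniq ?iota_uniq // => i j; lia.
have sB : {subset A <= B}.
  move=> x xA; have : (`|x| <= \max_(i <- A) `|i|)%N.
    exact: (@leq_bigmax_seq _ A predT (fun i : int => `|i|%N)).
  move=> hx; apply/mapP; exists (absz ((x : int) + n%:Z)); last by rewrite /n; lia.
  by rewrite mem_iota /n; lia.
have := hA _ uB sB; rewrite big_map.
have -> : \sum_(i <- iota 0 (n + n)) F (i%:Z - n%:Z) = g n%:Z - g (- n%:Z).
  have H m : \sum_(i <- iota 0 m) F (i%:Z - n%:Z) = g (m%:Z - n%:Z) - g (- n%:Z).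
    elim: m => [|m IH]; first by rewrite big_nil sub0r subrr.
    rewrite -[m.+1]addn1 iotaD big_cat IH big_seq1 /= add0n Fg.
    have -> : m%:Z - n%:Z + 1 = (m + 1)%N%:Z - n%:Z by lia.
    by ring.
  by rewrite H; congr (g _ - _); lia.
have [|h1 h2] := hN n; first by rewrite /n; lia.
move=> h3.
have -> : s - (a - b) = (g n%:Z - a) - (g (- n%:Z) - b) - (g n%:Z - g
  (- n%:Z) - s) by ring.
apply: (le_trans (cabsB _ _)).
by have := cabsB (g n%:Z - a) (g (- n%:Z) - b); lra.
Qed.

End UnconditionalSums.

(** * Geometric sums *)

Section GeometricSums.
Variable R : realType.
Local Notation C := R[i].

Lemma asum_nat_bounded (F : nat -> C) (M : R) :
  (forall n, \sum_(0 <= i < n) cabs (F i) <= M) -> asum F.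
Proof.
move=> FM; exists M => A uA.
apply: (le_trans _ (FM (\max_(i <- A) i).+1)).
apply: sub_sum_le => //; first exact: iota_uniq.
  move=> x xA; rewrite mem_index_iota /= ltnS.
  exact: (@leq_bigmax_seq _ A predT id).
by move=> i; exact: cabs_ge0.
Qed.

Lemma asum_geo (x : C) : cabs x < 1 -> asum (fun n => x ^+ n).
Proof.
move=> x1; have x0 := cabs_ge0 x.
apply: (@asum_nat_bounded _ (1 - cabs x)^-1) => n.
rewrite (eq_bigr (fun i => cabs x ^+ i)) => [|i _]; last by rewrite cabsX.
rewrite big_mkord -[leRHS]mul1r ler_pdivlMr ?subr_gt0 // mulrC.
have -> : (1 - cabs x) * (\sum_(i < n) cabs x ^+ i) = 1 - cabs x ^+ n.
  rewrite -[in RHS](expr1n _ n) subrXX; congr (_ * _).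
  by apply: eq_bigr => i _; rewrite expr1n mul1r.
by rewrite lerBlDr lerDl exprn_ge0.
Qed.

Lemma bernoulli (x : R) n : 0 <= x <= 1 -> 1 - n%:R * x <= (1 - x) ^+ n.
Proof.
move=> /andP[x0 x1]; elim: n => [|n IH]; first by rewrite mul0r subr0.
rewrite exprSr; have : (1 - n%:R * x) * (1 - x) <= (1 - x) ^+ n * (1 - x).
  by rewrite ler_wpM2r // subr_ge0.
apply: le_trans; rewrite -natr1.
have : 0 <= n%:R * x * x by rewrite !mulr_ge0.
by lra.
Qed.

(** By the inequality of Bernoulli rho <= r^(k+1) for some r < 1; one of the
    k + 1 factors r^n remains and each other one absorbs a factor n + 1. *)
Lemma poly_geo (rho : R) k : 0 <= rho < 1 -> exists K r : R,
  [/\ 0 <= r < 1, 0 <= K & forall n, n.+1%:R ^+ k * rho ^+ n <= K * r ^+ n].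
Proof.
move=> /andP[rho0 rho1]; pose d := (1 - rho) / k.+1%:R.
have k0 : 0 < k.+1%:R :> R by rewrite ltr0n.
have d0 : 0 < d by rewrite divr_gt0 // subr_gt0.
have d1 : d <= 1.
  rewrite ler_pdivrMr // mul1r; have : 1 <= k.+1%:R :> R by rewrite ler1n.
  lra.
pose r := 1 - d.
have r01 : 0 <= r < 1 by rewrite /r; apply/andP; split; lra.
have [r0 r1] := andP r01.
have rk : rho <= r ^+ k.+1.
  apply: (le_trans _ (bernoulli k.+1 (_ : 0 <= d <= 1))).
    by rewrite /d mulrC divfK ?gt_eqF //; lra.
  by rewrite ltW.
pose K := (1 / d) ^+ k; exists K, r; split=> //.
  by rewrite exprn_ge0 // divr_ge0 // ltW.
move=> n; have nr : n.+1%:R * r ^+ n <= 1 / d.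
  rewrite ler_pdivlMr // mulrC mulrA.
  have : (\sum_(i < n.+1) r ^+ i) * d <= 1.
    have -> : d = 1 - r by rewrite /r; ring.
    rewrite mulrC.
    have -> : (1 - r) * (\sum_(i < n.+1) r ^+ i) = 1 - r ^+ n.+1.
      rewrite -[in RHS](expr1n _ n.+1) subrXX; congr (_ * _).
      by apply: eq_bigr => i _; rewrite expr1n mul1r.
    by rewrite lerBlDr lerDl exprn_ge0.
  apply: le_trans; rewrite -mulrA [leLHS]mulrC ler_wpM2r ?(ltW d0) //.
  have -> : n.+1%:R * r ^+ n = \sum_(i < n.+1) r ^+ n.
    by rewrite sumr_const card_ord mulr_natl.
  by apply: ler_sum => i _; rewrite ler_wiXn2l // ?ltW // -ltnS.
have : n.+1%:R ^+ k * rho ^+ n <= n.+1%:R ^+ k * (r ^+ k.+1) ^+ n.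
  by rewrite ler_wpM2l ?exprn_ge0 // lerXn2r ?nnegrE ?exprn_ge0.
move=> /le_trans; apply.
have -> : n.+1%:R ^+ k * (r ^+ k.+1) ^+ n = (n.+1%:R * r ^+ n) ^+ k * r ^+ n.
  rewrite exprMn -[(r ^+ k.+1) ^+ n]exprM -[(r ^+ n) ^+ k]exprM mulSn exprD.
  by rewrite [(n * k)%N]mulnC; ring.
rewrite ler_wpM2r ?exprn_ge0 //.
rewrite lerXn2r ?nnegrE ?mulr_ge0 ?exprn_ge0 //; first by rewrite invr_ge0 ltW.
Qed.

Lemma asum_polygeo k (x : C) : cabs x < 1 -> asum (fun n => n.+1%:R ^+ k * x ^+ n).
Proof.
move=> x1; have [|K [r [/andP[r0 r1] K0 h]]] := @poly_geo (cabs x) k.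
  by rewrite cabs_ge0.
apply: (@asum_le _ _ _ (fun n => r%:C%C ^+ n) K); last first.
  by apply: asum_geo; rewrite cabsR ger0_norm.
by move=> n; rewrite cabsM !cabsX cabs_nat cabsR ger0_norm.
Qed.

Lemma sub1_neq0 (x : C) : cabs x < 1 -> 1 - x != 0.
Proof.
by move=> x1; rewrite subr_eq0; apply: contraTneq x1 => <-; rewrite cabs1 ltxx.
Qed.

Lemma hs_geo (x : C) : cabs x < 1 -> hs (fun n => x ^+ n) (1 - x)^-1.
Proof.
move=> x1; have x0 := sub1_neq0 x1.
have [s hx] := asum_hs (asum_geo x1).
have h2 : hs (fun n => x ^+ n.+1) (s - 1) := hs_nat_shift hx.
have h3 : hs (fun n => x ^+ n.+1) (x * s).
  by apply: hs_ext (hsZ x hx) => n; rewrite exprS.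
have e := hs_unique h2 h3.
suff -> : (1 - x)^-1 = s by [].
apply: (mulfI x0); rewrite mulfV //.
by rewrite mulrBl mul1r -e; ring.
Qed.

(** Abel summation: multiplication by 1 - x takes the differences of the
    coefficients. *)
Lemma hs_geo_diff (x : C) (a : nat -> C) s : cabs x < 1 ->
  asum (fun n => a n * x ^+ n) ->
  hs (fun n => (a n.+1 - a n) * x ^+ n) s -> a 0%N = 0 ->
  hs (fun n => a n.+1 * x ^+ n) (s / (1 - x)).
Proof.
move=> x1 aa hs1 a0; have [t ht] := asum_hs aa.
have h1 := hs_nat_shift ht; rewrite a0 mul0r subr0 in h1.
have h2 := hsD hs1 ht.
have {h2} h2 : hs (fun n => a n.+1 * x ^+ n) (s + t).
  by apply: hs_ext h2 => n; ring.
have h3 : hs (fun n => a n.+1 * x ^+ n.+1) (x * (s + t)).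
  by apply: hs_ext (hsZ x h2) => n; rewrite exprS; ring.
have e := hs_unique h1 h3.
suff -> : s / (1 - x) = s + t by [].
apply: (mulIf (sub1_neq0 x1)); rewrite divfK ?sub1_neq0 //.
by rewrite mulrBr mulr1 mulrC -e; ring.
Qed.

Lemma asum_polygeo0 k (x : C) : cabs x < 1 -> asum (fun n => n%:R ^+ k * x ^+ n).
Proof.
move=> /(asum_polygeo k); apply: (@asum_le _ _ _ _ 1) => n.
rewrite mul1r !cabsM ler_wpM2r ?cabs_ge0 // !cabsX !cabs_nat.
by rewrite lerXn2r ?nnegrE // ler_nat.
Qed.

Lemma hs_geo1 (x : C) : cabs x < 1 -> hs (fun n => n.+1%:R * x ^+ n) ((1 - x) ^- 2).
Proof.
move=> x1; have := @hs_geo_diff x (fun n => n%:R) (1 - x)^-1 x1.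
rewrite -expr2 exprVn; apply => //.
- by have := asum_polygeo0 1 x1.
- by apply: hs_ext (hs_geo x1) => n; rewrite -natr1; ring.
Qed.

Lemma hs_geo2 (x : C) : cabs x < 1 ->
  hs (fun n => n.+1%:R ^+ 2 * x ^+ n) ((1 + x) / (1 - x) ^+ 3).
Proof.
move=> x1; have x0 := sub1_neq0 x1.
have := @hs_geo_diff x (fun n => n%:R ^+ 2) (2 * (1 - x) ^- 2 - (1 - x)^-1) x1.
have -> : (2 * (1 - x) ^- 2 - (1 - x)^-1) / (1 - x) = (1 + x) / (1 - x) ^+ 3.
  by field.
apply; [exact: asum_polygeo0| |by rewrite expr0n].
apply: hs_ext (hsB (hsZ 2 (hs_geo1 x1)) (hs_geo x1)) => n.
by rewrite -natr1; ring.
Qed.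

(** By comparison with the telescoping series of 1/(n (n + 1)). *)
Lemma asum_inv_sq : asum (fun n => (n.+1%:R ^+ 2)^-1 : C).
Proof.
suff H : asum (fun n => (n.+1%:R * n.+2%:R)^-1 : C).
  apply: (@asum_le _ _ _ _ 2) H => n.
  rewrite !cabsV cabsX cabsM !cabs_nat.
  have n1 : 1 <= n.+1%:R :> R by rewrite ler1n.
  have -> : n.+2%:R = n.+1%:R + 1 :> R by rewrite natr1.
  rewrite -subr_ge0; set a := n.+1%:R in n1 *.
  have -> : 2 * (a * (a + 1))^-1 - a ^- 2 = (a - 1) / (a ^+ 2 * (a + 1)).
    by field; apply/andP; split; lra.
  by rewrite divr_ge0 ?mulr_ge0 ?exprn_ge0 //; lra.
apply: (@asum_nat_bounded _ 1) => n.
suff -> : \sum_(0 <= i < n) cabs ((i.+1%:R * i.+2%:R)^-1 : C) = 1 - n.+1%:R^-1.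
  by rewrite lerBlDr lerDl invr_ge0.
elim: n => [|n IH]; first by rewrite big_nil invr1 subrr.
rewrite big_nat_recr //= IH cabsV cabsM !cabs_nat.
have n1 : n.+1%:R != 0 :> R by rewrite pnatr_eq0.
have n2 : n.+2%:R != 0 :> R by rewrite pnatr_eq0.
have e : n.+2%:R = n.+1%:R + 1 :> R by rewrite natr1.
move: n1 n2; rewrite e; move: (n.+1%:R) => a n1 n2.
by field; rewrite ?n1 ?n2.
Qed.

Lemma asum_int_inv_sq : asum (fun n : int => (n%:~R ^+ 2)^-1 : C).
Proof.
apply: asum_int.
- apply: (@asum_reindex _ _ _ succn); first exact: succn_inj.
    case=> [|n]; last by exists n.
    by rewrite expr0n invr0 eqxx.
  exact: asum_inv_sq.
- apply: asum_ext asum_inv_sq => n.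
  by rewrite NegzE rmorphN sqrrN.
Qed.

End GeometricSums.

(** * The duplication trick of Herglotz *)

Section Herglotz.
Variable R : realType.
Local Notation C := R[i].
Implicit Types (u v : C).

(** The domain of the partial fraction expansions. *)
Definition nonint u := forall n : int, u <> n%:~R.

(** It meets every class modulo the integers, in points that have the least
    modulus of their class. *)
Definition strip u := - (1 / 2) <= complex.Re u <= 1 / 2.

Lemma Re_int (n : int) : complex.Re (n%:~R : C) = n%:~R.
Proof. by rewrite -(rmorph_int (real_complex R)). Qed.

Lemma Im_int (n : int) : complex.Im (n%:~R : C) = 0.
Proof. by rewrite -(rmorph_int (real_complex R)). Qed.

Lemma ReD u v : complex.Re (u + v) = complex.Re u + complex.Re v.
Proof. by case: u v => [? ?] [? ?]. Qed.

Lemma ImD u v : complex.Im (u + v) = complex.Im u + complex.Im v.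
Proof. by case: u v => [? ?] [? ?]. Qed.

Lemma int_norm_ge1 (n : int) : n != 0 -> 1 <= `|n%:~R| :> R.
Proof. by move=> n0; rewrite -intr_norm -[1]/(1%:~R) ler_int; lia. Qed.

Lemma strip_int u (n : int) : strip u -> n != 0 ->
  `|n%:~R| / 2 <= cabs (u + n%:~R) /\ cabs u <= cabs (u + n%:~R).
Proof.
move=> /andP[u1 u2] /int_norm_ge1 n1.
have Rn : `|n%:~R| - 1 / 2 <= `|complex.Re u + n%:~R|.
  have := lerB_normD (n%:~R) (complex.Re u); rewrite addrC.
  have : `|complex.Re u| <= 1 / 2 by rewrite ler_norml u1.
  by rewrite [n%:~R + _]addrC; lra.
split.
  have := cabs_Re (u + n%:~R); rewrite ReD Re_int; lra.
rewrite -(@ler_pXn2r _ 2) ?nnegrE ?cabs_ge0 // !cabs_sqr ReD ImD Re_int Im_int addr0.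
rewrite lerD2r -(real_normK (num_real (complex.Re u))).
rewrite -(real_normK (num_real (complex.Re u + n%:~R))) lerXn2r ?nnegrE //.
have : `|complex.Re u| <= 1 / 2 by rewrite ler_norml u1.
lra.
Qed.

Lemma strip_nonint u : strip u -> u != 0 -> nonint u.
Proof.
move=> us u0 n un; have n0 : - n != 0.
  by rewrite oppr_eq0; apply: contraNneq u0 => n0; rewrite un n0.
have [] := strip_int us n0; rewrite un -rmorphD subrr rmorph0 cabs0.
by have := int_norm_ge1 n0; lra.
Qed.

Lemma to_strip u : exists n : int, strip (u + n%:~R).
Proof.
exists (- Num.floor (complex.Re u + 1 / 2)); rewrite /strip ReD Re_int rmorphN /=.
have := ge_floor (complex.Re u + 1 / 2).
have := lt_succ_floor (complex.Re u + 1 / 2).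
by rewrite rmorphD /= => h1 h2; apply/andP; split; lra.
Qed.

Lemma nonintD u (n : int) : nonint u -> nonint (u + n%:~R).
Proof.
move=> nu m um; apply: (nu (m - n)); rewrite rmorphB /= -um; ring.
Qed.

Arguments nonintD {u} n _.

Lemma nonint_neq0 u (n : int) : nonint u -> u + n%:~R != 0.
Proof. by move=> nu; apply/eqP => h; have := nonintD n nu; move=> /(_ 0); exact. Qed.

Lemma nonint_half u : nonint u -> nonint (u / 2) /\ nonint ((u + 1) / 2).
Proof.
move=> nu; split=> n un.
  apply: (nu (n + n)); rewrite rmorphD /= -un; by field.
apply: (nu (n + n - 1)); rewrite rmorphB rmorphD /= -un; by field.
Qed.

(** The weight |u|^k compensates the extra powers of u + n, so that the terms
    other than n = 0 are dominated by those of the sum of 1/n^2, uniformly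
    on the strip. *)
Lemma strip_tail_bound k u (n : int) : strip u -> n != 0 ->
  cabs (((u + n%:~R) ^+ k.+2)^-1) * cabs u ^+ k <= 4 * cabs ((n%:~R ^+ 2)^-1 : C).
Proof.
move=> us n0; have [h1 h2] := strip_int us n0.
have n1 := int_norm_ge1 n0; have c0 : 0 < cabs (u + n%:~R) by lra.
rewrite !cabsV !cabsX -[in leRHS](rmorph_int (real_complex R)) cabsR.
set a := cabs (u + _) in h1 h2 c0 *; set b := cabs u in h2 *.
set m := `|_| in h1 n1 *.
have a1 : b ^+ k <= a ^+ k by rewrite lerXn2r ?nnegrE ?cabs_ge0 // ltW.
have -> : (a ^+ k.+2)^-1 * b ^+ k = (b ^+ k / a ^+ k) * (a ^+ 2)^-1.
  by rewrite -[k.+2]addn2 exprD invfM; ring.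
have a2 : b ^+ k / a ^+ k <= 1 by rewrite ler_pdivrMr ?exprn_gt0 // mul1r.
have a3 : (a ^+ 2)^-1 <= 4 * (m ^+ 2)^-1.
  have -> : 4 * (m ^+ 2)^-1 = ((m / 2) ^+ 2)^-1 by field; lra.
  rewrite lef_pV2 ?posrE ?exprn_gt0 //; last lra.
  by rewrite lerXn2r ?nnegrE //; lra.
rewrite -[leRHS]mul1r ler_pM //; first by rewrite divr_ge0 ?exprn_ge0 ?cabs_ge0 // ltW.
by rewrite invr_ge0 exprn_ge0 // ltW.
Qed.

Lemma asum_inv_strip k u : strip u -> u != 0 ->
  asum (fun n : int => ((u + n%:~R) ^+ k.+2)^-1).
Proof.
move=> us u0; have c0 : 0 < cabs u ^+ k by rewrite exprn_gt0 ?cabs_gt0.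
apply: (@asum_point R int _ 0).
apply: (@asum_le _ _ _ _ (4 / cabs u ^+ k) _ (asum_int_inv_sq R)) => n.
case: (eqVneq n 0) => [_|n0].
  by rewrite cabs0 mulr_ge0 ?divr_ge0 ?cabs_ge0 // ltW.
by rewrite mulrAC ler_pdivlMr // strip_tail_bound.
Qed.

Lemma asum_inv_pow k u : nonint u -> asum (fun n : int => ((u + n%:~R) ^+ k.+2)^-1).
Proof.
move=> nu; have [m um] := to_strip u.
have := asum_inv_strip k um (nonint_neq0 m nu).
move=> /(asum_inj (h := fun n : int => n - m)) H.
apply: asum_ext (H _) => [n|i j]; last by lia.
by rewrite rmorphB /=; congr (_ ^+ _)^-1; ring.
Qed.

(** Herglotz' trick: the difference of the two sides satisfies the same
    duplication formula, which halves any bound of the shape M |u|^(- k) on the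
    strip |Re u| <= 1/2. *)
Lemma herglotz k (f : C -> C) (M : R) :
  (forall u (n : int), f (u + n%:~R) = f u) ->
  (forall u, nonint u -> f u = (2 ^+ k.+2)^-1 * (f (u / 2) + f ((u + 1) / 2))) ->
  (forall u, strip u -> u != 0 -> cabs (f u - (u ^+ k.+2)^-1) * cabs u ^+ k <= M) ->
  forall u, nonint u -> hs (fun n : int => ((u + n%:~R) ^+ k.+2)^-1) (f u).
Proof.
move=> fper fdup fbnd.
have [S hS] : exists S : C -> C, forall u, nonint u ->
    hs (fun n : int => ((u + n%:~R) ^+ k.+2)^-1) (S u).
  have H u : exists s, nonint u -> hs (fun n : int => ((u + n%:~R) ^+ k.+2)^-1) s.
    have [nu|nnu] := pselect (nonint u); last by exists 0.
    by have [s hs1] := asum_hs (asum_inv_pow k nu); exists s.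
  by have [S hS] := choice H; exists S.
have Sper u (n : int) : nonint u -> S (u + n%:~R) = S u.
  move=> nu; apply: hs_unique (hS _ (nonintD n nu)) _.
  have := hS _ nu; move=> /(hs_int_shift _ _ n).1; apply: hs_ext => m.
  by rewrite rmorphD /=; congr (_ ^+ _)^-1; ring.
have Sdup u : nonint u -> S u = (2 ^+ k.+2)^-1 * (S (u / 2) + S ((u + 1) / 2)).
  move=> nu; have [nu2 nu3] := nonint_half nu.
  apply: hs_unique (hS _ nu) _; rewrite mulrDr; apply: hs_int_parity.
    apply: hs_ext (hsZ _ (hS _ nu2)) => n.
    by rewrite -invfM -exprMn; congr (_ ^+ _)^-1; rewrite rmorphM /=; field.
  apply: hs_ext (hsZ _ (hS _ nu3)) => n.
  by rewrite -invfM -exprMn; congr (_ ^+ _)^-1; rewrite rmorphD rmorphM /=; field.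
have [N hN] : exists N, forall u, strip u -> u != 0 ->
    cabs (S u - (u ^+ k.+2)^-1) * cabs u ^+ k <= N.
  have [N hN] := asum_int_inv_sq R.
  exists (4 * N) => u us u0; have nu := strip_nonint us u0.
  have c0 : 0 < cabs u ^+ k by rewrite exprn_gt0 ?cabs_gt0.
  pose d (n : int) : C := if n == 0 then (u ^+ k.+2)^-1 else 0.
  have hd : hs d (u ^+ k.+2)^-1.
    have := @hs_finite _ _ d [:: 0] isT; rewrite big_seq1 /d eqxx; apply=> i.
    by rewrite inE => /negPf ->.
  rewrite -ler_pdivlMr //; apply: (hs_bound (hsB (hS _ nu) hd)) => A uA.
  rewrite ler_pdivlMr // mulr_suml; apply: (le_trans _ (ler_wpM2l _ (hN A uA))) => //.
  rewrite mulr_sumr; apply: ler_sum => n _; rewrite /d.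
  case: (eqVneq n 0) => [->|n0]; last by rewrite subr0 strip_tail_bound.
  by rewrite addr0 subrr cabs0 mul0r mulr_ge0 ?cabs_ge0.
pose h u := f u - S u.
have hper u (n : int) : nonint u -> h (u + n%:~R) = h u by move=> nu;
  rewrite /h fper Sper.
have hdup u : nonint u -> h u = (2 ^+ k.+2)^-1 * (h (u / 2) + h ((u + 1) / 2)).
  by move=> nu; rewrite /h fdup // Sdup //; ring.
have hb j : forall u, strip u -> u != 0 -> cabs (h u) * cabs u ^+ k <= (M + N) / 2 ^+ j.
  elim: j => [|j IH] u us u0.
    rewrite expr0 divr1.
    have -> : h u = (f u - (u ^+ k.+2)^-1) - (S u - (u ^+ k.+2)^-1) by rewrite /h; ring.
    have c0 : 0 <= cabs u ^+ k by rewrite exprn_ge0 ?cabs_ge0.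
    have := ler_wpM2r c0 (cabsB (f u - (u ^+ k.+2)^-1) (S u - (u ^+ k.+2)^-1)).
    by have := fbnd _ us u0; have := hN _ us u0; rewrite mulrDl; lra.
  have nu := strip_nonint us u0.
  have u2 : strip (u / 2) /\ u / 2 != 0.
    split; last by rewrite mulf_neq0 ?invr_eq0 ?pnatr_eq0.
    have -> : u / 2 = (2^-1)%:C%C * u by rewrite fmorphV rmorph_nat mulrC.
    move: us; rewrite /strip; case: (u) => x y /=; rewrite mul0r subr0 => /andP[? ?].
    by apply/andP; split; lra.
  (* The point (u + 1) / 2 may be outside of the strip, but one of (u + 1) / 2
     and (u - 1) / 2 is in it. *)
  have [v [vs v0 vu hv]] : exists v, [/\ strip v, v != 0, cabs u <= 2 * cabs v &
      h ((u + 1) / 2) = h v].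
    have [e hv] : exists e : int, (e = 1 \/ e = -1) /\
        strip ((u + e%:~R) / 2) /\ h ((u + 1) / 2) = h ((u + e%:~R) / 2).
      have re (e : int) : complex.Re ((u + e%:~R) / 2) = (complex.Re u + e%:~R) / 2.
        have -> : (u + e%:~R) / 2 = (2^-1)%:C%C * (u + e%:~R).
          by rewrite fmorphV rmorph_nat mulrC.
        rewrite -(rmorph_int (real_complex R)).
        by case: (u) => x y /=; rewrite mul0r subr0 mulrC.
      have := us; rewrite /strip => /andP[us1 us2].
      have [ur|ur] := lerP (complex.Re u) 0.
        exists 1; split; first by left.
        split; last by [].
        by rewrite /strip re; apply/andP; split; lra.
      exists (-1); split; first by right.
      split; first by rewrite /strip re; apply/andP; split; lra.
      have [_ nu3] := nonint_half nu; rewrite -(hper _ (-1) nu3).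
      by congr h; rewrite rmorphN rmorph1; field.
    have e0 : e != 0 by lia.
    have [_ ue] := strip_int us e0.
    exists ((u + e%:~R) / 2); case: hv => _ [vs hv]; split=> //.
      by rewrite mulf_neq0 ?invr_eq0 ?pnatr_eq0 // nonint_neq0.
    rewrite cabsM cabsV cabs_nat mulrCA mulfV ?mulr1 //.
  case: u2 => u2s u20; have h1 := IH _ u2s u20; have h2 := IH _ vs v0.
  rewrite hdup // hv cabsM cabsV cabsX cabs_nat.
  have c0 : 0 <= cabs u ^+ k by rewrite exprn_ge0 ?cabs_ge0.
  have a1 : cabs (h (u / 2)) * cabs u ^+ k <= 2 ^+ k * ((M + N) / 2 ^+ j).
    have -> : cabs u ^+ k = 2 ^+ k * cabs (u / 2) ^+ k.
      by rewrite -exprMn cabsM cabsV cabs_nat mulrCA mulfV ?mulr1 // pnatr_eq0.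
    by rewrite mulrCA ler_wpM2l ?exprn_ge0.
  have a2 : cabs (h v) * cabs u ^+ k <= 2 ^+ k * ((M + N) / 2 ^+ j).
    apply: (le_trans (_ : _ <= cabs (h v) * (2 ^+ k * cabs v ^+ k))).
      rewrite ler_wpM2l ?cabs_ge0 // -exprMn lerXn2r ?nnegrE ?cabs_ge0 //.
      by rewrite mulr_ge0 ?cabs_ge0.
    by rewrite mulrCA ler_wpM2l ?exprn_ge0.
  have -> : (M + N) / 2 ^+ j.+1 = (2 ^+ k.+2)^-1 * (2 ^+ k *
    ((M + N) / 2 ^+ j) + 2 ^+ k * ((M + N) / 2 ^+ j)).
    have p0 : 2 ^+ k != 0 :> R by rewrite expf_neq0 // pnatr_eq0.
    have q0 : 2 ^+ j != 0 :> R by rewrite expf_neq0 // pnatr_eq0.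
    by rewrite !exprS; field; rewrite p0 q0.
  rewrite -mulrA ler_wpM2l ?invr_ge0 ?exprn_ge0 //.
  have := ler_wpM2r c0 (cabsD (h (u / 2)) (h v)); rewrite mulrDl; lra.
have h0 u : strip u -> u != 0 -> h u = 0.
  move=> us u0; have c0 : 0 < cabs u ^+ k by rewrite exprn_gt0 ?cabs_gt0.
  apply: cabs_lt_eq0 => e e0.
  have MN : 0 <= M + N.
    have := hb 0%N u us u0; rewrite expr0 divr1; apply: le_trans.
    by rewrite mulr_ge0 ?cabs_ge0 // ltW.
  have [j hj] : exists j, (M + N) / 2 ^+ j <= e * cabs u ^+ k.
    exists (Num.truncn ((M + N) / (e * cabs u ^+ k))).+1.
    have ec : 0 < e * cabs u ^+ k by rewrite mulr_gt0.
    rewrite ler_pdivrMr ?exprn_gt0 // mulrC -ler_pdivrMr //.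
    apply: (le_trans (ltW (truncnS_gt _))).
    set m := _.+1; rewrite -natrX ler_nat ltnW // ltn_expl //.
  by rewrite -(ler_pM2r c0); apply: (le_trans (hb j u us u0)).
move=> u nu; have [m um] := to_strip u.
have : h u = 0 by rewrite -(hper _ m nu) h0 // nonint_neq0.
by move=> /eqP; rewrite subr_eq0 => /eqP ->; exact: hS.
Qed.

End Herglotz.

(** * Partial fractions of the inverse powers of the sine *)

Section CotangentFamily.
Variable R : realType.
Local Notation C := R[i].
Local Notation c := (tpi R).
Implicit Types (u v s w : C).

(** The functions (pi / sin (pi u))^2, - 1/2 times its derivative, and
    pi cot (pi u), in terms of e2pi u. *)
Definition pfrac2 u : C := c ^+ 2 * (e2pi u / (1 - e2pi u) ^+ 2).
Definition pfrac3 u : C :=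
  - (c ^+ 3 / 2) * (e2pi u * (1 + e2pi u) / (1 - e2pi u) ^+ 3).
Definition pfrac1 u : C := c / 2 * ((e2pi u + 1) / (e2pi u - 1)).

(** 2 sinh s and cosh s; at s = c u / 2, pfrac2 and pfrac3 are c^2 / shd^2 and
    c^3 chh / shd^3. *)
Let shd s : C := cexp s - cexp (- s).
Let chh s : C := (cexp s + cexp (- s)) / 2.

Let shdK s : cexp s != 0 /\ cexp (- s) = (cexp s)^-1.
Proof. by rewrite cexp_neq0 cexpN. Qed.

Let shd_half s : shd s = 2 * shd (s / 2) * chh (s / 2).
Proof.
rewrite /shd /chh; have [s0 ->] := shdK (s / 2).
have -> : cexp s = cexp (s / 2) ^+ 2 by rewrite -cexpMn; congr cexp; field.
have -> : cexp (- s) = (cexp (s / 2)) ^- 2.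
  by rewrite -exprVn -cexpN -cexpMn; congr cexp; field.
by field.
Qed.

Let chh_half s : chh s - 1 = shd (s / 2) ^+ 2 / 2.
Proof.
rewrite /shd /chh; have [s0 ->] := shdK (s / 2).
have -> : cexp s = cexp (s / 2) ^+ 2 by rewrite -cexpMn; congr cexp; field.
have -> : cexp (- s) = (cexp (s / 2)) ^- 2.
  by rewrite -exprVn -cexpN -cexpMn; congr cexp; field.
by field.
Qed.

Let chh_sqr s : chh s ^+ 2 = 1 + shd s ^+ 2 / 4.
Proof. by rewrite /shd /chh; have [s0 ->] := shdK s; field. Qed.

Let cabs_half s : cabs (s / 2) = cabs s / 2.
Proof. by rewrite cabsM cabsV cabs_nat. Qed.

Let shd_lin (e : R) : 0 < e -> exists2 r : R, 0 < r &
  forall s, cabs s < r -> cabs (shd s - 2 * s) <= e * cabs s.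
Proof.
move=> e0.
have D0 := @cderiv_cexp0 R.
have D1 : cderiv_at (fun s => cexp (- s)) 0 (1 * -1 : C).
  apply: (cderiv_comp (f := fun s => - s) (g := @cexp R)).
    exact: cderivN (cderiv_id 0).
  by rewrite oppr0.
have [r r0 h] := cderivB D0 D1 e0; exists r => // s /h.
have -> // : shd s - 2 * s = cexp (0 + s) - cexp (- (0 + s)) -
  (cexp 0 - cexp (- 0)) - s * (1 - 1 * -1).
by rewrite oppr0 add0r /shd; ring.
Qed.

(** Third order contact of shd with its linear part, by iterated halving. *)
Let sh_taylor : exists2 r : R, 0 < r <= 1 / 2 & forall s, cabs s < r ->
  [/\ cabs (shd s - 2 * s) <= 2 * cabs s ^+ 3, cabs (shd s) <= 3 * cabs s &
      cabs (chh s - 1) <= 2 * cabs s ^+ 2].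
Proof.
have [r1 r10 h1] := shd_lin ltr01.
exists (Num.min r1 (1 / 2)).
  by rewrite lt_min r10 ge_min lexx orbT /= andbT divr_gt0.
have bs s : cabs s < r1 -> cabs (shd s) <= 3 * cabs s.
  move=> /h1; have := cabsD (shd s - 2 * s) (2 * s); rewrite subrK.
  by rewrite (cabsM 2) cabs_nat; lra.
have half s r : cabs s < r -> cabs (s / 2) < r.
  by rewrite cabs_half; have := cabs_ge0 s; lra.
have bc s : cabs s < r1 -> cabs (chh s - 1) <= 2 * cabs s ^+ 2.
  move=> /half /bs h2; rewrite chh_half cabsM cabsX cabsV cabs_nat.
  have : cabs (shd (s / 2)) ^+ 2 <= (3 * cabs (s / 2)) ^+ 2.
    by rewrite lerXn2r ?nnegrE ?cabs_ge0 ?mulr_ge0 ?cabs_ge0.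
  rewrite cabs_half; have := sqr_ge0 (cabs s); rewrite exprMn exprMn; lra.
move=> s; rewrite lt_min => /andP[sr s2]; split; [|exact: bs|exact: bc].
have step t : cabs t < r1 ->
    cabs (shd t - 2 * t) <= 2 * cabs (shd (t / 2) - 2 * (t / 2)) + 3 / 2 * cabs t ^+ 3.
  move=> tr; have -> : shd t - 2 * t = 2 * (shd (t / 2) - 2 * (t / 2)) +
      2 * shd (t / 2) * (chh (t / 2) - 1) by rewrite [shd t]shd_half; field.
  apply: (le_trans (cabsD _ _)); rewrite !cabsM !cabs_nat lerD2l.
  have := ler_pM (cabs_ge0 _) (cabs_ge0 _) (bs _ (half _ _ tr)) (bc _ (half _ _ tr)).
  rewrite cabs_half -mulrA; set a := cabs (shd _) * _.
  have -> : 3 * (cabs t / 2) * (2 * (cabs t / 2) ^+ 2) = 3 / 4 * cabs t ^+ 3 by field.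
  lra.
have main (e : R) j : forall t, cabs t < r1 ->
    cabs (shd (t / 2 ^+ j) - 2 * (t / 2 ^+ j)) <= e * cabs (t / 2 ^+ j) ->
    cabs (shd t - 2 * t) <= e * cabs t + 2 * cabs t ^+ 3.
  elim: j => [|j IH] t tr.
    rewrite expr0 divr1 => h; apply: (le_trans h).
    by rewrite lerDl mulr_ge0 // exprn_ge0 ?cabs_ge0.
  have -> : t / 2 ^+ j.+1 = t / 2 / 2 ^+ j by rewrite exprS invfM mulrA.
  move=> h; have := IH _ (half _ _ tr) h; have := step t tr; rewrite cabs_half.
  rewrite expr_div_n; lra.
apply/ler_addgt0Pr => e e0.
have [r2 r20 h2] := shd_lin e0.
have [j hj] : exists j, cabs (s / 2 ^+ j) < r2.
  exists (Num.truncn (cabs s / r2)).+1; rewrite cabsM cabsV cabsX cabs_nat.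
  rewrite ltr_pdivrMr ?exprn_gt0 // mulrC -ltr_pdivrMr //.
  apply: (lt_le_trans (truncnS_gt _)).
  by set m := _.+1; rewrite -natrX ler_nat ltnW // ltn_expl.
have := main e j s sr (h2 _ hj).
have : e * cabs s <= e * 1 by rewrite ler_wpM2l ?ltW //; lra.
by lra.
Qed.

Lemma nonint_e2pi u : nonint u -> 1 - e2pi u != 0.
Proof.
by move=> nu; rewrite subr_eq0 eq_sym; apply/eqP => /e2pi_eq1[n /nu].
Qed.

Let e2pi_shd u : exists2 s, s = c / 2 * u & [/\ e2pi u = cexp s ^+ 2,
  shd s = e2pi (u / 2) - e2pi (- (u / 2)) & cexp s != 0].
Proof.
exists (c / 2 * u) => //; split; last exact: cexp_neq0.
  by rewrite -cexpMn e2piE; congr cexp; field.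
by rewrite /shd !e2piE; congr (cexp _ - cexp _); field.
Qed.

Let pfrac2E u : nonint u -> pfrac2 u = c ^+ 2 / shd (c / 2 * u) ^+ 2.
Proof.
move=> nu; have [s <- [e _ s0]] := e2pi_shd u; have := nonint_e2pi nu.
rewrite /pfrac2 /shd e; have [_ ->] := shdK s => w0.
have h : cexp s - (cexp s)^-1 != 0.
  have -> : cexp s - (cexp s)^-1 = - (1 - cexp s ^+ 2) / cexp s by field.
  by rewrite mulf_neq0 ?oppr_eq0 ?invr_eq0.
have -> : cexp s - (cexp s)^-1 = - (1 - cexp s ^+ 2) / cexp s by field.
by field; rewrite ?s0 ?w0.
Qed.

Let pfrac3E u : nonint u -> pfrac3 u = c ^+ 3 * chh (c / 2 * u) / shd (c / 2 * u) ^+ 3.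
Proof.
move=> nu; have [s <- [e _ s0]] := e2pi_shd u; have := nonint_e2pi nu.
rewrite /pfrac3 /shd /chh e; have [_ ->] := shdK s => w0.
have -> : cexp s - (cexp s)^-1 = - (1 - cexp s ^+ 2) / cexp s by field.
by field; rewrite ?s0 ?w0.
Qed.

Let c0 : c != 0 := tpi_neq0 R.

Let small_u : exists2 d : R, 0 < d & forall u, cabs u < d -> u != 0 -> strip u ->
  let s := c / 2 * u in
  [/\ s != 0, shd s != 0, cabs s <= cabs (shd s), u = 2 * s / c &
  [/\ cabs (shd s - 2 * s) <= 2 * cabs s ^+ 3, cabs (shd s) <= 3 * cabs s &
      cabs (chh s - 1) <= 2 * cabs s ^+ 2]].
Proof.
have [r /andP[r0 r2] h] := sh_taylor; have k0 : 0 < cabs (c / 2).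
  by rewrite cabs_gt0 mulf_neq0 ?invr_eq0 ?pnatr_eq0.
exists (r / cabs (c / 2)) => [|u ud u0 us s]; first by rewrite divr_gt0.
have s0 : s != 0 by rewrite mulf_neq0 // -cabs_gt0.
have sr : cabs s < r by rewrite cabsM mulrC -ltr_pdivlMr.
have [h1 h2 h3] := h _ sr; have sp : 0 < cabs s by rewrite cabs_gt0.
have hs : cabs s <= cabs (shd s).
  have := cabsB_ge (2 * s) (shd s); rewrite cabsBC (cabsM 2) cabs_nat.
  have : cabs s ^+ 3 <= (1 / 4) * cabs s.
    rewrite exprSr ler_wpM2r ?(ltW sp) //.
    have -> : 1 / 4 = (1 / 2) ^+ 2 :> R by field.
    by rewrite lerXn2r ?nnegrE ?(ltW sp) //; lra.
  lra.
by split=> //; [rewrite -cabs_gt0; lra|rewrite /s; field].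
Qed.

Let strip_shd u : strip u -> 2 * cabs u <= cabs (shd (c / 2 * u)).
Proof.
by move=> us; have [s <- [_ -> _]] := e2pi_shd u; exact: e2pi_sub_ge.
Qed.

(** Near 0 by the third order contact of the sine with its linear part; away
    from 0 the sine is bounded below on the strip. *)
Let bound2 : exists M : R, forall u, strip u -> u != 0 ->
  cabs (pfrac2 u - (u ^+ 2)^-1) * cabs u ^+ 0 <= M.
Proof.
have [d d0 hd] := small_u; have k0 := cabs_ge0 c.
have kc : 0 < cabs c by rewrite cabs_gt0.
exists (10 / 4 * cabs c ^+ 2 + (cabs c ^+ 2 + 1) / d ^+ 2) => u us u0.
have nu := strip_nonint us u0; have up : 0 < cabs u by rewrite cabs_gt0.
have P1 : 0 <= 10 / 4 * cabs c ^+ 2 by rewrite mulr_ge0 ?exprn_ge0 ?divr_ge0.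
have P2 : 0 <= (cabs c ^+ 2 + 1) / d ^+ 2.
  by rewrite divr_ge0 ?addr_ge0 ?exprn_ge0 // ltW.
rewrite expr0 mulr1 pfrac2E //; have [ud|ud] := ltrP (cabs u) d.
  have [s0 D0 sD uE [h1 h2 h3]] := hd u ud u0 us; move: s0 D0 sD uE h1 h2 h3.
  set s := c / 2 * u; set D := shd s => s0 D0 sD uE h1 h2 h3.
  have -> : c ^+ 2 / D ^+ 2 - (u ^+ 2)^-1 =
      c ^+ 2 / 4 * ((2 * s - D) * (2 * s + D) / (D ^+ 2 * s ^+ 2)).
    by rewrite uE; field; rewrite ?s0 ?D0 ?c0.
  apply: (le_trans (_ : _ <= 10 / 4 * cabs c ^+ 2)); last lra.
  rewrite cabsM (cabsM (c ^+ 2)) cabsX cabsV cabs_nat.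
  have sp : 0 < cabs s by rewrite cabs_gt0.
  have Dp : 0 < cabs D by rewrite cabs_gt0.
  rewrite cabsM cabsV (cabsM (D ^+ 2)) !cabsX (cabsM (2 * s - D)) cabsBC.
  suff : cabs (D - 2 * s) * cabs (2 * s + D) / (cabs D ^+ 2 * cabs s ^+ 2) <= 10.
    move=> H; have : 0 <= cabs c ^+ 2 / 4 by rewrite divr_ge0 ?exprn_ge0.
    by move=> /ler_wpM2l /(_ _ _ H); lra.
  rewrite ler_pdivrMr ?mulr_gt0 ?exprn_gt0 //.
  have h4 : cabs (2 * s + D) <= 5 * cabs s.
    by apply: (le_trans (cabsD _ _)); rewrite (cabsM 2) cabs_nat; lra.
  apply: (le_trans (ler_pM (cabs_ge0 _) (cabs_ge0 _) h1 h4)).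
  have -> : 2 * cabs s ^+ 3 * (5 * cabs s) = 10 * (cabs s ^+ 2 * cabs s ^+ 2) by ring.
  rewrite ler_wpM2l // ler_wpM2r ?exprn_ge0 ?cabs_ge0 //.
  by rewrite lerXn2r ?nnegrE ?cabs_ge0.
have hD := strip_shd us; set D := shd _ in hD *.
apply: (le_trans (cabsB _ _)); rewrite cabsM !cabsV !cabsX.
have d2 : 0 < d ^+ 2 by rewrite exprn_gt0.
have a1 : (cabs D ^+ 2)^-1 <= (d ^+ 2)^-1.
  rewrite lef_pV2 ?posrE ?exprn_gt0 //; last lra.
  by rewrite lerXn2r ?nnegrE ?cabs_ge0 ?(ltW d0) //; lra.
have a2 : (cabs u ^+ 2)^-1 <= (d ^+ 2)^-1.
  rewrite lef_pV2 ?posrE ?exprn_gt0 //.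
  by rewrite lerXn2r ?nnegrE ?cabs_ge0 ?(ltW d0).
have := ler_wpM2l (exprn_ge0 2 k0) a1.
by rewrite mulrDl mul1r; lra.
Qed.

(** As for bound2; away from 0 the factor |u| is absorbed by one of the three
    factors 1/sin. *)
Let bound3 : exists M : R, forall u, strip u -> u != 0 ->
  cabs (pfrac3 u - (u ^+ 3)^-1) * cabs u ^+ 1 <= M.
Proof.
have [d d0 hd] := small_u; have k0 := cabs_ge0 c.
have kc : 0 < cabs c by rewrite cabs_gt0.
exists (54 / 4 * cabs c ^+ 2 + (cabs c ^+ 3 * (d ^- 2 + d^-1) + d ^- 2)) => u us u0.
have nu := strip_nonint us u0; have up : 0 < cabs u by rewrite cabs_gt0.
have P1 : 0 <= 54 / 4 * cabs c ^+ 2 by rewrite mulr_ge0 ?exprn_ge0 ?divr_ge0.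
have d1' : 0 <= d^-1 by rewrite invr_ge0 ltW.
have d2' : 0 <= d ^- 2 by rewrite invr_ge0 exprn_ge0 // ltW.
have P2 : 0 <= cabs c ^+ 3 * (d ^- 2 + d^-1) + d ^- 2.
  by rewrite addr_ge0 // mulr_ge0 ?addr_ge0 ?exprn_ge0.
rewrite expr1 pfrac3E //; have [ud|ud] := ltrP (cabs u) d.
  have [s0 D0 sD uE [h1 h2 h3]] := hd u ud u0 us; move: s0 D0 sD uE h1 h2 h3.
  set s := c / 2 * u; set D := shd s; set H := chh s => s0 D0 sD uE h1 h2 h3.
  have sp : 0 < cabs s by rewrite cabs_gt0.
  have Dp : 0 < cabs D by rewrite cabs_gt0.
  apply: (le_trans (_ : _ <= 54 / 4 * cabs c ^+ 2)); last lra.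
  rewrite -cabsM.
  have -> : (c ^+ 3 * H / D ^+ 3 - (u ^+ 3)^-1) * u =
      c ^+ 2 / 4 * ((8 * s ^+ 3 * (H - 1) + (2 * s - D) *
        (4 * s ^+ 2 + 2 * s * D + D ^+ 2))
        / (D ^+ 3 * s ^+ 2)).
    by rewrite uE; field; rewrite ?s0 ?D0 ?c0.
  rewrite cabsM (cabsM (c ^+ 2)) cabsX cabsV cabs_nat.
  set N := (X in X / (D ^+ 3 * _)).
  suff hN : cabs N <= 54 * cabs s ^+ 5.
    rewrite (cabsM N) cabsV (cabsM (D ^+ 3)) !cabsX.
    suff : cabs N / (cabs D ^+ 3 * cabs s ^+ 2) <= 54.
      move=> HH; have : 0 <= cabs c ^+ 2 / 4 by rewrite divr_ge0 ?exprn_ge0.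
      by move=> /ler_wpM2l /(_ _ _ HH); lra.
    rewrite ler_pdivrMr ?mulr_gt0 ?exprn_gt0 //; apply: (le_trans hN).
    rewrite ler_wpM2l // -[5%N]/(3 + 2)%N exprD ler_wpM2r ?exprn_ge0 ?cabs_ge0 //.
    by rewrite lerXn2r ?nnegrE ?cabs_ge0.
  have b1 : cabs (8 * s ^+ 3 * (H - 1)) <= 16 * cabs s ^+ 5.
    rewrite (cabsM (8 * s ^+ 3)) (cabsM 8) cabsX cabs_nat.
    have -> : 16 * cabs s ^+ 5 = 8 * cabs s ^+ 3 * (2 * cabs s ^+ 2) by ring.
    by rewrite ler_wpM2l // mulr_ge0 ?exprn_ge0 ?cabs_ge0.
  have b2 : cabs (4 * s ^+ 2 + 2 * s * D + D ^+ 2) <= 19 * cabs s ^+ 2.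
    apply: (le_trans (cabsD _ _)); have := cabsD (4 * s ^+ 2) (2 * s * D).
    rewrite (cabsM 4) (cabsM (2 * s)) (cabsM 2) !cabsX !cabs_nat.
    have : cabs s * cabs D <= cabs s * (3 * cabs s) by rewrite ler_wpM2l ?cabs_ge0.
    have : cabs D ^+ 2 <= (3 * cabs s) ^+ 2.
      by rewrite lerXn2r ?nnegrE ?mulr_ge0 ?cabs_ge0.
    rewrite exprMn; set a := cabs s; set b := cabs D.
    have -> : a * (3 * a) = 3 * a ^+ 2 by ring.
    have -> : 2 * a * b = 2 * (a * b) by ring.
    lra.
  have b3 : cabs ((2 * s - D) * (4 * s ^+ 2 + 2 * s * D + D ^+ 2)) <= 38 * cabs s ^+ 5.
    rewrite cabsM cabsBC.
    have -> : 38 * cabs s ^+ 5 = 2 * cabs s ^+ 3 * (19 * cabs s ^+ 2) by ring.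
    by rewrite ler_pM ?cabs_ge0.
  by apply: (le_trans (cabsD _ _)); lra.
have hD := strip_shd us; set D := shd _ in hD *; set H := chh _.
have Dp : 0 < cabs D by lra.
have hH : cabs H <= 1 + cabs D.
  have HD : H ^+ 2 = 1 + D ^+ 2 / 4 by exact: chh_sqr.
  have := cabsD 1 (D ^+ 2 / 4); rewrite -HD cabs1 cabsX cabsM cabsV cabsX cabs_nat.
  move=> h; have : cabs H ^+ 2 <= (1 + cabs D) ^+ 2.
    rewrite sqrrD expr1n mul1r; have := sqr_ge0 (cabs D).
    have : 0 <= cabs D *+ 2 by rewrite mulrn_wge0 // cabs_ge0.
    lra.
  by rewrite ler_pXn2r ?nnegrE ?addr_ge0 ?cabs_ge0.
apply: (le_trans (_ : _ <= cabs c ^+ 3 * (d ^- 2 + d^-1) + d ^- 2)); last lra.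
have := ler_wpM2r (ltW up) (cabsB (c ^+ 3 * H / D ^+ 3) (u ^+ 3)^-1).
move=> /le_trans; apply; rewrite mulrDl lerD //; last first.
  rewrite cabsV cabsX.
  have -> : (cabs u ^+ 3)^-1 * cabs u = (cabs u ^+ 2)^-1 by field; lra.
  rewrite lef_pV2 ?posrE ?exprn_gt0 //.
  by rewrite lerXn2r ?nnegrE ?cabs_ge0 ?(ltW d0).
rewrite (cabsM (c ^+ 3 * H)) (cabsM (c ^+ 3)) cabsV !cabsX.
have -> : cabs c ^+ 3 * cabs H * (cabs D ^+ 3)^-1 * cabs u =
  cabs c ^+ 3 * (cabs H * ((cabs D ^+ 3)^-1 * cabs u)) by ring.
rewrite ler_wpM2l ?exprn_ge0 //.
have a1 : cabs H * ((cabs D ^+ 3)^-1 * cabs u) <= (1 + cabs D) *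
  ((cabs D ^+ 3)^-1 * cabs D).
  apply: ler_pM; rewrite ?cabs_ge0 ?mulr_ge0 ?cabs_ge0 ?invr_ge0 ?exprn_ge0 ?cabs_ge0 //.
  rewrite ler_wpM2l ?invr_ge0 ?exprn_ge0 ?cabs_ge0 //; lra.
apply: (le_trans a1).
have -> : (1 + cabs D) * ((cabs D ^+ 3)^-1 * cabs D) = cabs D ^- 2 + (cabs D)^-1.
  by field; lra.
rewrite lerD // lef_pV2 ?posrE ?exprn_gt0 //; last lra.
by rewrite lerXn2r ?nnegrE ?cabs_ge0 ?(ltW d0) //; lra.
Qed.

Let e2pi_dup u : nonint u -> exists v, [/\ e2pi u = v ^+ 2, e2pi (u / 2) = v,
  e2pi ((u + 1) / 2) = - v, 1 - v != 0 & 1 + v != 0].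
Proof.
move=> nu; exists (e2pi (u / 2)); have e : e2pi u = e2pi (u / 2) ^+ 2.
  by rewrite -e2piMn; congr e2pi; field.
have := nonint_e2pi nu; rewrite e.
have -> : 1 - e2pi (u / 2) ^+ 2 = (1 - e2pi (u / 2)) * (1 + e2pi (u / 2)) by ring.
rewrite mulf_eq0 negb_or => /andP[h1 h2]; split=> //.
by rewrite mulrDl mul1r e2piD e2pi_half mulrN1.
Qed.

(** With v = e2pi (u / 2) the duplication formula is an identity between
    rational functions of v, since e2pi ((u + 1) / 2) = - v. *)
Lemma pfrac2P u : nonint u -> hs (fun n : int => ((u + n%:~R) ^+ 2)^-1) (pfrac2 u).
Proof.
have [M hM] := bound2; apply: (@herglotz R 0 pfrac2 M) => //.
  by move=> v n; rewrite /pfrac2 e2piDint.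
move=> v /e2pi_dup[x [h1 h2 h3 h4 h5]]; rewrite /pfrac2 h1 h2 h3.
have h6 : 1 - x ^+ 2 != 0.
  have -> : 1 - x ^+ 2 = (1 - x) * (1 + x) by ring.
  by rewrite mulf_neq0.
rewrite opprK; have -> : 1 - x ^+ 2 = (1 - x) * (1 + x) by ring.
by field; rewrite h4 h5.
Qed.

Lemma pfrac3P u : nonint u -> hs (fun n : int => ((u + n%:~R) ^+ 3)^-1) (pfrac3 u).
Proof.
have [M hM] := bound3; apply: (@herglotz R 1 pfrac3 M) => //.
  by move=> v n; rewrite /pfrac3 e2piDint.
move=> v /e2pi_dup[x [h1 h2 h3 h4 h5]]; rewrite /pfrac3 h1 h2 h3.
rewrite opprK; have -> : 1 - x ^+ 2 = (1 - x) * (1 + x) by ring.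
by field; rewrite h4 h5.
Qed.

Lemma pfrac2N u : pfrac2 (- u) = pfrac2 u.
Proof.
rewrite /pfrac2 e2piN; have w0 := e2pi_neq0 u; set w := e2pi u in w0 *.
have [->|w1] := eqVneq w 1; first by rewrite invr1.
have w2 : 1 - w != 0 by rewrite subr_eq0 eq_sym.
have -> : 1 - w^-1 = - (1 - w) / w by field.
by field; rewrite w0 w2.
Qed.

Lemma pfrac3N u : pfrac3 (- u) = - pfrac3 u.
Proof.
rewrite /pfrac3 e2piN; have w0 := e2pi_neq0 u; set w := e2pi u in w0 *.
have [->|w1] := eqVneq w 1; first by rewrite invr1 subrr expr0n invr0 !mulr0 oppr0.
have w2 : 1 - w != 0 by rewrite subr_eq0 eq_sym.
have -> : 1 - w^-1 = - (1 - w) / w by field.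
by field; rewrite w0 w2.
Qed.

(** The value of the sum of 1/n^2, by splitting off the odd n and evaluating
    at 1/2. *)
Lemma hs_int_inv_sq : hs (fun n : int => (n%:~R ^+ 2)^-1 : C) (- c ^+ 2 / 12).
Proof.
have [s hs1] := asum_hs (asum_int_inv_sq R).
suff -> : - c ^+ 2 / 12 = s by [].
have nh : nonint (2^-1 : C).
  move=> n /(congr1 (fun z => 2 * z)); rewrite mulfV ?pnatr_eq0 // => h.
  have : (1 = 2 * n) by apply: (@intr_inj C); rewrite rmorphM.
  lia.
have h2 := pfrac2P nh.
have e2 : pfrac2 2^-1 = - c ^+ 2 / 4.
  by rewrite /pfrac2 e2pi_half; field.
have : hs (fun n : int => (n%:~R ^+ 2)^-1 : C) (4^-1 * s + 4^-1 * pfrac2 2^-1).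
  apply: hs_int_parity.
    apply: hs_ext (hsZ 4^-1 hs1) => n.
    have -> : (2 * n)%:~R = 2 * n%:~R :> C by rewrite rmorphM.
    have [->|n0] := eqVneq (n%:~R : C) 0; last by field.
    by rewrite mulr0 expr0n invr0 mulr0.
  apply: hs_ext (hsZ 4^-1 h2) => n; rewrite rmorphD rmorphM /= -invfM.
  by congr (_^-1); field.
move=> /(hs_unique hs1); rewrite e2 => h.
have h4 : 4 * s = s - c ^+ 2 / 4 by rewrite {1}h; field.
have -> : s = (4 * s - s) / 3 by field.
by rewrite h4; field.
Qed.

End CotangentFamily.

(** * Partial fractions of the cotangent *)

Section Cotangent.
Variable R : realType.
Local Notation C := R[i].
Local Notation c := (tpi R).
Implicit Types (u v s w : C).

Lemma cderiv_pfrac1 v : nonint v -> cderiv_at (@pfrac1 R) v (- pfrac2 v).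
Proof.
move=> nv; have w1 := nonint_e2pi nv.
have w2 : e2pi v - 1 != 0 by rewrite -oppr_eq0 opprB.
have dN : cderiv_at (fun z => e2pi z + 1) v (c * e2pi v + 0).
  exact: cderivD (cderiv_e2pi v) (cderiv_cst 1 v).
have dD : cderiv_at (fun z => e2pi z - 1) v (c * e2pi v - 0).
  exact: cderivB (cderiv_e2pi v) (cderiv_cst 1 v).
have := cderivMl (c / 2) (cderivM dN (cderivV (f := fun z => e2pi z - 1) w2 dD)).
have -> // : c / 2 * ((c * e2pi v + 0) / (e2pi v - 1) +
   (e2pi v + 1) * (- (e2pi v - 1) ^- 2 * (c * e2pi v - 0))) = - pfrac2 v.
rewrite /pfrac2; have -> : 1 - e2pi v = - (e2pi v - 1) by ring.
by move: (e2pi v) w2 => w w2; field.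
Qed.

Lemma nonint_dist v : nonint v -> exists2 d : R, 0 < d &
  forall n : int, d <= cabs (v + n%:~R).
Proof.
move=> nv; have [m um] := to_strip v; have u0 := nonint_neq0 m nv.
exists (cabs (v + m%:~R)); first by rewrite cabs_gt0.
move=> n; have [->|nm] := eqVneq n m; first by [].
have nm0 : n - m != 0 by rewrite subr_eq0.
have [_ ] := strip_int um nm0.
have -> // : v + m%:~R + (n - m)%:~R = v + n%:~R.
by rewrite rmorphB /=; ring.
Qed.

Lemma asum_inv_diff u v : nonint u -> nonint v ->
  asum (fun n : int => (u + n%:~R)^-1 - (v + n%:~R)^-1).
Proof.
move=> nu nv; have [du du0 hu] := nonint_dist nu; have [dv dv0 hv] := nonint_dist nv.
have a1 := asum_inv_pow 0 nu; have a2 := asum_inv_pow 0 nv.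
pose G (n : int) : C := (cabs ((u + n%:~R) ^+ 2)^-1 + cabs ((v + n%:~R) ^+ 2)^-1)%:C%C.
have aG : asum G.
  have [M1 h1] := a1; have [M2 h2] := a2; exists (M1 + M2) => A uA.
  rewrite (eq_bigr (fun n : int => cabs ((u + n%:~R) ^+ 2)^-1 + cabs
    ((v + n%:~R) ^+ 2)^-1)).
    by rewrite big_split lerD // ?h1 ?h2.
  by move=> n _; rewrite cabsR ger0_norm // addr_ge0 ?cabs_ge0.
apply: (@asum_le _ _ _ _ (cabs (v - u)) _ aG) => n.
have un := nonint_neq0 n nu; have vn := nonint_neq0 n nv.
rewrite cabsR ger0_norm ?addr_ge0 ?cabs_ge0 //.
have -> : (u + n%:~R)^-1 - (v + n%:~R)^-1 = (v - u) * ((u + n%:~R)^-1 * (v + n%:~R)^-1).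
  by field; rewrite ?un ?vn.
rewrite cabsM ler_wpM2l ?cabs_ge0 // -!exprVn !cabsX cabsM.
set a := cabs _; set b := cabs _.
have := sqr_ge0 (a - b); have := sqr_ge0 a; have := sqr_ge0 b.
by rewrite sqrrB -mulr_natr; lra.
Qed.

(** The partial fractions of the cotangent, by integrating those of its
    derivative along a segment that avoids the poles. *)
Lemma pfrac1P a b : (forall s : R, 0 <= s <= 1 -> nonint (a + s%:C%C * b)) ->
  hs (fun n : int => (a + b + n%:~R)^-1 - (a + n%:~R)^-1) (pfrac1 (a + b) - pfrac1 a).
Proof.
move=> nab.
have na : nonint a by have := nab 0; rewrite mul0r addr0 lexx ler01; exact.
have nb : nonint (a + b) by have := nab 1; rewrite mul1r lexx ler01; exact.
have [T hT] : exists T : C -> C, forall v, nonint v ->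
    hs (fun n : int => (v + n%:~R)^-1 - (a + n%:~R)^-1) (T v).
  have H v : exists s, nonint v -> hs (fun n : int => (v + n%:~R)^-1 - (a + n%:~R)^-1) s.
    have [nv|nnv] := pselect (nonint v); last by exists 0.
    by have [s hs1] := asum_hs (asum_inv_diff nv na); exists s.
  by have [T hT] := choice H; exists T.
have Ta : T a = 0.
  by apply: hs_unique (hT a na) _; apply: hs_ext (@hs0 R _) => n; rewrite subrr.
have dT v : nonint v -> cderiv_at T v (- pfrac2 v).
  move=> nv e e0; have [d d0 hd] := nonint_dist nv.
  have [M hM] := asum_inv_pow 0 nv.
  have M0 : 0 <= M by have := hM [::] isT; rewrite big_nil.
  have K0 : 0 < 2 / d * M + 1 by rewrite ltr_wpDl // mulr_ge0 // divr_ge0 // ltW.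
  exists (Num.min (d / 2) (e / (2 / d * M + 1))) => [|h].
    by rewrite lt_min !divr_gt0.
  rewrite lt_min => /andP[h1 h2].
  have vh (n : int) : cabs (v + n%:~R) / 2 <= cabs (v + h + n%:~R).
    have := cabsB_ge (v + n%:~R) (- h); rewrite cabsN opprK.
    have -> : v + n%:~R + h = v + h + n%:~R by ring.
    by have := hd n; lra.
  have nvh : nonint (v + h).
    move=> n vn; have := vh (- n); have := hd (- n).
    by rewrite vn -rmorphD subrr rmorph0 cabs0; lra.
  have := hsD (hsB (hT _ nvh) (hT _ nv)) (hsZ h (pfrac2P nv)) => hF.
  have -> : T (v + h) - T v - h * - pfrac2 v = T (v + h) - T v + h * pfrac2 v by ring.
  have : cabs (T (v + h) - T v + h * pfrac2 v) <= cabs h ^+ 2 * (2 / d) * M.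
    apply: (hs_bound hF) => A uA; apply: (le_trans _ (ler_wpM2l _ (hM A uA))).
      rewrite mulr_sumr; apply: ler_sum => n _.
      have n1 := nonint_neq0 n nv; have n2 := nonint_neq0 n nvh.
      have -> : (v + h + n%:~R)^-1 - (a + n%:~R)^-1 - ((v + n%:~R)^-1 - (a + n%:~R)^-1) +
         h / (v + n%:~R) ^+ 2 = h ^+ 2 / (v + h + n%:~R) * ((v + n%:~R) ^+ 2)^-1.
        move: (a + n%:~R)^-1 => z.
        have -> : v + h + n%:~R = (v + n%:~R) + h by ring.
        have n3 : v + n%:~R + h != 0 by have := n2; rewrite addrAC.
        by move: (v + n%:~R) n1 n3 => y n1 n3; field; rewrite ?n1 ?n3.
      rewrite cabsM ler_wpM2r ?cabs_ge0 // cabsM cabsX cabsV ler_wpM2l ?exprn_ge0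
        ?cabs_ge0 //.
      rewrite -[2 / d]invrK lef_pV2 ?posrE ?invr_gt0 ?divr_gt0 ?cabs_gt0 //.
      by rewrite invf_div; have := vh n; have := hd n; lra.
    by rewrite mulr_ge0 ?exprn_ge0 ?cabs_ge0 // divr_ge0 // ltW.
  move=> /le_trans; apply.
  have -> : cabs h ^+ 2 * (2 / d) * M = (cabs h * (2 / d * M)) * cabs h by ring.
  rewrite ler_wpM2r ?cabs_ge0 //.
  have : cabs h * (2 / d * M + 1) <= e by rewrite -ler_pdivlMr // ltW.
  by have := cabs_ge0 h; lra.
have := @cderiv0_segment R (fun v => T v - pfrac1 v) a b.
have H (s : R) : 0 <= s <= 1 -> cderiv_at (fun v => T v - pfrac1 v) (a + s%:C%C * b) 0.
  move=> s01; have ns := nab s s01.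
  by have := cderivB (dT _ ns) (cderiv_pfrac1 ns); rewrite subrr.
move=> /(_ H); rewrite Ta sub0r => e.
have -> : pfrac1 (a + b) - pfrac1 a = T (a + b) by rewrite -e; ring.
exact: hT.
Qed.

End Cotangent.

(** * Lattice sums *)

Section LatticeSums.
Variable R : realType.
Local Notation C := R[i].
Local Notation c := (tpi R).
Implicit Types (u v s w tau : C).

(** The row i is dominated by a telescoping series, with a sum of the order
    of 1/(i + 1)^2. *)
Lemma asum_nat2_inv_cube :
  asum (fun p : nat * nat => ((p.1 + p.2).+1%:R ^+ 3)^-1 : C).
Proof.
apply: (@asum_pair _ _ _ _ (fun i => 3 * (i.+1%:R ^+ 2)^-1)).
  exact: asumZ (asum_inv_sq R).
move=> i A uA /=.
apply: (le_trans (_ : _ <= \sum_(0 <= j < (\max_(j <- A) j).+1) cabs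
  (((i + j).+1%:R ^+ 3)^-1 : C))).
  apply: (sub_sum_le (f := fun j => cabs (((i + j).+1%:R ^+ 3)^-1 : C))) => //.
  - exact: iota_uniq.
  - by move=> x xA; rewrite mem_index_iota ltnS; exact: (@leq_bigmax_seq _ A predT id).
  - by move=> j; exact: cabs_ge0.
move: (_.+1) => n.
have tel : \sum_(0 <= j < n) cabs (((i + j).+1%:R ^+ 3)^-1 : C) <=
    3 * ((i.+1%:R * i.+2%:R)^-1 - ((i + n).+1%:R * (i + n).+2%:R)^-1).
  elim: n => [|n IH]; first by rewrite big_nil addn0 subrr mulr0.
  rewrite big_nat_recr //= cabsV cabsX cabs_nat addnS.
  apply: (le_trans (lerD IH (lexx _))).
  have e1 : (i + n).+2%:R = (i + n).+1%:R + 1 :> R by rewrite natr1.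
  have e2 : (i + n).+3%:R = (i + n).+1%:R + 2 :> R by rewrite -addn2 natrD.
  rewrite e1 e2; have : 1 <= (i + n).+1%:R :> R by rewrite ler1n.
  move: (_.+1%:R) => s s1; rewrite -subr_ge0.
  set A0 := (i.+1%:R * _)^-1.
  have -> : 3 * (A0 - ((s + 1) * (s + 2))^-1) - (3 * (A0 - (s * (s + 1))^-1) +
    (s ^+ 3)^-1) =
     (6 * s ^+ 2 - (s + 1) * (s + 2)) / (s ^+ 3 * (s + 1) * (s + 2)).
    by field; apply/and3P; split; lra.
  rewrite divr_ge0 //; last by rewrite !mulr_ge0 ?exprn_ge0 //; lra.
  have : 1 * s <= s * s by rewrite ler_wpM2r //; lra.
  rewrite expr2; lra.
apply: (le_trans tel); rewrite cabsM cabsV cabsX !cabs_nat ler_wpM2l //.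
apply: (le_trans (_ : _ <= (i.+1%:R * i.+2%:R)^-1)).
  by rewrite lerBlDr lerDl invr_ge0 mulr_ge0.
rewrite lef_pV2 ?posrE ?exprn_gt0 ?mulr_gt0 ?ltr0n //.
by rewrite expr2 ler_wpM2l // ler_nat.
Qed.

Lemma asum_int2 (F : int * int -> C) :
  asum (fun p : nat * nat => F (Posz p.1, Posz p.2)) ->
  asum (fun p : nat * nat => F (Posz p.1, Negz p.2)) ->
  asum (fun p : nat * nat => F (Negz p.1, Posz p.2)) ->
  asum (fun p : nat * nat => F (Negz p.1, Negz p.2)) -> asum F.
Proof.
move=> h1 h2 h3 h4.
apply: (@asum_split _ _ _ _ (fun p : nat * int => (Posz p.1, p.2))
  (fun p : nat * int => (Negz p.1, p.2))) => //.
- by move=> [? ?] [? ?] [-> ->].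
- by move=> [? ?] [? ?] [-> ->].
- by move=> [[n|n] m]; [left|right]; exists (n, m).
- apply: (@asum_split _ _ _ _ (fun p : nat * nat => (p.1, Posz p.2))
    (fun p : nat * nat => (p.1, Negz p.2))) => //.
  + by move=> [? ?] [? ?] [-> ->].
  + by move=> [? ?] [? ?] [-> ->].
  + by move=> [n [m|m]]; [left|right]; exists (n, m).
- apply: (@asum_split _ _ _ _ (fun p : nat * nat => (p.1, Posz p.2))
    (fun p : nat * nat => (p.1, Negz p.2))) => //.
  + by move=> [? ?] [? ?] [-> ->].
  + by move=> [? ?] [? ?] [-> ->].
  + by move=> [n [m|m]]; [left|right]; exists (n, m).
Qed.

Lemma asum_int2_inv_cube :
  asum (fun p : int * int => ((`|p.1| + `|p.2|)%N%:R ^+ 3)^-1 : C).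
Proof.
have H (f : nat * nat -> nat) :
    (forall p, f p = 0 \/ (p.1 + p.2).+1 <= 2 * f p)%N ->
    asum (fun p => ((f p)%:R ^+ 3)^-1 : C).
  move=> hf; apply: (@asum_le _ _ _ _ 8 _ asum_nat2_inv_cube) => p.
  rewrite !cabsV !cabsX !cabs_nat; case: (hf p) => [->|h].
    by rewrite expr0n invr0 mulr_ge0 // invr_ge0 exprn_ge0.
  have f0 : 0 < (f p)%:R :> R by rewrite ltr0n; lia.
  have -> : 8 * (((p.1 + p.2).+1)%:R ^+ 3)^-1 = (((p.1 + p.2).+1%:R / 2) ^+ 3)^-1 :> R.
    by move: (_.+1%:R) (pnatr_eq0 R (p.1 + p.2).+1) => x /negbT x0; field.
  have s0 : 0 < ((p.1 + p.2).+1)%:R :> R by rewrite ltr0n.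
  rewrite lef_pV2 ?posrE ?exprn_gt0 ?divr_gt0 //.
  rewrite lerXn2r ?nnegrE ?divr_ge0 // ler_pdivrMr // -natrM ler_nat mulnC; exact: h.
by apply: asum_int2 => /=; apply: H => -[i j] /=; lia.
Qed.

Section Lattice.
Variable tau : C.
Hypothesis tauH : 0 < complex.Im tau.

Definition latp (p : int * int) : C := p.1%:~R * tau + p.2%:~R.

Lemma latpE p : complex.Im (latp p) = p.1%:~R * complex.Im tau.
Proof.
rewrite /latp ImD Im_int addr0 -(rmorph_int (real_complex R)).
by case: (tau) => x y /=; rewrite mul0r addr0.
Qed.

Lemma cabs_int (n : int) : cabs (n%:~R : C) = `|n|%N%:R.
Proof.
rewrite -(rmorph_int (real_complex R)) cabsR -intr_norm.
by rewrite -abszE.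
Qed.

(** The imaginary part bounds the first coordinate, and then the modulus
    bounds the second one. *)
Lemma latp_lb : exists2 k : R, 0 < k &
  forall p, (`|p.1| + `|p.2|)%N%:R <= k * cabs (latp p).
Proof.
pose y := complex.Im tau; have y0 : 0 < y := tauH; have t0 := cabs_ge0 tau.
exists (1 / y + 1 + cabs tau / y).
  have : 0 < 1 / y by rewrite divr_gt0.
  have : 0 <= cabs tau / y by rewrite divr_ge0 // ltW.
  lra.
move=> p; have h1 : `|p.1|%N%:R <= cabs (latp p) / y.
  rewrite ler_pdivlMr // -(@cabs_int p.1) -(rmorph_int (real_complex R)) cabsR.
  by apply: le_trans (cabs_Im _); rewrite latpE normrM (gtr0_norm y0).
have h2 : `|p.2|%N%:R <= cabs (latp p) + `|p.1|%N%:R * cabs tau.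
  rewrite -!cabs_int -cabsM; apply: le_trans (cabsB _ _).
  by rewrite /latp addrAC subrr add0r.
have h3 := ler_wpM2r t0 h1.
have -> : (1 / y + 1 + cabs tau / y) * cabs (latp p) =
  cabs (latp p) / y + cabs (latp p) + cabs (latp p) / y * cabs tau by ring.
by rewrite natrD; lra.
Qed.

Lemma latp_eq0 p : (latp p == 0) = (p == 0).
Proof.
apply/eqP/eqP => [h|->]; last by rewrite /latp mul0r addr0.
have [k _ /(_ p)] := latp_lb; rewrite h cabs0 mulr0 lern0.
by case: p {h} => m n /= mn; congr (_, _); lia.
Qed.

Lemma asum_latp3 : asum (fun p => (latp p ^+ 3)^-1).
Proof.
have [k k0 hk] := latp_lb.
apply: (@asum_le _ _ _ _ (k ^+ 3) _ asum_int2_inv_cube) => p.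
rewrite !cabsV !cabsX cabs_nat; have [->|p0] := eqVneq p 0.
  have -> : latp 0 = 0 by apply/eqP; rewrite latp_eq0.
  by rewrite cabs0 expr0n invr0 mulr_ge0 ?exprn_ge0 ?invr_ge0 ?exprn_ge0 // ltW.
have l0 : 0 < cabs (latp p) by rewrite cabs_gt0 latp_eq0.
have n0 : 0 < (`|p.1| + `|p.2|)%N%:R :> R.
  rewrite ltr0n; case: p p0 {l0} => m n /= p0.
  suff : (m != 0) || (n != 0) by lia.
  by rewrite -negb_and; apply: contra p0 => /andP[/eqP -> /eqP ->].
rewrite mulrC ler_pdivlMl ?exprn_gt0 // ler_pdivrMr ?exprn_gt0 // -exprMn.
by rewrite lerXn2r ?nnegrE ?mulr_ge0 ?cabs_ge0 // ltW.
Qed.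

(** The domination of the lattice sums uses a positive distance from u to
    the lattice. *)
Definition offlat u := exists2 d : R, 0 < d & forall p, d <= cabs (u + latp p).

Lemma latpD p p' : latp (p + p') = latp p + latp p'.
Proof. by rewrite /latp !rmorphD /=; ring. Qed.

Lemma offlatD u p : offlat u -> offlat (u + latp p).
Proof.
by case=> d d0 h; exists d => // p'; rewrite -addrA -latpD.
Qed.

Lemma offlat_nonint u (m : int) : offlat u -> nonint (u + m%:~R * tau).
Proof.
case=> d d0 h n un; have := h (m, - n); rewrite /latp /= rmorphN addrA un subrr cabs0.
by lra.
Qed.

Arguments offlat_nonint {u} m _.

Lemma offlat_cmp u : offlat u -> exists2 K : R, 0 < K &
  forall p, cabs (latp p) <= K * cabs (u + latp p).
Proof.
case=> d d0 h; exists (1 + cabs u / d) => [|p].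
  by rewrite ltr_wpDr // divr_ge0 ?cabs_ge0 // ltW.
have := cabsB (u + latp p) u; rewrite addrAC subrr add0r.
move=> /le_trans; apply; rewrite mulrDl mul1r lerD2l.
by rewrite mulrAC ler_pdivlMr // ler_wpM2l ?cabs_ge0.
Qed.

Lemma asum_off3 u : offlat u -> asum (fun p => ((u + latp p) ^+ 3)^-1).
Proof.
move=> ou; have [K K0 hK] := offlat_cmp ou; apply: (@asum_point R _ _ 0).
apply: (@asum_le _ _ _ _ (K ^+ 3) _ asum_latp3) => p.
have [p0|p0] := eqVneq p 0.
  by rewrite cabs0 mulr_ge0 ?cabs_ge0 ?exprn_ge0 // ltW.
rewrite !cabsV !cabsX; have l0 : 0 < cabs (latp p) by rewrite cabs_gt0 latp_eq0.
have u0 : 0 < cabs (u + latp p) by case: ou => d d0 /(_ p); lra.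
rewrite mulrC ler_pdivlMl ?exprn_gt0 // ler_pdivrMr ?exprn_gt0 // -exprMn.
by rewrite lerXn2r ?nnegrE ?mulr_ge0 ?cabs_ge0 // ltW.
Qed.

(** The terms of the Weierstrass function; the term at 0 is 1/u^2 by the
    convention that the inverse of 0 is 0. *)
Definition wpt u (p : int * int) : C := ((u + latp p) ^+ 2)^-1 - (latp p ^+ 2)^-1.

Lemma asum_wpt u : offlat u -> asum (wpt u).
Proof.
move=> ou; have [K K0 hK] := offlat_cmp ou; apply: (@asum_point R _ _ 0).
apply: (@asum_le _ _ _ _ (cabs u * (K + K ^+ 2)) _ asum_latp3) => p.
have P0 : 0 <= cabs u * (K + K ^+ 2).
  by rewrite mulr_ge0 ?cabs_ge0 ?addr_ge0 ?exprn_ge0 // ltW.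
have [p0|p0] := eqVneq p 0; first by rewrite cabs0 mulr_ge0 ?cabs_ge0.
have l0 : latp p != 0 by rewrite latp_eq0.
have u0 : u + latp p != 0 by rewrite -cabs_gt0; case: ou => d d0 /(_ p); lra.
rewrite /wpt; have := hK p; move: (latp p) l0 u0 => z l0 u0 {}hK.
have zp : 0 < cabs z by rewrite cabs_gt0.
have up : 0 < cabs (u + z) by rewrite cabs_gt0.
have -> : ((u + z) ^+ 2)^-1 - (z ^+ 2)^-1 =
   - (u * (((u + z) * z ^+ 2)^-1 + ((u + z) ^+ 2 * z)^-1)).
  by field; rewrite l0 u0.
rewrite cabsN cabsM -mulrA ler_wpM2l ?cabs_ge0 // [leRHS]mulrDl.
apply: (le_trans (cabsD _ _)).
rewrite !cabsV (cabsM (u + z)) (cabsM ((u + z) ^+ 2)) !cabsX.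
set a := cabs z in zp hK *; set b := cabs (u + z) in up hK *.
have h1 : b^-1 <= K / a by rewrite ler_pdivlMr // mulrC ler_pdivrMr.
have ia : 0 <= a^-1 by rewrite invr_ge0 ltW.
have ib : 0 <= b^-1 by rewrite invr_ge0 ltW.
have Ka : 0 <= K / a by rewrite divr_ge0 // ltW.
rewrite lerD //.
  have -> : (b * a ^+ 2)^-1 = b^-1 * a^-1 ^+ 2 by rewrite invfM exprVn.
  have -> : K * (a ^+ 3)^-1 = K / a * a^-1 ^+ 2 by rewrite -exprVn; ring.
  by rewrite ler_wpM2r ?exprn_ge0.
have -> : (b ^+ 2 * a)^-1 = b^-1 ^+ 2 * a^-1 by rewrite invfM exprVn.
have -> : K ^+ 2 * (a ^+ 3)^-1 = (K / a) ^+ 2 * a^-1 by rewrite -exprVn; ring.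
by rewrite ler_wpM2r // lerXn2r ?nnegrE.
Qed.

Lemma nonint_mtau (m : int) : m != 0 -> nonint (m%:~R * tau).
Proof.
move=> m0 n /(congr1 (@complex.Im R)); have := latpE (m, 0).
rewrite /latp addr0 /= => ->; rewrite Im_int => /eqP.
by rewrite mulf_eq0 (gt_eqF tauH) orbF intr_eq0 (negPf m0).
Qed.

Lemma wpt_row u (m : int) : offlat u -> hs (fun n => wpt u (m, n))
  (pfrac2 (u + m%:~R * tau) - (if m == 0 then - c ^+ 2 / 12 else pfrac2 (m%:~R * tau))).
Proof.
move=> ou; apply: hsB.
  by apply: hs_ext (pfrac2P (offlat_nonint m ou)) => n; rewrite /latp addrA.
case: eqP => [->|/eqP m0]; last exact: pfrac2P (nonint_mtau m0).
by apply: hs_ext (@hs_int_inv_sq R) => n; rewrite /latp mul0r add0r.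
Qed.

Lemma off3_row u (m : int) : offlat u ->
  hs (fun n => ((u + latp (m, n)) ^+ 3)^-1) (pfrac3 (u + m%:~R * tau)).
Proof.
by move=> ou; apply: hs_ext (pfrac3P (offlat_nonint m ou)) => n; rewrite /latp addrA.
Qed.

End Lattice.

Section RowExpansion.
Variables (w q : C).
Hypotheses (q1 : cabs q < 1) (wq1 : cabs (w * q) < 1).

Lemma asum_rows k : asum (fun p : nat * nat =>
  p.2.+1%:R ^+ k * (w * q ^+ p.1.+1) ^+ p.2.+1).
Proof.
have a := asum_prod (asum_geo q1) (asum_polygeo k wq1).
apply: (@asum_le _ _ _ _ (cabs (w * q)) _ a) => -[i m] /=.
rewrite cabsM (cabsM (q ^+ i)) (cabsM (m.+1%:R ^+ k)); set b := cabs (_ ^+ k).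
have hX : cabs ((w * q ^+ i.+1) ^+ m.+1) <= cabs (w * q) ^+ m.+1 * cabs q ^+ i.
  have -> : w * q ^+ i.+1 = (w * q) * q ^+ i by rewrite exprS; ring.
  rewrite cabsX cabsM exprMn (cabsX q) ler_wpM2l ?exprn_ge0 ?cabs_ge0 // -exprM.
  by rewrite ler_wiXn2l ?cabs_ge0 ?(ltW q1) // leq_pmulr.
apply: (le_trans (ler_wpM2l (cabs_ge0 _) hX)).
rewrite -/b cabsX (cabsX (w * q)) exprS; move: b => b.
by rewrite le_eqVlt; apply/orP; left; apply/eqP; ring.
Qed.

Lemma cabs_rows i : cabs (w * q ^+ i.+1) < 1.
Proof.
have -> : w * q ^+ i.+1 = (w * q) * q ^+ i by rewrite exprS; ring.
rewrite cabsM cabsX; apply: le_lt_trans wq1.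
by rewrite ler_piMr ?cabs_ge0 // exprn_ile1 ?cabs_ge0 // ltW.
Qed.

Lemma hs_row1 (x : C) : cabs x < 1 ->
  hs (fun m => m.+1%:R ^+ 1 * x ^+ m.+1) (x / (1 - x) ^+ 2).
Proof.
by move=> /hs_geo1 /(hsZ x); apply: hs_ext => m; rewrite [x ^+ m.+1]exprS; ring.
Qed.

Lemma hs_row2 (x : C) : cabs x < 1 ->
  hs (fun m => m.+1%:R ^+ 2 * x ^+ m.+1) (x * (1 + x) / (1 - x) ^+ 3).
Proof.
by move=> /hs_geo2 /(hsZ x); rewrite mulrA; apply: hs_ext => m;
  rewrite [x ^+ m.+1]exprS; ring.
Qed.

(** The double series of x, with its sums over m in closed form. *)
Lemma rows1 : exists s, hs (fun i => w * q ^+ i.+1 / (1 - w * q ^+ i.+1) ^+ 2) s /\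
  hs (fun p : nat * nat => p.2.+1%:R ^+ 1 * (w * q ^+ p.1.+1) ^+ p.2.+1) s.
Proof.
have [s h] := asum_hs (asum_rows 1); exists s; split=> //.
by apply: hs_fubini h _ => i; exact: hs_row1 (cabs_rows i).
Qed.

Lemma rows2 : exists s, hs (fun i => w * q ^+ i.+1 * (1 + w * q ^+ i.+1) /
    (1 - w * q ^+ i.+1) ^+ 3) s /\
  hs (fun p : nat * nat => p.2.+1%:R ^+ 2 * (w * q ^+ p.1.+1) ^+ p.2.+1) s.
Proof.
have [s h] := asum_hs (asum_rows 2); exists s; split=> //.
by apply: hs_fubini h _ => i; exact: hs_row2 (cabs_rows i).
Qed.

End RowExpansion.

Lemma xserE w q A B D : w != 0 -> cabs q < 1 -> cabs (w * q) < 1 -> cabs (w^-1 * q) < 1 ->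
  hs (fun i => w * q ^+ i.+1 / (1 - w * q ^+ i.+1) ^+ 2) A ->
  hs (fun i => w^-1 * q ^+ i.+1 / (1 - w^-1 * q ^+ i.+1) ^+ 2) B ->
  hs (fun i => 1 * q ^+ i.+1 / (1 - 1 * q ^+ i.+1) ^+ 2) D ->
  xser w q = 12%:R^-1 + w / (1 - w) ^+ 2 + (A + B - 2 * D).
Proof.
move=> w0 q1 wq wq' hA hB hD; rewrite /xser; congr (_ + _).
apply: csum1_hs; apply: hs_ext (hsB (hsD hA hB) (hsZ 2 hD)) => i /=.
apply/esym; apply: csum1_hs.
have q1' : cabs (1 * q) < 1 by rewrite mul1r.
have := hsB (hsD (hs_row1 (cabs_rows q1 wq i)) (hs_row1 (cabs_rows q1 wq' i)))
  (hsZ 2 (hs_row1 (cabs_rows q1 q1' i))).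
apply: hs_ext => m /=; rewrite !exprMn -!exprM expr1 expr1n.
by rewrite exprVn; ring.
Qed.

(** The coefficients m (m + 1) / 2 of the terms of index m and m + 1 add up,
    after a shift of the index in the latter, to m^2, whence the sum of
    m^2 (x^m - y^m) in each row. *)
Lemma yserE w q A B : w != 0 -> cabs q < 1 -> cabs (w * q) < 1 -> cabs (w^-1 * q) < 1 ->
  hs (fun i => w * q ^+ i.+1 * (1 + w * q ^+ i.+1) / (1 - w * q ^+ i.+1) ^+ 3) A ->
  hs (fun i => w^-1 * q ^+ i.+1 * (1 + w^-1 * q ^+ i.+1) /
     (1 - w^-1 * q ^+ i.+1) ^+ 3) B ->
  yser w q = (w + w ^+ 2) / (2 * (1 - w) ^+ 3) + 2^-1 * (A - B).
Proof.
move=> w0 q1 wq wq' hA hB; rewrite /yser; congr (_ + _ * _).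
apply: csum1_hs; apply: hs_ext (hsB hA hB) => i /=.
apply/esym; apply: csum1_hs.
set x := w * q ^+ i.+1; set y := w^-1 * q ^+ i.+1.
have x1 : cabs x < 1 := cabs_rows q1 wq i.
have y1 : cabs y < 1 := cabs_rows q1 wq' i.
pose a m := x ^+ m - y ^+ m.
have ha : hs (fun m => m.+1%:R ^+ 2 * a m.+1)
    (x * (1 + x) / (1 - x) ^+ 3 - y * (1 + y) / (1 - y) ^+ 3).
  by apply: hs_ext (hsB (hs_row2 x1) (hs_row2 y1)) => m; rewrite /a; ring.
have [t ht] : exists t, hs (fun m => m%:R * m.+1%:R / 2 * a m.+1) t.
  apply: asum_hs.
  have b (z : C) : cabs z < 1 -> asum (fun m => m%:R * m.+1%:R / 2 * z ^+ m.+1).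
    move=> z1; apply: (@asum_le _ _ _ _ (cabs z) _ (asum_polygeo 2 z1)) => m.
    rewrite !cabsM !cabsX cabsV !cabs_nat exprS.
    have e1 : 0 <= cabs z * cabs z ^+ m by rewrite mulr_ge0 ?exprn_ge0 ?cabs_ge0.
    set r := cabs z in e1 *.
    have -> : r * (m.+1%:R ^+ 2 * r ^+ m) = m.+1%:R ^+ 2 * (r * r ^+ m) by ring.
    rewrite ler_wpM2r // -natr1; have := ler0n R m; set t := m%:R => t0.
    have := mulr_ge0 t0 t0; rewrite -expr2 => t2.
    have -> : t * (t + 1) / 2 = (t ^+ 2 + t) / 2 by field.
    have -> : (t + 1) ^+ 2 = t ^+ 2 + 2 * t + 1 by ring.
    lra.
  apply: asum_ext (asumB (b _ x1) (b _ y1)) => m; rewrite /a; ring.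
have h1 := hs_nat_shift ht; rewrite !mul0r subr0 in h1.
have h2 := hsD (hsB ha ht) h1; rewrite subrK in h2.
apply: hs_ext h2 => m.
have ew (z : C) k : (z * q ^+ i.+1) ^+ k = q ^+ (i.+1 * k) * z ^+ k.
  by rewrite exprMn -exprM mulrC.
by rewrite /a /x /y !ew !exprVn addn1 -!natr1; field; rewrite expf_neq0 ?expf_neq0.
Qed.

End LatticeSums.

(** * The q-series x and y at torsion points *)

Section TorsionValues.
Variable R : realType.
Local Notation C := R[i].
Local Notation c := (tpi R).
Implicit Types (u v s w tau : C).

Lemma e2pi_MtauS u tau n :
  e2pi (u + n%:R * tau) = e2pi u * e2pi tau ^+ n.
Proof. by rewrite e2piD e2piMn. Qed.

Section Rows.
Variables (tau u : C).
Hypothesis tauH : 0 < complex.Im tau.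
Hypothesis uT : - complex.Im tau < complex.Im u < complex.Im tau.
Let w := e2pi u.
Let q := e2pi tau.

Lemma rows_q1 : cabs q < 1. Proof. by rewrite cabs_e2pi_lt1. Qed.

Lemma rows_wq1 : cabs (w * q) < 1.
Proof. by rewrite -e2piD cabs_e2pi_lt1 ImD; case/andP: uT; lra. Qed.

Lemma rows_wVq1 : cabs (w^-1 * q) < 1.
Proof.
rewrite -e2piN -e2piD cabs_e2pi_lt1 ImD raddfN /=.
by case/andP: uT; lra.
Qed.

(** The rows m >= 0 are functions of w q^m. The rows m < 0 are reduced to
    w^-1 q^(-m) by parity. *)
Lemma hs_pfrac2_rows A B :
  hs (fun i => w * q ^+ i.+1 / (1 - w * q ^+ i.+1) ^+ 2) A ->
  hs (fun i => w^-1 * q ^+ i.+1 / (1 - w^-1 * q ^+ i.+1) ^+ 2) B ->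
  hs (fun m : int => pfrac2 (u + m%:~R * tau))
     (c ^+ 2 * (w / (1 - w) ^+ 2 + A + B)).
Proof.
move=> hA hB.
have -> : c ^+ 2 * (w / (1 - w) ^+ 2 + A + B) = (pfrac2 u + c ^+ 2 * A) + c ^+ 2 * B.
  by rewrite /pfrac2 -/w; ring.
apply: hs_int.
  have -> : pfrac2 u = pfrac2 (u + 0%N%:Z%:~R * tau) by rewrite mul0r addr0.
  apply: (hs_nat_recl (F := fun n : nat => pfrac2 (u + n%:Z%:~R * tau))).
  apply: hs_ext (hsZ (c ^+ 2) hA) => n.
  by rewrite /pfrac2 e2pi_MtauS.
apply: hs_ext (hsZ (c ^+ 2) hB) => n.
have -> : u + (Negz n)%:~R * tau = - (- u + n.+1%:R * tau).
  by rewrite NegzE rmorphN /=; ring.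
by rewrite pfrac2N /pfrac2 e2pi_MtauS e2piN.
Qed.

Lemma hs_pfrac3_rows A B :
  hs (fun i => w * q ^+ i.+1 * (1 + w * q ^+ i.+1) / (1 - w * q ^+ i.+1) ^+ 3) A ->
  hs (fun i => w^-1 * q ^+ i.+1 * (1 + w^-1 * q ^+ i.+1) /
     (1 - w^-1 * q ^+ i.+1) ^+ 3) B ->
  hs (fun m : int => pfrac3 (u + m%:~R * tau))
     (- c ^+ 3 * ((w + w ^+ 2) / (2 * (1 - w) ^+ 3) + 2^-1 * (A - B))).
Proof.
move=> hA hB.
have -> : - c ^+ 3 * ((w + w ^+ 2) / (2 * (1 - w) ^+ 3) + 2^-1 * (A - B)) =
   (pfrac3 u + - (c ^+ 3 / 2) * A) + - (- (c ^+ 3 / 2) * B).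
  rewrite /pfrac3 -/w [(2 * _)^-1]invfM.
  by move: ((1 - w) ^+ 3)^-1 => z; field.
apply: hs_int.
  have -> : pfrac3 u = pfrac3 (u + 0%N%:Z%:~R * tau) by rewrite mul0r addr0.
  apply: (hs_nat_recl (F := fun n : nat => pfrac3 (u + n%:Z%:~R * tau))).
  apply: hs_ext (hsZ (- (c ^+ 3 / 2)) hA) => n.
  by rewrite /pfrac3 e2pi_MtauS.
apply: hs_ext (hsN (hsZ (- (c ^+ 3 / 2)) hB)) => n.
have -> : u + (Negz n)%:~R * tau = - (- u + n.+1%:R * tau).
  by rewrite NegzE rmorphN /=; ring.
by rewrite pfrac3N /pfrac3 e2pi_MtauS e2piN.
Qed.

End Rows.

Lemma hs_eisenstein_rows tau D : 0 < complex.Im tau ->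
  hs (fun i => 1 * e2pi tau ^+ i.+1 / (1 - 1 * e2pi tau ^+ i.+1) ^+ 2) D ->
  hs (fun m : int => if m == 0 then - c ^+ 2 / 12 else pfrac2 (m%:~R * tau))
     (- c ^+ 2 / 12 + 2 * c ^+ 2 * D).
Proof.
move=> tauH hD.
have -> : - c ^+ 2 / 12 + 2 * c ^+ 2 * D = (- c ^+ 2 / 12 + c ^+ 2 * D) + c ^+ 2 * D.
  by ring.
apply: hs_int.
  apply: (hs_nat_recl (F := fun n : nat => if n%:Z == 0 then - c ^+ 2 / 12 else pfrac2
    (n%:Z%:~R * tau))).
  apply: hs_ext (hsZ (c ^+ 2) hD) => n /=.
  by rewrite /pfrac2 -[e2pi (_ * tau)]/(e2pi (n.+1%:R * tau)) e2piMn mul1r.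
apply: hs_ext (hsZ (c ^+ 2) hD) => n /=.
by rewrite NegzE rmorphN mulNr pfrac2N /pfrac2 -[e2pi (_ * tau)]/(e2pi
  (n.+1%:R * tau)) e2piMn mul1r.
Qed.

Section Values.
Variables (tau u : C) (p : int * int).
Hypothesis tauH : 0 < complex.Im tau.
Hypothesis uT : - complex.Im tau < complex.Im u < complex.Im tau.
Hypothesis uoff : offlat tau u.

Let shift_row (f : C -> C) s : (forall v (n : int), f (v + n%:~R) = f v) ->
  hs (fun m : int => f (u + m%:~R * tau)) s ->
  hs (fun m : int => f (u + latp tau p + m%:~R * tau)) s.
Proof.
move=> fper /(hs_int_shift _ _ p.1).1; apply: hs_ext => m.
rewrite -(fper (u + _) p.2); congr f; rewrite /latp rmorphD /=; ring.
Qed.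

(** Summing the Weierstrass series by rows gives the q-series x, whatever the
    representative of u modulo the lattice. *)
Lemma wpt_xser : hs (wpt tau (u + latp tau p))
  (c ^+ 2 * xser (e2pi u) (e2pi tau)).
Proof.
have q1 := rows_q1 tauH; have wq1 := rows_wq1 uT; have wVq1 := rows_wVq1 uT.
have [A [hA _]] := rows1 q1 wq1; have [B [hB _]] := rows1 q1 wVq1.
have [|D [hD _]] := @rows1 _ 1 _ q1; first by rewrite mul1r.
have ou := offlatD p uoff; have [s hs1] := asum_hs (asum_wpt tauH ou).
suff <- : s = c ^+ 2 * xser (e2pi u) (e2pi tau) by [].
have h1 := hs_fubini hs1 (fun m => wpt_row tauH m ou).
rewrite (xserE (e2pi_neq0 _) q1 wq1 wVq1 hA hB hD); apply: hs_unique h1 _.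
have h2 := hs_pfrac2_rows hA hB; have h3 := hs_eisenstein_rows tauH hD.
have h4 := hsB (shift_row (f := @pfrac2 R) _ h2) h3.
set x := (X in hs _ X); set y := (X in hs _ X) in h4.
have -> : x = y by rewrite /x /y; move: (e2pi u / _) => z; field.
by apply: h4 => v n; rewrite /pfrac2 e2piDint.
Qed.

(** The sum of the inverse cubes has the same rows as y; it converges
    without any correcting term. *)
Lemma off3_yser : hs (fun p' => ((u + latp tau p + latp tau p') ^+ 3)^-1)
  (- c ^+ 3 * yser (e2pi u) (e2pi tau)).
Proof.
have q1 := rows_q1 tauH; have wq1 := rows_wq1 uT; have wVq1 := rows_wVq1 uT.
have [A [hA _]] := rows2 q1 wq1; have [B [hB _]] := rows2 q1 wVq1.
have ou := offlatD p uoff; have [s hs1] := asum_hs (asum_off3 tauH ou).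
suff <- : s = - c ^+ 3 * yser (e2pi u) (e2pi tau) by [].
have h1 := hs_fubini hs1 (fun m => off3_row m ou).
rewrite (yserE (e2pi_neq0 _) q1 wq1 wVq1 hA hB); apply: hs_unique h1 _.
have h2 := shift_row (f := @pfrac3 R) _ (hs_pfrac3_rows hA hB).
apply: h2 => v n.
by rewrite /pfrac3 e2piDint.
Qed.

End Values.

(** A translate of the point by the lattice is 1/l times a nonzero lattice
    point. *)
Lemma offlat_torsion tau (l : nat) (a b : int) : 0 < complex.Im tau -> (0 < l)%N ->
  ~~ ((l%:Z %| a)%Z && (l%:Z %| b)%Z) ->
  offlat tau ((a%:~R * tau + b%:~R) / l%:R).
Proof.
move=> tauH l0 nab; have [k k0 hk] := latp_lb tauH.
have lp : 0 < l%:R :> R by rewrite ltr0n.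
exists (1 / (k * l%:R)) => [|p]; first by rewrite divr_gt0 ?mulr_gt0.
pose p' : int * int := (a + l%:Z * p.1, b + l%:Z * p.2).
have -> : (a%:~R * tau + b%:~R) / l%:R + latp tau p = latp tau p' / l%:R.
  have lC : l%:R != 0 :> C by rewrite pnatr_eq0 -lt0n.
  by rewrite /latp /p' !rmorphD !rmorphM /=; field.
rewrite cabsM cabsV cabs_nat ler_pdivlMr // -[1 / _]mul1r invfM !mulrA mulfVK ?gt_eqF //.
rewrite !mul1r -[k^-1]mul1r ler_pdivrMr // mulrC; apply: le_trans (hk p').
rewrite ler1n; move: nab; apply: contraNT; rewrite /p' /= => h.
have -> : a = l%:Z * - p.1 by lia.
have -> : b = l%:Z * - p.2 by lia.
by rewrite !dvdz_mulr.
Qed.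

Lemma im_div (z w : C) : complex.Im (z / w) =
  (complex.Im z * complex.Re w - complex.Re z * complex.Im w) / cabs w ^+ 2.
Proof. by rewrite cabs_sqr; case: z w => [a b] [x y] /=; ring. Qed.

Lemma Re_lin (m n : int) tau :
  complex.Re (m%:~R * tau + n%:~R) = m%:~R * complex.Re tau + n%:~R.
Proof.
rewrite -!(rmorph_int (real_complex R)).
by case: tau => x y /=; rewrite mul0r subr0.
Qed.

Lemma Im_lin (m n : int) tau :
  complex.Im (m%:~R * tau + n%:~R) = m%:~R * complex.Im tau.
Proof.
rewrite -!(rmorph_int (real_complex R)).
by case: tau => x y /=; rewrite mul0r !addr0.
Qed.

Section Moebius.
Variables (A : 'M[int]_2) (t : C).
Hypothesis AS : SL2Z A.
Hypothesis tH : 0 < complex.Im t.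
Let j : C := (A 1 0)%:~R * t + (A 1 1)%:~R.

Lemma SL2Z_det : A 0 0 * A 1 1 - A 0 1 * A 1 0 = 1.
Proof.
have <- : \det A = A 0 0 * A 1 1 - A 0 1 * A 1 0; last exact: AS.
rewrite (expand_det_row _ 0) !big_ord_recl big_ord0 addr0.
rewrite /cofactor !det_mx11 !mxE /=; congr (_ + _).
  by rewrite expr0 mul1r; congr (A _ _ * A _ _); exact/val_inj.
by rewrite expr1 mulN1r mulrN; congr (- (A _ _ * A _ _)); exact/val_inj.
Qed.

Lemma moebius_den_neq0 : j != 0.
Proof.
apply/eqP => j0; have := latp_eq0 tH (A 1 0, A 1 1).
rewrite /latp /= -/j j0 eqxx => /esym /eqP [c0 d0].
by have := SL2Z_det; rewrite c0 d0 !mulr0 subrr.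
Qed.

Lemma moebius_Im : 0 < complex.Im (moebius A t).
Proof.
have j0 := moebius_den_neq0; have d1 := SL2Z_det.
have dR : (A 0 0)%:~R * (A 1 1)%:~R - (A 0 1)%:~R * (A 1 0)%:~R = 1 :> R.
  by rewrite -!rmorphM -rmorphB d1.
have jp : 0 < cabs j ^+ 2 by rewrite exprn_gt0 // cabs_gt0.
rewrite /moebius -/j im_div divr_gt0 // !Im_lin /j !Re_lin.
have -> : (A 0 0)%:~R * complex.Im t * ((A 1 0)%:~R * complex.Re t + (A 1 1)%:~R) -
   ((A 0 0)%:~R * complex.Re t + (A 0 1)%:~R) * ((A 1 0)%:~R * complex.Im t) =
   complex.Im t * ((A 0 0)%:~R * (A 1 1)%:~R - (A 0 1)%:~R * (A 1 0)%:~R) by ring.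
by rewrite dR mulr1.
Qed.

(** The lattice of moebius A t is that of t divided by j, up to this action
    on the coordinates. *)
Let act (p : int * int) : int * int :=
  (p.1 * A 0 0 + p.2 * A 1 0, p.1 * A 0 1 + p.2 * A 1 1).
Let act' (p : int * int) : int * int :=
  (p.1 * A 1 1 - p.2 * A 1 0, p.2 * A 0 0 - p.1 * A 0 1).

Let actK : cancel act act'.
Proof.
move=> [m n]; rewrite /act /act' /=; congr (_, _).
  by rewrite -[RHS]mulr1 -SL2Z_det; ring.
by rewrite -[RHS]mulr1 -SL2Z_det; ring.
Qed.

Let act'K : cancel act' act.
Proof.
move=> [m n]; rewrite /act /act' /=; congr (_, _).
  by rewrite -[RHS]mulr1 -SL2Z_det; ring.
by rewrite -[RHS]mulr1 -SL2Z_det; ring.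
Qed.

Let latp_act p : latp (moebius A t) p = latp t (act p) / j.
Proof.
have j0 := moebius_den_neq0; rewrite /latp /act /moebius -/j /= !rmorphD !rmorphM /=.
by rewrite /j in j0 *; field.
Qed.

Lemma wpt_moebius u s : hs (wpt t u) s -> hs (wpt (moebius A t) (u / j)) (j ^+ 2 * s).
Proof.
move=> /(hs_bij _ _ actK act'K).1 /(hsZ (j ^+ 2)); apply: hs_ext => p.
rewrite /wpt latp_act -mulrDl !expr_div_n !invf_div; ring.
Qed.

Lemma off3_moebius u s : hs (fun p => ((u + latp t p) ^+ 3)^-1) s ->
  hs (fun p => ((u / j + latp (moebius A t) p) ^+ 3)^-1) (j ^+ 3 * s).
Proof.
move=> /(hs_bij _ _ actK act'K).1 /(hsZ (j ^+ 3)); apply: hs_ext => p.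
by rewrite latp_act -mulrDl expr_div_n invf_div.
Qed.

Variables (l : nat) (mu : int).
Hypothesis l0 : (0 < l)%N.
Hypothesis lmu : ~~ (l%:Z %| mu)%Z.

(* The homothety sends mu / l to ((A 1 0 * mu) t + A 1 1 * mu) / l. Reducing
   the coefficient of t modulo 1 gives the representative u0 with
   coefficient div_exp / l, and div_value is e2pi u0: a root of unity times a
   power of e2pi (t / l). *)
Let cm : int := A 1 0 * mu.
Definition div_exp : nat := absz (cm %% l%:Z)%Z.
Definition div_value : C :=
  e2pi ((A 1 1 * mu)%:~R / l%:R) * e2pi (t / l%:R) ^+ div_exp.

Lemma div_exp_lt : (div_exp < l)%N.
Proof using l0.
rewrite /div_exp; move: cm => x; clear -l0.
have := ltz_pmod x (_ : 0 < l%:Z); have := modz_ge0 x (_ : l%:Z != 0).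
by lia.
Qed.

Let u0 : C := ((div_exp%:Z)%:~R * t + (A 1 1 * mu)%:~R) / l%:R.
Let p0 : int * int := ((cm %/ l%:Z)%Z, 0).

Let lC : l%:R != 0 :> C. Proof. by rewrite pnatr_eq0 -lt0n. Qed.

Let modE : div_exp%:Z = (cm %% l%:Z)%Z.
Proof. by rewrite /div_exp gez0_abs // modz_ge0 //; lia. Qed.

Let u0E : u0 + latp t p0 = j * (mu%:~R / l%:R).
Proof.
rewrite /u0 /latp /p0 /= modE addr0.
have e : cm%:~R = (cm %/ l%:Z)%Z%:~R * l%:R + (cm %% l%:Z)%Z%:~R :> C.
  by rewrite {1}(divz_eq cm l%:Z) rmorphD rmorphM.
have -> : (cm %% l%:Z)%Z%:~R = cm%:~R - (cm %/ l%:Z)%Z%:~R * l%:R :> C.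
  by rewrite e; ring.
by rewrite /j /cm !rmorphM /=; field.
Qed.

Let u0off : offlat t u0.
Proof.
apply: offlat_torsion => //; apply: contra lmu => /andP[h1 h2].
have h3 : (l%:Z %| cm)%Z.
  by rewrite (divz_eq cm l%:Z) -modE rpredD // dvdz_mull.
have -> : mu = A 0 0 * (A 1 1 * mu) - A 0 1 * cm.
  by rewrite /cm -[LHS]mul1r -SL2Z_det; ring.
by rewrite rpredB // dvdz_mull.
Qed.

Let u0T : - complex.Im t < complex.Im u0 < complex.Im t.
Proof.
have lp : 0 < l%:R :> R by rewrite ltr0n.
have -> : complex.Im u0 = div_exp%:R / l%:R * complex.Im t.
  have -> : u0 = (div_exp%:R / l%:R)%:C%C * t + ((A 1 1 * mu)%:~R / l%:R)%:C%C.
    rewrite /u0 !fmorph_div !rmorph_nat rmorph_int; field.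
    exact: lC.
  by rewrite ImD; case: (t) => x y /=; rewrite mul0r !addr0.
have h : 0 <= div_exp%:R / l%:R :> R by rewrite divr_ge0.
have h2 : div_exp%:R / l%:R < 1 :> R by rewrite ltr_pdivrMr // mul1r ltr_nat div_exp_lt.
apply/andP; split.
  by apply: lt_le_trans (mulr_ge0 h (ltW tH)); rewrite oppr_lt0.
by rewrite gtr_pMl.
Qed.

Let e2pi_u0 : e2pi u0 = div_value.
Proof.
rewrite /u0 /div_value mulrDl e2piD mulrC; congr (_ * _).
by rewrite -e2piMn mulrA.
Qed.

Let lmu0 : offlat (moebius A t) (mu%:~R / l%:R).
Proof.
have -> : mu%:~R / l%:R = ((0:int)%:~R * moebius A t + mu%:~R) / l%:R by rewrite mul0r
  add0r.
apply: offlat_torsion => //; first exact: moebius_Im.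
by rewrite negb_and lmu orbT.
Qed.

Let muT : - complex.Im (moebius A t) < complex.Im (mu%:~R / l%:R) < complex.Im
  (moebius A t).
Proof.
have -> : complex.Im (mu%:~R / l%:R : C) = 0.
  by rewrite -(rmorph_int (real_complex R)) -(rmorph_nat (real_complex R)) -fmorph_div.
by rewrite oppr_lt0 moebius_Im.
Qed.

Let c0 : c != 0 := tpi_neq0 R.

(** Both sides are the Weierstrass series of the lattice of moebius A t at
    mu / l. *)
Lemma xser_moebius : xser (e2pi (mu%:~R / l%:R)) (e2pi (moebius A t)) =
  j ^+ 2 * xser div_value (e2pi t).
Proof.
have h1 := wpt_moebius (wpt_xser p0 tH u0T u0off).
have h2 := wpt_xser 0 moebius_Im muT lmu0.
move: h1 h2; rewrite u0E [j * _]mulrC mulfK ?moebius_den_neq0 // e2pi_u0.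
have -> : latp (moebius A t) 0 = 0 by rewrite /latp mul0r addr0.
rewrite addr0 => h1 /(hs_unique h1) e.
by apply: (mulfI (expf_neq0 2 c0)); rewrite -e; ring.
Qed.

Lemma yser_moebius : yser (e2pi (mu%:~R / l%:R)) (e2pi (moebius A t)) =
  j ^+ 3 * yser div_value (e2pi t).
Proof.
have h1 := off3_moebius (off3_yser p0 tH u0T u0off).
have h2 := off3_yser 0 moebius_Im muT lmu0.
move: h1 h2; rewrite u0E [j * _]mulrC mulfK ?moebius_den_neq0 // e2pi_u0.
have -> : latp (moebius A t) 0 = 0 by rewrite /latp mul0r addr0.
rewrite addr0 => h1 /(hs_unique h1) e.
have c3 : - c ^+ 3 != 0 by rewrite oppr_eq0 expf_neq0.
by apply: (mulfI c3); rewrite -e; ring.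
Qed.

End Moebius.

End TorsionValues.

(** * Power series on the unit disc *)

Section PowerSeries.
Variable R : realType.
Local Notation C := R[i].
Implicit Types (x y q : C) (a b d : nat -> C) (f g : C -> C).

(** Absolute convergence is included for the sake of products. *)
Definition pser a f := forall x, cabs x < 1 ->
  asum (fun n => a n * x ^+ n) /\ hs (fun n => a n * x ^+ n) (f x).

Lemma pser_ext a b f : a =1 b -> pser a f -> pser b f.
Proof.
move=> ab fa x x1; have [h1 h2] := fa x x1.
by split; [apply: asum_ext h1|apply: hs_ext h2] => n; rewrite ab.
Qed.

Lemma pser_exists a : (forall x, cabs x < 1 -> asum (fun n => a n * x ^+ n)) ->
  exists f, pser a f.
Proof.
move=> aa; have H x : exists s, cabs x < 1 -> hs (fun n => a n * x ^+ n) s.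
  have [x1|x1] := ltrP (cabs x) 1; last by exists 0.
  by have [s hs1] := asum_hs (aa x x1); exists s.
by have [f hf] := choice H; exists f => x x1; split; [exact: aa|exact: hf].
Qed.

Lemma pser_cst (z : C) : pser (fun n => if n is 0%N then z else 0) (fun=> z).
Proof.
move=> x x1.
have h : hs (fun n => (if n is 0%N then z else 0) * x ^+ n) z.
  have := @hs_finite _ _ (fun n => (if n is 0%N then z else 0) * x ^+ n) [:: 0%N] isT.
  by rewrite big_seq1 expr0 mulr1; apply=> -[|n] //; rewrite mul0r.
split=> //; apply: (@asum_nat_bounded _ _ (cabs z)) => -[|n].
  by rewrite big_nil cabs_ge0.
rewrite big_nat_recl //= expr0 mulr1 big1 ?addr0 // => i _.
by rewrite mul0r cabs0.
Qed.

Lemma pserD a b f g : pser a f -> pser b g ->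
  pser (fun n => a n + b n) (fun x => f x + g x).
Proof.
move=> fa gb x x1; have [h1 h2] := fa x x1; have [h3 h4] := gb x x1.
split; first by apply: asum_ext (asumD h1 h3) => n; rewrite mulrDl.
by apply: hs_ext (hsD h2 h4) => n; rewrite mulrDl.
Qed.

Lemma pserZ a f (z : C) : pser a f -> pser (fun n => z * a n) (fun x => z * f x).
Proof.
move=> fa x x1; have [h1 h2] := fa x x1.
split; first by apply: asum_ext (asumZ z h1) => n; rewrite mulrA.
by apply: hs_ext (hsZ z h2) => n; rewrite mulrA.
Qed.

(** Here L n lists the fibre of p over n. *)
Lemma hs_group (I J : eqType) (F : I -> C) (p : I -> J) (L : J -> seq I) s :
  (forall n, uniq (L n)) -> (forall n i, (i \in L n) = (p i == n)) ->
  hs F s -> hs (fun n => \sum_(i <- L n) F i) s.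
Proof.
move=> uL pL Fs; pose F' (z : J * I) : C := if p z.2 == z.1 then F z.2 else 0.
have h1 : hs F' s.
  apply: (@hs_reindex _ _ _ (fun i => (p i, i)) F' s _ _).2.
  - by move=> i i' [].
  - by move=> [n i] /=; rewrite /F' /=; case: (eqVneq (p i) n) => [<- _|_];
    [exists i|rewrite eqxx].
  - by apply: hs_ext Fs => i; rewrite /F' /= eqxx.
apply: hs_fubini h1 _ => n.
have -> : \sum_(i <- L n) F i = \sum_(i <- L n) F' (n, i).
  by apply: eq_big_seq => i; rewrite pL /F' /= => ->.
apply: (hs_finite (F := fun i => F' (n, i))); first exact: uL.
by move=> i; rewrite pL /F' /= => /negPf ->.
Qed.

Lemma asum_group (I J : eqType) (F : I -> C) (p : I -> J) (L : J -> seq I) :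
  (forall n, uniq (L n)) -> (forall n i, (i \in L n) = (p i == n)) ->
  asum F -> asum (fun n => \sum_(i <- L n) F i).
Proof.
move=> uL pL [M FM]; exists M => A uA.
have uF : uniq (flatten [seq L n | n <- A]).
  elim: A uA => //= n A IH /andP[nA uA]; rewrite cat_uniq uL IH // andbT /=.
  apply/hasPn => i /flatten_mapP[m mA]; rewrite !pL => /eqP ->.
  by apply: contraNneq nA => <-.
apply: (le_trans _ (FM _ uF)); rewrite big_flatten big_map /=.
by apply: ler_sum => n _; exact: cabs_sum.
Qed.

Definition conv a b n : C := \sum_(i < n.+1) a i * b (n - i)%N.

Lemma pserM a b f g : pser a f -> pser b g -> pser (conv a b) (fun x => f x * g x).
Proof.
move=> fa gb x x1; have [h1 h2] := fa x x1; have [h3 h4] := gb x x1.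
pose F (p : nat * nat) := (a p.1 * x ^+ p.1) * (b p.2 * x ^+ p.2).
pose L n := [seq (i, n - i)%N | i <- iota 0 n.+1].
have uL n : uniq (L n) by rewrite map_inj_uniq ?iota_uniq // => i j [].
have pL n p : (p \in L n) = ((p.1 + p.2)%N == n).
  case: p => i j /=; apply/mapP/eqP => [[k]|<-].
    by rewrite mem_iota => kn [-> ->]; lia.
  by exists i; [rewrite mem_iota; lia|rewrite addKn].
have E n : \sum_(p <- L n) F p = conv a b n * x ^+ n.
  rewrite big_map -[iota 0 n.+1]/(index_iota 0 n.+1) big_mkord mulr_suml.
  apply: eq_bigr => i _; rewrite /F /=.
  have -> : x ^+ n = x ^+ i * x ^+ (n - i) by rewrite -exprD subnKC // -ltnS.
  by ring.
split.
  by apply: asum_ext (asum_group uL pL (asum_prod h1 h3)) => n; exact: E.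
by apply: hs_ext (hs_group uL pL (hs_prod h1 h3 h2 h4)) => n; exact: E.
Qed.

Lemma pser_bound a f (r : R) : pser a f -> 0 <= r < 1 ->
  exists M : R, forall n, cabs (a n) * r ^+ n <= M.
Proof.
move=> fa /andP[r0 r1]; have [|[M hM] _] := fa r%:C%C.
  by rewrite cabsR ger0_norm.
exists M => n; have := hM [:: n] isT.
by rewrite big_seq1 cabsM cabsX cabsR ger0_norm.
Qed.

Lemma asum_of_bound a (M r : R) k x : cabs x < r ->
  (forall n, cabs (a n) * r ^+ n <= M) ->
  asum (fun n => n.+1%:R ^+ k * (a n * x ^+ n)).
Proof.
move=> xr hM; have r0 : 0 < r := le_lt_trans (cabs_ge0 x) xr.
have z1 : cabs (x / r%:C%C) < 1.
  by rewrite cabsM cabsV cabsR (gtr0_norm r0) ltr_pdivrMr // mul1r.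
apply: (@asum_le _ _ _ _ M _ (asum_polygeo k z1)) => n.
have -> : cabs (n.+1%:R ^+ k * (x / r%:C%C) ^+ n) =
    cabs (n.+1%:R ^+ k) * (cabs x ^+ n / r ^+ n).
  by rewrite cabsM (cabsX (x / _)) (cabsM x) cabsV cabsR (gtr0_norm r0) expr_div_n.
have -> : cabs (n.+1%:R ^+ k * (a n * x ^+ n)) =
    cabs (n.+1%:R ^+ k) * (cabs (a n) * cabs x ^+ n).
  by rewrite cabsM (cabsM (a n)) (cabsX x).
rewrite [leRHS]mulrCA ler_wpM2l ?cabs_ge0 // mulrA ler_pdivlMr ?exprn_gt0 // mulrAC.
by rewrite ler_wpM2r ?exprn_ge0 ?cabs_ge0.
Qed.

Lemma mid_lt (x : C) : cabs x < 1 -> cabs x < (1 + cabs x) / 2 /\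
  0 <= (1 + cabs x) / 2 < 1.
Proof. by have := cabs_ge0 x => x0 x1; split; [lra|apply/andP; split; lra]. Qed.

Lemma pser_poly a f k x : pser a f -> cabs x < 1 ->
  asum (fun n => n.+1%:R ^+ k * (a n * x ^+ n)).
Proof.
move=> fa /mid_lt[xr r01]; have [M hM] := pser_bound fa r01.
exact: asum_of_bound xr hM.
Qed.

Definition dcoef a n : C := n.+1%:R * a n.+1.

Lemma pser_deriv_exists a f : pser a f -> exists g, pser (dcoef a) g.
Proof.
move=> fa; apply: pser_exists => x x1.
have [xr r01] := mid_lt x1; have [M hM] := pser_bound fa r01.
set r := (1 + _) / 2 in xr r01 hM.
have r0 : 0 < r := le_lt_trans (cabs_ge0 x) xr.
have hM' n : cabs (a n.+1) * r ^+ n <= M / r.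
  by rewrite ler_pdivlMr // -mulrA -exprSr.
apply: asum_ext (asum_of_bound 1 xr hM') => n; rewrite /dcoef expr1; ring.
Qed.

(** A second order Taylor bound, by a term of the form n^2 r^n which is
    summable in n against the coefficients of a power series when r < 1. *)
Lemma pow_diff2 x y (r : R) n : 0 < r -> cabs x <= r -> cabs y <= r ->
  cabs (y ^+ n - x ^+ n - (y - x) * (n%:R * x ^+ n.-1)) <=
  cabs (y - x) ^+ 2 * (n%:R ^+ 2 * r ^+ n / r ^+ 2).
Proof.
move=> r0 xr yr; elim: n => [|n IH].
  by rewrite !expr0 subrr !mul0r mulr0 subr0 cabs0 expr0n !mul0r mulr0.
have -> : y ^+ n.+1 - x ^+ n.+1 - (y - x) * (n.+1%:R * x ^+ n.+1.-1) =
  y * (y ^+ n - x ^+ n - (y - x) * (n%:R * x ^+ n.-1)) +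
  (y - x) ^+ 2 * (n%:R * x ^+ n.-1).
  case: n {IH} => [|n]; first by rewrite /= !expr0 !expr1; ring.
  have e2 : n.+2%:R = n.+1%:R + 1 :> C by rewrite natr1.
  by rewrite /= !exprS e2; ring.
apply: (le_trans (cabsD _ _)).
have h1 : cabs (y * (y ^+ n - x ^+ n - (y - x) * (n%:R * x ^+ n.-1))) <=
    r * (cabs (y - x) ^+ 2 * (n%:R ^+ 2 * r ^+ n / r ^+ 2)).
  by rewrite cabsM ler_pM ?cabs_ge0.
have h2 : cabs ((y - x) ^+ 2 * (n%:R * x ^+ n.-1)) <=
    cabs (y - x) ^+ 2 * (n%:R * r ^+ n / r).
  rewrite cabsM cabsX ler_wpM2l ?exprn_ge0 ?cabs_ge0 //.
  case: n {IH h1} => [|n]; first by rewrite !mul0r cabs0.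
  rewrite cabsM cabs_nat cabsX /= exprSr mulrA mulfK ?gt_eqF // ler_wpM2l //.
  by rewrite lerXn2r ?nnegrE ?cabs_ge0 // ltW.
apply: (le_trans (lerD h1 h2)).
have -> : r * (cabs (y - x) ^+ 2 * (n%:R ^+ 2 * r ^+ n / r ^+ 2)) +
   cabs (y - x) ^+ 2 * (n%:R * r ^+ n / r) =
   cabs (y - x) ^+ 2 * ((n%:R ^+ 2 + n%:R) * r ^+ n / r).
  by field; rewrite gt_eqF.
have -> : n.+1%:R ^+ 2 * r ^+ n.+1 / r ^+ 2 = n.+1%:R ^+ 2 * r ^+ n / r.
  by rewrite [r ^+ n.+1]exprS; field; rewrite gt_eqF.
have pr : 0 <= r ^+ n / r by rewrite divr_ge0 ?exprn_ge0 // ltW.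
rewrite ler_wpM2l ?exprn_ge0 ?cabs_ge0 // -[leLHS]mulrA -[leRHS]mulrA ler_wpM2r //.
rewrite -natr1 sqrrD expr1n mulr1 -mulr_natr; have := ler0n R n; lra.
Qed.

(** Termwise differentiation, the remainders being summable by pow_diff2. *)
Lemma cderiv_pser a f g x : pser a f -> pser (dcoef a) g -> cabs x < 1 ->
  cderiv_at f x (g x).
Proof.
move=> fa gd x1; have [xr r01] := mid_lt x1.
set r := (1 + cabs x) / 2 in xr r01; have [r0' r1] := andP r01.
have r0 : 0 < r := le_lt_trans (cabs_ge0 x) xr.
have [|M hM] := @pser_poly a f 2 r%:C%C fa; first by rewrite cabsR ger0_norm.
have M0 : 0 <= M by have := hM [::] isT; rewrite big_nil.
move=> e e0; pose K := M / r ^+ 2 + 1.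
have K0 : 0 < K by rewrite ltr_wpDl // divr_ge0 ?exprn_ge0.
exists (Num.min (r - cabs x) (e / K)) => [|h];
  first by rewrite lt_min subr_gt0 xr divr_gt0.
rewrite lt_min => /andP[h1 h2].
have yr : cabs (x + h) <= r by apply: (le_trans (cabsD _ _)); lra.
have [_ hx] := fa x x1; have [_ hy] := fa (x + h) (le_lt_trans yr r1).
have [_ hg] := gd x x1.
have hg' : hs (fun n => a n * (n%:R * x ^+ n.-1)) (g x).
  have -> : g x = a 0%N * (0%:R * x ^+ 0.-1) + g x by rewrite mul0r mulr0 add0r.
  apply: (hs_nat_recl (F := fun n => a n * (n%:R * x ^+ n.-1))).
  by apply: hs_ext hg => n; rewrite /dcoef /=; ring.
have hD := hsB (hsB hy hx) (hsZ h hg').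
apply: (le_trans (_ : _ <= cabs h ^+ 2 * (M / r ^+ 2))).
  apply: (hs_bound hD) => A uA.
  apply: (le_trans (_ : _ <= \sum_(n <- A) cabs h ^+ 2 / r ^+ 2 *
     cabs (n.+1%:R ^+ 2 * (a n * r%:C%C ^+ n)))).
    apply: ler_sum => n _.
    have -> : a n * (x + h) ^+ n - a n * x ^+ n - h * (a n * (n%:R * x ^+ n.-1)) =
       a n * ((x + h) ^+ n - x ^+ n - (x + h - x) * (n%:R * x ^+ n.-1)) by ring.
    rewrite cabsM; have := pow_diff2 n r0 (ltW xr) yr.
    have -> : x + h - x = h by ring.
    move=> /(ler_wpM2l (cabs_ge0 (a n))) /le_trans; apply.
    rewrite (cabsM (n.+1%:R ^+ 2)) (cabsM (a n)) !cabsX cabsR cabs_nat (gtr0_norm r0).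
    have -> : cabs (a n) * (cabs h ^+ 2 * (n%:R ^+ 2 * r ^+ n / r ^+ 2)) =
      (cabs h ^+ 2 / r ^+ 2 * (cabs (a n) * r ^+ n)) * n%:R ^+ 2 by ring.
    have -> : cabs h ^+ 2 / r ^+ 2 * (n.+1%:R ^+ 2 * (cabs (a n) * r ^+ n)) =
      (cabs h ^+ 2 / r ^+ 2 * (cabs (a n) * r ^+ n)) * n.+1%:R ^+ 2 by ring.
    rewrite ler_wpM2l //.
      by apply: mulr_ge0; [apply: divr_ge0|apply: mulr_ge0]; rewrite ?exprn_ge0 ?cabs_ge0.
    by rewrite lerXn2r ?nnegrE // ler_nat.
  rewrite -mulr_sumr -mulrA [leRHS](_ : _ = cabs h ^+ 2 * (r ^- 2 * M)); last by ring.
  rewrite ler_wpM2l ?exprn_ge0 ?cabs_ge0 // ler_wpM2l ?invr_ge0 ?exprn_ge0 //.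
  exact: hM.
rewrite expr2 -mulrA mulrCA mulrC ler_wpM2r ?cabs_ge0 //.
have : cabs h * K <= e by rewrite -ler_pdivlMr // ltW.
by rewrite /K; have := cabs_ge0 h; lra.
Qed.

Lemma pser_cderiv a f x : pser a f -> cabs x < 1 -> exists D, cderiv_at f x D.
Proof.
move=> fa x1; have [g hg] := pser_deriv_exists fa.
by exists (g x); exact: cderiv_pser fa hg x1.
Qed.

Lemma pser0 a f : pser a f -> f 0 = a 0%N.
Proof.
move=> fa; have [|_ h] := fa 0; first by rewrite cabs0.
apply: hs_unique h _.
have := @hs_finite _ _ (fun n => a n * 0 ^+ n) [:: 0%N] isT.
rewrite big_seq1 expr0 mulr1; apply=> -[|n] // _.
by rewrite expr0n mulr0.
Qed.

Lemma pser_unique a f g : pser a f -> pser a g -> forall x, cabs x < 1 -> f x = g x.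
Proof. by move=> fa ga x x1; apply: hs_unique (fa x x1).2 (ga x x1).2. Qed.

(** * Double families of monomials *)

Section DoubleFamily.
Variables (cf : nat -> nat -> C) (ex : nat -> nat -> nat) (K : R) (k : nat).
Hypothesis exi : forall i m, (i <= ex i m)%N.
Hypothesis exm : forall i m, (m <= ex i m)%N.
Hypothesis cfK : forall i m, cabs (cf i m) <= K * m.+1%:R ^+ k.

Definition dfam x (p : nat * nat) : C := cf p.1 p.2 * x ^+ ex p.1 p.2.

(** The index pairs of exponent n, of which there are finitely many because
    exponents are at least as large as both indices. *)
Definition dfib n : seq (nat * nat) :=
  [seq p <- [seq (i, m) | i <- iota 0 n.+1, m <- iota 0 n.+1] | ex p.1 p.2 == n].

Definition dfcoef n : C := \sum_(p <- dfib n) cf p.1 p.2.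

Lemma dfib_uniq n : uniq (dfib n).
Proof.
apply: filter_uniq; apply: allpairs_uniq; rewrite ?iota_uniq //.
by move=> [? ?] [? ?].
Qed.

Lemma mem_dfib n p : (p \in dfib n) = (ex p.1 p.2 == n).
Proof.
have h : ex p.1 p.2 = n -> p \in [seq (i, m) | i <- iota 0 n.+1, m <- iota 0 n.+1].
  move=> e; apply/allpairsP; exists p; rewrite !mem_iota /= !add0n !ltnS -e exi exm.
  by split=> //; case: p {e}.
by rewrite mem_filter; case: eqP => //= /h ->.
Qed.

(** With s = (1 + |x|) / 2 one has |x| <= s^2, hence |x|^(ex i m) <= s^i s^m. *)
Lemma asum_dfam x : cabs x < 1 -> asum (dfam x).
Proof.
move=> x1; have [xr /andP[s0 s1]] := mid_lt x1; set s := (1 + _) / 2 in xr s0 s1.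
have x0 := cabs_ge0 x.
have xs : cabs x <= s ^+ 2.
  have -> : s ^+ 2 = cabs x + ((1 - cabs x) / 2) ^+ 2 by rewrite /s; field.
  by rewrite lerDl sqr_ge0.
have sC : cabs (s%:C%C : C) < 1 by rewrite cabsR ger0_norm.
have a := asum_prod (asum_geo sC) (asum_polygeo k sC).
apply: (@asum_le _ _ _ _ `|K| _ a) => -[i m]; rewrite /dfam /= !cabsM !cabsX.
rewrite cabsR cabs_nat (ger0_norm s0).
have e1 : cabs x ^+ ex i m <= s ^+ i * s ^+ m.
  rewrite -exprD; apply: (le_trans (_ : _ <= (s ^+ 2) ^+ ex i m)).
    by rewrite lerXn2r ?nnegrE // exprn_ge0.
  rewrite -exprM ler_wiXn2l // ?ltW //; have := exi i m; have := exm i m; lia.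
have e2 : cabs (cf i m) <= `|K| * m.+1%:R ^+ k.
  by apply: le_trans (cfK i m) _; rewrite ler_wpM2r ?exprn_ge0 // ler_norm.
apply: (le_trans (ler_pM (cabs_ge0 _) _ e2 e1)); first by rewrite exprn_ge0.
by rewrite le_eqVlt; apply/orP; left; apply/eqP; ring.
Qed.

Lemma dfam_coef n x : \sum_(p <- dfib n) dfam x p = dfcoef n * x ^+ n.
Proof.
rewrite /dfcoef mulr_suml; apply: eq_big_seq => p.
by rewrite mem_dfib /dfam => /eqP ->.
Qed.

Lemma pser_dfam f : (forall x, cabs x < 1 -> hs (dfam x) (f x)) -> pser dfcoef f.
Proof.
move=> hf x x1; split.
  apply: asum_ext (asum_group dfib_uniq mem_dfib (asum_dfam x1)) => n.
  exact: dfam_coef.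
apply: hs_ext (hs_group dfib_uniq mem_dfib (hf x x1)) => n.
exact: dfam_coef.
Qed.

Lemma dfam_fun : exists f, forall x, cabs x < 1 -> hs (dfam x) (f x).
Proof.
have H x : exists s, cabs x < 1 -> hs (dfam x) s.
  have [x1|x1] := ltrP (cabs x) 1; last by exists 0.
  by have [s hs1] := asum_hs (asum_dfam x1); exists s.
by have [f hf] := choice H; exists f.
Qed.

End DoubleFamily.

(** * The exponential of a power series *)

Section ExpSeries.
Variable a : nat -> C.

(** A list, in decreasing order of degree, for the recursion to reach all the
    previous coefficients. *)
Fixpoint expl n : seq C := if n is m.+1 then
  m.+1%:R^-1 * (\sum_(k < m.+1) k.+1%:R * a k.+1 * nth 0 (expl m) k) :: expl m
  else [:: 1].

(** The coefficients e of the exponential F of a series g with coefficients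
    a, given by the recursion n e_n = sum of k a_k e_(n - k) that F' = g' F
    imposes. *)
Definition expcoef n : C := head 0 (expl n).

Lemma nth_expl n k : (k <= n)%N -> nth 0 (expl n) k = expcoef (n - k).
Proof.
elim: n k => [|n IH] [|k] //; rewrite ltnS => kn.
by rewrite subSS -IH.
Qed.

Lemma expcoefS n : n.+1%:R * expcoef n.+1 = conv (dcoef a) expcoef n.
Proof.
rewrite /expcoef /= mulrA mulfV ?pnatr_eq0 // mul1r.
by apply: eq_bigr => k _; rewrite nth_expl // -ltnS.
Qed.

Variable g : C -> C.
Hypothesis ag : pser a g.
Hypothesis a0 : a 0%N = 0.

(** Once n exceeds the sum B of the k |a_k| r^k, the recursion cannot
    increase the maximum of the |e_n| r^n. *)
Lemma expcoef_bound (r : R) : 0 <= r < 1 ->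
  exists M : R, forall n, cabs (expcoef n) * r ^+ n <= M.
Proof.
move=> /andP[r0 r1]; have [|B hB] := @pser_poly a g 1 r%:C%C ag.
  by rewrite cabsR ger0_norm.
have hB' n : \sum_(k < n.+1) k.+1%:R * cabs (a k.+1) * r ^+ k.+1 <= B.
  apply: (le_trans _ (hB (iota 0 n.+2) (iota_uniq _ _))).
  rewrite -[iota 0 n.+2]/(index_iota 0 n.+2) big_mkord big_ord_recl.
  rewrite -[leLHS]add0r lerD ?cabs_ge0 //; apply: ler_sum => k _.
  rewrite expr1 !cabsM cabsX cabsR (ger0_norm r0) cabs_nat mulrA.
  by rewrite ler_wpM2r ?exprn_ge0 // ler_wpM2r ?cabs_ge0 // ler_nat.
pose N := (Num.truncn B).+1.
have BN : B <= N%:R := ltW (truncnS_gt B).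
pose M := \sum_(n < N.+1) cabs (expcoef n) * r ^+ n.
have Mn n : 0 <= cabs (expcoef n) * r ^+ n by rewrite mulr_ge0 ?cabs_ge0 ?exprn_ge0.
exists M; elim/ltn_ind => n IH; have [nN|nN] := leqP n N.
  rewrite /M (bigD1 (Ordinal (nN : (n < N.+1)%N))) //= lerDl.
  by rewrite sumr_ge0.
case: n nN IH => // n nN IH.
have M0 : 0 <= M by rewrite /M sumr_ge0.
have n0 : 0 < n.+1%:R :> R by rewrite ltr0n.
rewrite -(ler_pM2l n0) mulrA -[n.+1%:R in leLHS]cabs_nat -cabsM expcoefS.
apply: (le_trans (ler_wpM2r (exprn_ge0 _ r0) (cabs_sum _ _ _))).
rewrite mulr_suml.
apply: (le_trans (_ : _ <= \sum_(k < n.+1) k.+1%:R * cabs (a k.+1) * r ^+ k.+1 * M)).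
  apply: ler_sum => k _; rewrite /dcoef !cabsM cabs_nat.
  have -> : r ^+ n.+1 = r ^+ k.+1 * r ^+ (n - k).
    by rewrite -exprD; congr (_ ^+ _); have := ltn_ord k; lia.
  have -> : k.+1%:R * cabs (a k.+1) * cabs (expcoef (n - k)) * (r ^+ k.+1 * r ^+
    (n - k)) =
    k.+1%:R * cabs (a k.+1) * r ^+ k.+1 * (cabs (expcoef (n - k)) * r ^+ (n - k)) by ring.
  rewrite ler_wpM2l ?mulr_ge0 ?cabs_ge0 ?exprn_ge0 // IH //.
  by have := ltn_ord k; lia.
rewrite -mulr_suml ler_wpM2r //; apply: (le_trans (hB' n)); apply: (le_trans BN).
by rewrite ler_nat ltnW.
Qed.

(** The sum F of the series satisfies F' = g' F, so that F exp (- g) is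
    constant. *)
Lemma pser_exp : pser expcoef (fun x => cexp (g x)).
Proof.
have [f hf] : exists f, pser expcoef f.
  apply: pser_exists => x x1; have [xr r01] := mid_lt x1.
  have [M hM] := expcoef_bound r01.
  by apply: asum_ext (asum_of_bound 0 xr hM) => n; rewrite expr0 mul1r.
have [g' hg'] := pser_deriv_exists ag; have [f' hf'] := pser_deriv_exists hf.
have ff x : cabs x < 1 -> f' x = g' x * f x.
  have h : pser (dcoef expcoef) (fun z => g' z * f z).
    by apply: pser_ext (pserM hg' hf) => n; rewrite -expcoefS.
  exact: (pser_unique hf' h).
suff E x : cabs x < 1 -> f x = cexp (g x).
  by move=> x x1; rewrite -E //; exact: hf.
move=> x1; pose F z := f z * cexp (- g z).
have dF z : cabs z < 1 -> cderiv_at F z 0.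
  move=> z1; have h1 := cderiv_pser hf hf' z1.
  have h2 := cderiv_comp (cderivN (cderiv_pser ag hg' z1)) (cderiv_cexp (- g z)).
  have := cderivM h1 h2; rewrite ff // => h; apply: cderiv_eq (_ : cderiv_at _ _ _) => //.
  have <- // : g' z * f z * cexp (- g z) + f z * (cexp (- g z) * - g' z) = 0 by ring.
have := @cderiv0_segment R F 0 x _; rewrite add0r => H.
have : F x = F 0.
  apply: H => s /andP[s0 s1]; apply: dF; rewrite add0r cabsM cabsR ger0_norm //.
  by apply: le_lt_trans x1; rewrite ler_piMl ?cabs_ge0.
rewrite /F (pser0 ag) (pser0 hf) a0 oppr0 cexp0 mulr1 cexpN => /(canRL (divfK _)).
by rewrite /expcoef /= mul1r; apply; exact: cexp_neq0.
Qed.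

End ExpSeries.

(** The function (1 - z) exp (l z) has derivative 0. *)
Lemma log_series : exists l, pser (fun n => n%:R^-1) l /\
  forall x, cabs x < 1 -> 1 - x = cexp (- l x).
Proof.
have [l hl] : exists l, pser (fun n => n%:R^-1) l.
  apply: pser_exists => x x1; apply: (@asum_le _ _ _ _ 1 _ (asum_geo x1)) => n.
  rewrite mul1r cabsM cabsV cabs_nat ler_piMl ?cabs_ge0 //.
  case: n => [|n]; first by rewrite invr0.
  by rewrite invf_le1 ?ltr0n // ler1n.
exists l; split=> // x x1.
have hd : pser (dcoef (fun n => n%:R^-1)) (fun x => (1 - x)^-1).
  move=> y y1; have e n : y ^+ n = dcoef (fun n => n%:R^-1) n * y ^+ n.
    by rewrite /dcoef mulfV ?pnatr_eq0 // mul1r.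
  split; first by apply: asum_ext (asum_geo y1).
  by apply: hs_ext (hs_geo y1).
pose F z := (1 - z) * cexp (l z).
have dF z : cabs z < 1 -> cderiv_at F z 0.
  move=> z1; have h1 := cderivB (cderiv_cst 1 z) (cderiv_id z).
  have h2 := cderiv_comp (cderiv_pser hl hd z1) (cderiv_cexp (l z)).
  have := cderivM h1 h2; have zn := sub1_neq0 z1.
  have -> // : (0 - 1) * cexp (l z) + (1 - z) * (cexp (l z) / (1 - z)) = 0.
  by field.
have := @cderiv0_segment R F 0 x _; rewrite add0r => H.
have : F x = F 0.
  apply: H => s /andP[s0 s1]; apply: dF; rewrite add0r cabsM cabsR ger0_norm //.
  by apply: le_lt_trans x1; rewrite ler_piMl ?cabs_ge0.
rewrite /F (pser0 hl) invr0 cexp0 subr0 mulr1 cexpN => /(canRL (mulfK _)).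
by rewrite mul1r; apply; exact: cexp_neq0.
Qed.

End PowerSeries.

(** * The Euler product *)

Section EulerProduct.
Variable R : realType.
Local Notation C := R[i].
Local Notation c := (tpi R).
Implicit Types (t u z q : C).

Definition eulc (i m : nat) : C := m.+1%:R^-1.
Definition eule (i m : nat) : nat := (i.+1 * m.+1)%N.
Definition eulcoef : nat -> C := dfcoef eulc eule.

Lemma eule_ge1 i m : (i <= eule i m)%N. Proof. by rewrite /eule; nia. Qed.
Lemma eule_ge2 i m : (m <= eule i m)%N. Proof. by rewrite /eule; nia. Qed.

Lemma eulc_bound i m : cabs (eulc i m) <= 1 * m.+1%:R ^+ 0.
Proof.
by rewrite mulr1 /eulc cabsV cabs_nat invf_le1 ?ltr0n // ler1n.
Qed.

(** The sum over i >= 1 of - log (1 - q^i). *)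
Lemma euler_log : exists L, pser eulcoef L /\
  forall q, cabs q < 1 -> cprod1 (fun m => 1 - q ^+ m) = cexp (- L q).
Proof.
have [L hL] := dfam_fun eule_ge1 eule_ge2 eulc_bound.
exists L; split.
  by rewrite /eulcoef; exact: (pser_dfam eule_ge1 eule_ge2 eulc_bound hL).
(* The double series of the q^(i m) / m, summed over m first. *)
move=> q q1; have [l [hl le]] := log_series R.
have qi i : cabs (q ^+ i.+1) < 1.
  by rewrite cabsX exprn_ilt1 // cabs_ge0.
have hLq : hs (fun i => l (q ^+ i.+1)) (L q).
  apply: hs_fubini (hL q q1) _ => i.
  have [_ h] := hl _ (qi i); have := hs_nat_shift h; rewrite invr0 mul0r subr0.
  by apply: hs_ext => m; rewrite /dfam /eulc /eule /= -exprM.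
apply: limn_cabs => e e0.
have [d d0 hd] := cderiv_cont (cderiv_cexp (- L q)) e0.
have [N hN] := hs_nat_partial hLq (divr_gt0 d0 (ltr0Sn R 1)); exists N => n nN.
have -> : \prod_(1 <= i < n.+1) (1 - q ^+ i) = cexp (- L q + (L q - \sum_(0 <= i < n) l
  (q ^+ i.+1))).
  rewrite addrA addNr add0r -sumrN cexp_sum big_add1 /=.
  by apply: eq_bigr => i _; exact: le.
by apply: hd; rewrite cabsBC; have := hN n nN; lra.
Qed.

Definition eulerlog : C -> C := proj1_sig (cid euler_log).

Lemma pser_eulerlog : pser eulcoef eulerlog.
Proof. by rewrite /eulerlog; case: cid => L []. Qed.

Lemma DeltaE t : 0 < complex.Im t ->
  Delta t = e2pi t * cexp (- (24 * eulerlog (e2pi t))).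
Proof.
move=> tH; have q1 : cabs (e2pi t) < 1 by rewrite cabs_e2pi_lt1.
rewrite /Delta /eta exprMn -(e2piMn (t / 24%:R) 24).
have -> : 24%:R * (t / 24%:R) = t by field.
congr (_ * _); rewrite /eulerlog; case: cid => L [_ /= -> //].
by rewrite -cexpMn mulrN.
Qed.

(** q times the derivative of the Euler logarithm is the Lambert series of the
    weight 2 Eisenstein series. *)
Lemma eulerlog_deriv : exists L', pser (dcoef eulcoef) L' /\
  forall q, cabs q < 1 ->
    hs (fun i => 1 * q ^+ i.+1 / (1 - 1 * q ^+ i.+1) ^+ 2) (q * L' q).
Proof.
have [L' hL'] := pser_deriv_exists pser_eulerlog; exists L'; split=> // q q1.
have q1' : cabs (1 * q) < 1 by rewrite mul1r.
have [s [hr hp]] := rows1 q1 q1'.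
have -> // : q * L' q = s.
have h1 := hs_group (dfib_uniq eule) (mem_dfib eule_ge1 eule_ge2) (hs_swap hp).
have h2 : hs (fun n => n%:R * eulcoef n * q ^+ n) (q * L' q).
  have -> : q * L' q = 0%:R * eulcoef 0 * q ^+ 0 + q * L' q by rewrite !mul0r add0r.
  apply: (hs_nat_recl (F := fun n => n%:R * eulcoef n * q ^+ n)).
  apply: hs_ext (hsZ q (hL' q q1).2) => n.
  by rewrite /dcoef exprS; ring.
apply: hs_unique h2 _; apply: hs_ext h1 => n.
rewrite /eulcoef /dfcoef mulr_sumr mulr_suml; apply: eq_big_seq => -[i m].
rewrite (mem_dfib eule_ge1 eule_ge2) /= => /eqP <-.
rewrite mul1r expr1 /eulc /eule -exprM natrM [(m.+1 * i.+1)%N]mulnC.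
by field; rewrite ?pnatr_eq0.
Qed.

End EulerProduct.

(** * The Eisenstein series of weight 2 *)

Section Eisenstein2.
Variable R : realType.
Local Notation C := R[i].
Local Notation c := (tpi R).
Implicit Types (t u z q : C).

Lemma pow_small (rho e : R) : 0 <= rho < 1 -> 0 < e ->
  exists N, forall n, (N <= n)%N -> rho ^+ n <= e.
Proof.
move=> r01 e0; have [K [r [/andP[r0 r1] K0 hK]]] := poly_geo 1 r01.
exists (Num.truncn (K / e)) => n nN.
have n0 : 0 < n.+1%:R :> R by rewrite ltr0n.
rewrite -(ler_pM2l n0) -[n.+1%:R in leLHS]expr1; apply: (le_trans (hK n)).
apply: (le_trans (_ : _ <= K)); first by rewrite ler_piMr // exprn_ile1 // ltW.
rewrite -ler_pdivrMr //; apply: (le_trans (ltW (truncnS_gt _))).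
by rewrite ler_nat ltnS.
Qed.

Lemma pfrac1_small v (e : R) : cabs (e2pi v) <= 1 / 2 ->
  2 * cabs c * cabs (e2pi v) <= e -> cabs (pfrac1 v - - (c / 2)) <= e.
Proof.
rewrite /pfrac1; set w := e2pi v => w2 we.
have w1 : 1 / 2 <= cabs (w - 1).
  by have := cabsB_ge 1 w; rewrite cabs1 cabsBC; lra.
have w0 : w - 1 != 0 by rewrite -cabs_gt0; lra.
have -> : c / 2 * ((w + 1) / (w - 1)) - - (c / 2) = c * w / (w - 1) by field.
rewrite cabsM cabsV (cabsM c); apply: le_trans we.
rewrite ler_pdivrMr; last lra.
have P : 0 <= cabs c * cabs w by rewrite mulr_ge0 ?cabs_ge0.
have : cabs c * cabs w * (1 / 2) <= cabs c * cabs w * cabs (w - 1) by rewrite ler_wpM2l.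
have -> : 2 * cabs c * cabs w * cabs (w - 1) = 2 * (cabs c * cabs w * cabs
  (w - 1)) by ring.
lra.
Qed.

Lemma pfrac1N (v : C) : pfrac1 (- v) = - pfrac1 v.
Proof.
rewrite /pfrac1 e2piN; have w0 := e2pi_neq0 v; set w := e2pi v in w0 *.
have [->|w1] := eqVneq w 1; first by rewrite invr1 subrr invr0 !mulr0 oppr0.
have w2 : w - 1 != 0 by rewrite subr_eq0.
have -> : w^-1 - 1 = - (w - 1) / w by field.
by field; rewrite w0 w2.
Qed.

Section Columns.
Variable t : C.
Hypothesis tH : 0 < complex.Im t.

Let t0 : t != 0.
Proof. by apply: contraTneq tH => ->; rewrite ltxx. Qed.

Let ImV : complex.Im (t^-1) < 0.
Proof.
have -> : complex.Im t^-1 = - complex.Im t / cabs t ^+ 2.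
  have := im_div 1 t; rewrite div1r /= => ->; congr (_ / _); ring.
by rewrite mulNr oppr_lt0 divr_gt0 // exprn_gt0 // cabs_gt0.
Qed.

Let t' : C := - t^-1.

Lemma ImNV : 0 < complex.Im t'.
Proof. by rewrite /t' raddfN /= oppr_gt0. Qed.

Let Im_real (x : R) z : complex.Im (x%:C%C * z) = x * complex.Im z.
Proof. by case: z => a b /=; rewrite mul0r addr0. Qed.

Let half_off : offlat t (t / 2).
Proof.
have -> : t / 2 = ((1 : int)%:~R * t + (0 : int)%:~R) / 2%:R by rewrite mul1r addr0.
by apply: offlat_torsion.
Qed.

Let vn (n : int) : C := 2^-1 + n%:~R / t.

Let Im_half : complex.Im (2^-1 : C) = 0.
Proof. by rewrite -(rmorph_nat (real_complex R)) -fmorphV. Qed.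

Let half_nonint : nonint (2^-1 : C).
Proof.
move=> n /(congr1 (fun z => 2 * z)); rewrite mulfV ?pnatr_eq0 // => h.
have : (1 = 2 * n) by apply: (@intr_inj C); rewrite rmorphM.
lia.
Qed.

Let seg_nonint (n : int) (s : R) : nonint (vn n + s%:C%C / t).
Proof.
have -> : vn n + s%:C%C / t = 2^-1 + (n%:~R + s)%:C%C * t^-1.
  by rewrite /vn rmorphD /= rmorph_int; ring.
move=> k hk; have := congr1 (@complex.Im R) hk.
rewrite ImD Im_real Im_half add0r Im_int => /eqP.
rewrite mulf_eq0 (lt_eqF ImV) orbF => /eqP ns.
by move: hk; rewrite ns rmorph0 mul0r addr0; exact: half_nonint.
Qed.

Let vn_nonint n : nonint (vn n).
Proof. by have := @seg_nonint n 0; rewrite rmorph0 mul0r addr0. Qed.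

Let rho01 : 0 <= cabs (e2pi t') < 1.
Proof. by rewrite cabs_ge0 cabs_e2pi_lt1 ImNV. Qed.

(** The height of the segment is an odd multiple of half that of t. *)
Let row_seg (m : int) (s : R) : nonint (t / 2 + m%:~R * t + s%:C%C * 1).
Proof.
move=> k /(congr1 (@complex.Im R)); rewrite !ImD Im_int.
have -> : complex.Im (s%:C%C * 1) = 0 by rewrite Im_real mulr0.
have -> : t / 2 = (2^-1)%:C%C * t by rewrite fmorphV rmorph_nat mulrC.
rewrite -(rmorph_int (real_complex R)) !Im_real addr0 -mulrDl => /eqP.
rewrite mulf_eq0 (gt_eqF tH) orbF => /eqP h.
have : (1 + 2 * m) = 0.
  apply: (@intr_inj R); rewrite rmorphD rmorphM /=.
  have : 2 * (2^-1 + m%:~R) = 0 :> R by rewrite h mulr0.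
  by rewrite mulrDr mulfV ?pnatr_eq0.
lia.
Qed.

(** Summing the series of 1/u^2 over u in t/2 + Zt + Z by rows or by columns
    gives results that differ by 2 i pi / t: subtracting the telescoping family
    1/u - 1/(u + 1) makes the double series absolutely convergent, and its
    columns are evaluated with the cotangent. *)
Lemma rows_sub_columns Z Z' :
  hs (fun m : int => pfrac2 (t / 2 + m%:~R * t)) Z ->
  hs (fun m : int => pfrac2 (2^-1 + m%:~R * t')) Z' ->
  Z' = t ^+ 2 * Z - c * t.
Proof.
move=> hZ hZ'; have [d d0 hd] := half_off.
pose U (p : int * int) : C := t / 2 + latp t p.
have U0 p : U p != 0 by rewrite -cabs_gt0; have := hd p; rewrite -/(U p); lra.
have U1E p : U p + 1 = U (p.1, p.2 + 1) by rewrite /U /latp /= rmorphD /=; ring.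
have U1 p : U p + 1 != 0 by rewrite U1E.
pose F p : C := (U p ^+ 2)^-1 + ((U p + 1)^-1 - (U p)^-1).
have aF : asum F.
  apply: (@asum_le _ _ _ _ (1 + 1 / d) _ (asum_off3 tH half_off)) => p.
  have -> : F p = (U p)^-1 ^+ 2 * (U p + 1)^-1.
    by rewrite /F exprVn; move: (U p) (U0 p) (U1 p) => x x0 x1; field; rewrite x0 x1.
  rewrite -/(U p) -exprVn [(U p)^-1 ^+ 3]exprSr cabsM (cabsM (_ ^+ 2)) mulrCA.
  rewrite ler_wpM2l ?cabs_ge0 // !cabsV.
  have up : 0 < cabs (U p) by rewrite cabs_gt0.
  have up1 : 0 < cabs (U p + 1) by rewrite cabs_gt0.
  rewrite ler_pdivlMr // mulrC ler_pdivrMr //.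
  have := cabsB (U p + 1) 1; rewrite addrK cabs1 => /le_trans; apply.
  have -> : (1 + 1 / d) * cabs (U p + 1) = cabs (U p + 1) + cabs (U p + 1) / d by ring.
  by rewrite lerD2l ler_pdivlMr // mul1r U1E; exact: hd.
have [s hF] := asum_hs aF.
have sZ : s = Z.
  apply: hs_unique (hs_fubini (r := fun m => pfrac2 (t / 2 + m%:~R * t)) hF _) hZ => m.
  have := hsD (pfrac2P (@offlat_nonint R t (t / 2) m half_off))
    (pfrac1P (a := t / 2 + m%:~R * t) (b := 1) (fun s _ => @row_seg m s)).
  have -> : pfrac1 (t / 2 + m%:~R * t + 1) = pfrac1 (t / 2 + m%:~R * t).
    by rewrite /pfrac1 (_ : 1 = 1%:~R) // e2piDint.
  rewrite subrr addr0; apply: hs_ext => n; rewrite /F /U /latp /=.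
  by rewrite [_ + 1 + n%:~R]addrAC !addrA.
pose col n : C := t ^- 2 * pfrac2 (vn n) + (t^-1 * pfrac1 (vn (n + 1)) - t^-1 * pfrac1
  (vn n)).
have hcol : hs col s.
  apply: hs_fubini (hs_swap hF) _ => n /=.
  have h1 := hsZ (t ^- 2) (pfrac2P (@vn_nonint n)).
  have h2 := hsZ t^-1 (pfrac1P (a := vn n) (b := t^-1) (fun s _ => @seg_nonint n s)).
  have e1 : vn n + t^-1 = vn (n + 1) by rewrite /vn rmorphD /=; ring.
  rewrite e1 mulrBr in h2.
  apply: hs_ext (hsD h1 h2) => m.
  have uv : U (m, n) = t * (vn n + m%:~R) by rewrite /U /latp /vn /=; field.
  have uv1 : U (m, n) + 1 = t * (vn (n + 1) + m%:~R).
    by rewrite -e1 uv; field.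
  by rewrite /F uv1 uv exprMn !invfM; ring.
have hN : hs (fun n => t ^- 2 * pfrac2 (vn n)) (t ^- 2 * Z').
  apply: hsZ; have := (hs_int_opp _ _).1 hZ'; apply: hs_ext => n.
  by rewrite /vn /t' rmorphN /= mulrNN.
have hT := hsB hcol hN; rewrite sZ in hT.
have e : Z - t ^- 2 * Z' = t^-1 * (c / 2) - t^-1 * (- (c / 2)).
  apply: (hs_int_telescope (g := fun n => t^-1 * pfrac1 (vn n)) hT) => [n|e e0].
    by rewrite /col addrC addKr.
  have T0 : 0 < cabs t^-1 by rewrite cabs_gt0 invr_eq0.
  have C0 : 0 < 2 * cabs c by rewrite mulr_gt0 // cabs_gt0 tpi_neq0.
  have m0 : 0 < Num.min (1 / 2) (e / cabs t^-1 /
    (2 * cabs c)) by rewrite lt_min !divr_gt0.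
  have [N hN'] := pow_small rho01 m0; exists N => n /hN'.
  rewrite le_min => /andP[w2 we].
  have we' : 2 * cabs c * cabs (e2pi t') ^+ n <= e / cabs t^-1.
    by rewrite mulrC -ler_pdivlMr.
  have wN : cabs (e2pi (vn (- n%:Z))) = cabs (e2pi t') ^+ n.
    have -> : vn (- n%:Z) = 2^-1 + n%:R * t' by rewrite /vn /t' rmorphN /=; ring.
    by rewrite e2piD e2pi_half mulN1r cabsN e2piMn cabsX.
  have wP : cabs (e2pi (- vn n%:Z)) = cabs (e2pi t') ^+ n.
    have -> : - vn n%:Z = - 2^-1 + n%:R * t' by rewrite /vn /t' /=; ring.
    by rewrite e2piD e2piN e2pi_half cabsM cabsV cabsN cabs1 invr1 mul1r e2piMn cabsX.
  split; rewrite -mulrBr cabsM mulrC -ler_pdivlMr //.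
    rewrite -[vn n]opprK pfrac1N.
    have -> : - pfrac1 (- vn n) - c / 2 = - (pfrac1 (- vn n) - - (c / 2)) by ring.
    by rewrite cabsN; apply: pfrac1_small; rewrite wP.
  by apply: pfrac1_small; rewrite wN.
have -> : Z' = t ^+ 2 * Z - t ^+ 2 * (Z - t ^- 2 * Z') by field.
by rewrite e; field.
Qed.

Let S : 'M[int]_2 := \matrix_(i, j) (if i == 0 then (if j == 0 then 0 else -1) else
  (if j == 0 then 1 else 0)).

(** c (1 - 24 D) is c times the Eisenstein series of weight 2. The Weierstrass
    series at t/2 is the sum of the rows of 1/u^2 minus an Eisenstein series:
    it transforms with weight 2, and the rows of 1/u^2 by rows_sub_columns. *)
Lemma eisenstein2_inv D D' :
  hs (fun i => 1 * e2pi t ^+ i.+1 / (1 - 1 * e2pi t ^+ i.+1) ^+ 2) D ->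
  hs (fun i => 1 * e2pi t' ^+ i.+1 / (1 - 1 * e2pi t' ^+ i.+1) ^+ 2) D' ->
  c * (1 - 24 * D') = t ^+ 2 * (c * (1 - 24 * D)) + 12 * t.
Proof.
move=> hD hD'.
have SS : SL2Z S.
  rewrite /SL2Z /= (expand_det_row _ 0) !big_ord_recl big_ord0 addr0.
  by rewrite /cofactor !det_mx11 !mxE /= !mul0r add0r expr1 mulN1r.
have jS : (S 1 0)%:~R * t + (S 1 1)%:~R = t by rewrite !mxE /= mul1r addr0.
have mS : moebius S t = t'.
  by rewrite /moebius jS !mxE /= mul0r add0r mulN1r.
have [s hs1] := asum_hs (asum_wpt tH half_off).
have := wpt_moebius SS tH hs1; rewrite jS mS.
have -> : t / 2 / t = 2^-1 by field.
move=> hs2.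
have off2 : offlat t' 2^-1.
  have -> : 2^-1 = ((0 : int)%:~R * t' + (1 : int)%:~R) / 2%:R :> C by rewrite mul0r
    add0r mul1r.
  by apply: offlat_torsion => //; exact: ImNV.
have uT : - complex.Im t < complex.Im (t / 2) < complex.Im t.
  have -> : t / 2 = (2^-1)%:C%C * t by rewrite fmorphV rmorph_nat mulrC.
  rewrite Im_real; have := tH; move: (complex.Im t) => y y0.
  by apply/andP; split; lra.
have uT' : - complex.Im t' < complex.Im (2^-1 : C) < complex.Im t'.
  by rewrite Im_half oppr_lt0 ImNV.
have [A [hA _]] := rows1 (rows_q1 tH) (rows_wq1 uT).
have [B [hB _]] := rows1 (rows_q1 tH) (rows_wVq1 uT).
have [A' [hA' _]] := rows1 (rows_q1 ImNV) (rows_wq1 uT').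
have [B' [hB' _]] := rows1 (rows_q1 ImNV) (rows_wVq1 uT').
have hZ := hs_pfrac2_rows hA hB; have hZ' := hs_pfrac2_rows hA' hB'.
set Z := c ^+ 2 * _ in hZ; set Z' := c ^+ 2 * _ in hZ'.
have e1 := hs_unique (hs_fubini hs1 (fun m => wpt_row tH m half_off))
  (hsB hZ (hs_eisenstein_rows tH hD)).
have e2 := hs_unique (hs_fubini hs2 (fun m => wpt_row ImNV m off2))
  (hsB hZ' (hs_eisenstein_rows ImNV hD')).
have e3 := rows_sub_columns hZ hZ'.
have c0 := tpi_neq0 R; apply: (mulfI c0).
have e4 : - c ^+ 2 / 12 + 2 * c ^+ 2 * D' =
    t ^+ 2 * (- c ^+ 2 / 12 + 2 * c ^+ 2 * D) - c * t.
  have -> : - c ^+ 2 / 12 + 2 * c ^+ 2 * D' = Z' - t ^+ 2 * s by rewrite e2; ring.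
  have -> : - c ^+ 2 / 12 + 2 * c ^+ 2 * D = Z - s by rewrite e1; ring.
  by rewrite e3; ring.
have -> : c * (c * (1 - 24 * D')) = - 12 * (- c ^+ 2 / 12 + 2 * c ^+ 2 * D') by field.
by rewrite e4; field.
Qed.

End Columns.

End Eisenstein2.

(** * Modularity of the discriminant *)

Section DeltaModular.
Variable R : realType.
Local Notation C := R[i].
Local Notation c := (tpi R).
Implicit Types (t u z q : C).

Let lDelta z : C := c * z - 24 * eulerlog (e2pi z).

Let DeltaE' t : 0 < complex.Im t -> Delta t = cexp (lDelta t).
Proof. by move=> tH; rewrite DeltaE // /lDelta cexpD e2piE. Qed.

Let lDelta_deriv : exists L', (forall z, 0 < complex.Im z ->
    cderiv_at lDelta z (c * (1 - 24 * (e2pi z * L' (e2pi z))))) /\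
  forall q, cabs q < 1 -> hs (fun i => 1 * q ^+ i.+1 / (1 - 1 * q ^+ i.+1) ^+ 2)
    (q * L' q).
Proof.
have [L' [hL' hD]] := eulerlog_deriv R; exists L'; split=> // z zH.
have q1 : cabs (e2pi z) < 1 by rewrite cabs_e2pi_lt1.
have h1 := cderiv_comp (cderiv_e2pi z) (cderiv_pser (@pser_eulerlog R) hL' q1).
have := cderivB (cderivMl c (cderiv_id z)) (cderivMl 24 h1).
have -> // : c * 1 - 24 * (L' (e2pi z) * (c * e2pi z)) = c * (1 - 24 * (e2pi z * L'
  (e2pi z))).
by ring.
Qed.

(** The logarithmic derivative of the quotient of the two sides vanishes by the
    transformation of the weight 2 Eisenstein series; the value at i is 1. *)
Lemma Delta_inv t : 0 < complex.Im t -> Delta (- t^-1) = t ^+ 12 * Delta t.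
Proof.
move=> tH; have [L' [hL hD]] := lDelta_deriv.
pose phi z := lDelta (- z^-1) - lDelta z.
pose psi z := cexp (phi z) * z^-1 ^+ 12.
have nz z : 0 < complex.Im z -> z != 0.
  by move=> zH; apply: contraTneq zH => ->; rewrite ltxx.
have dpsi z : 0 < complex.Im z -> cderiv_at psi z 0.
  move=> zH; have z0 := nz z zH; have zH' := ImNV zH.
  have e := eisenstein2_inv zH (hD _ (rows_q1 zH)) (hD _ (rows_q1 zH')).
  have d1 : cderiv_at (fun z => - z^-1) z (- - z ^- 2) := cderivN (cderiv_inv z0).
  have dphi := cderivB (cderiv_comp d1 (hL _ zH')) (hL _ zH).
  have dexp := cderiv_comp dphi (cderiv_cexp (phi z)).
  have := cderivM dexp (cderivX 12 (cderiv_inv z0)).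
  set E' := c * (1 - _) in e *; set E := c * (1 - _) in e *.
  have -> // : cexp (phi z) * (E' * - - z ^- 2 - E) * z^-1 ^+ 12 +
     cexp (phi z) * (12%:R * z^-1 ^+ 12.-1 * - z ^- 2) = 0.
  by rewrite e /=; field.
have psiE z : psi z = cexp (phi z) * z^-1 ^+ 12 by [].
have i1 : psi t = psi 'i%C.
  have -> : t = 'i%C + (t - 'i%C) by ring.
  apply: cderiv0_segment => s /andP[s0 s1]; apply: dpsi.
  have -> : complex.Im ('i%C + s%:C%C * (t - 'i%C)) = (1 - s) + s * complex.Im t.
    by case: (t) => x y /=; ring.
  have : 0 <= s * complex.Im t by rewrite mulr_ge0 // ltW.
  move=> h; have [s1'|s1'] := eqVneq s 1; first by rewrite s1' mul1r subrr add0r.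
  have : s < 1 by rewrite lt_neqAle s1'.
  lra.
have i0 : 'i%C != 0 :> C by rewrite -cabs_gt0 cabs_i.
have i2 : 'i%C ^+ 2 = -1 :> C := sqr_i R.
have iV : - ('i%C)^-1 = 'i%C :> C.
  apply: (mulfI i0); rewrite mulrN mulfV // -expr2 i2 //.
have psii : psi 'i%C = 1.
  rewrite psiE /phi iV subrr cexp0 mul1r exprVn.
  have -> : 'i%C ^+ 12 = ('i%C ^+ 2) ^+ 6 :> C by rewrite -exprM.
  by rewrite i2 -signr_odd /= expr0 invr1.
have t0 := nz t tH.
rewrite !DeltaE' ?ImNV //; have := psii; rewrite -i1 psiE /phi cexpD cexpN exprVn.
have e0 := cexp_neq0 (lDelta t).
move: (cexp (lDelta (- t^-1))) (cexp (lDelta t)) e0 => X Y Y0 h.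
have -> : X = (X / Y / t ^+ 12) * (t ^+ 12 * Y).
  by field; rewrite t0 Y0.
by rewrite h mul1r.
Qed.

Lemma Delta_int t (n : int) : 0 < complex.Im t -> Delta (t + n%:~R) = Delta t.
Proof.
move=> tH; have tH' : 0 < complex.Im (t + n%:~R) by rewrite ImD Im_int addr0.
by rewrite !DeltaE // e2piDint.
Qed.

Let fracIm (a b c' d : int) t : a * d - b * c' = 1 -> 0 < complex.Im t ->
  c'%:~R * t + d%:~R != 0 /\
  0 < complex.Im ((a%:~R * t + b%:~R) / (c'%:~R * t + d%:~R)).
Proof.
move=> e tH; have j0 : c'%:~R * t + d%:~R != 0.
  apply/eqP => j0; have := latp_eq0 tH (c', d); rewrite /latp /= j0 eqxx.
  by move=> /esym /eqP [c0 d0]; move: e; rewrite c0 d0 !mulr0 subrr.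
split=> //; rewrite im_div divr_gt0 ?exprn_gt0 ?cabs_gt0 // !Im_lin !Re_lin.
have eR : a%:~R * d%:~R - b%:~R * c'%:~R = 1 :> R by rewrite -!rmorphM -rmorphB e.
have -> : a%:~R * complex.Im t * (c'%:~R * complex.Re t + d%:~R) -
   (a%:~R * complex.Re t + b%:~R) * (c'%:~R * complex.Im t) =
   complex.Im t * (a%:~R * d%:~R - b%:~R * c'%:~R) by ring.
by rewrite eR mulr1.
Qed.

(** Descent on the lower-left entry by Euclidean division. *)
Lemma Delta_frac (a b c' d : int) t : a * d - b * c' = 1 -> 0 < complex.Im t ->
  Delta ((a%:~R * t + b%:~R) / (c'%:~R * t + d%:~R)) =
  (c'%:~R * t + d%:~R) ^+ 12 * Delta t.
Proof.
move: {2}`|c'|.+1%N (ltnSn `|c'|%N) => n; elim: n a b c' d => // n IH a b c' d cn e tH.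
have [c0|c0] := eqVneq c' 0.
  have d1 : (d = 1 /\ a = 1) \/ (d = -1 /\ a = -1).
    have ad : a * d = 1 by rewrite -e c0 mulr0 subr0.
    have : (`|a| * `|d| = 1)%N by rewrite -abszM ad.
    move=> /eqP; rewrite muln_eq1 => /andP[/eqP ? /eqP ?]; nia.
  rewrite c0 mul0r add0r; case: d1 => -[-> ->].
    by rewrite mul1r divr1 expr1n mul1r Delta_int.
  have -> : ((-1)%:~R * t + b%:~R) / (-1)%:~R = t + (- b)%:~R :> C.
    by rewrite !rmorphN /=; field.
  by rewrite Delta_int // rmorphN /= -signr_odd /= expr0 mul1r.
pose k := (a %/ c')%Z; pose a' := a - k * c'; pose b' := b - k * d.
have a'c : (`|a'| < `|c'|)%N.
  have -> : a' = (a %% c')%Z by rewrite /a' /k {1}(divz_eq a c'); ring.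
  have := ltz_mod a c0; have := modz_ge0 a c0; lia.
have e' : a' * d - b' * c' = 1 by rewrite -e /a' /b'; ring.
have eB : c' * - b' - d * - a' = 1 by rewrite -e'; ring.
have [j0 _] := fracIm e tH; have [j1 BH] := fracIm eB tH.
have nB : (`|(- a')%R| < n)%N by lia.
have hB := IH c' d (- a') (- b') nB eB tH.
have [_ A1H] := fracIm e' tH.
have -> : (a%:~R * t + b%:~R) / (c'%:~R * t + d%:~R) =
   (a'%:~R * t + b'%:~R) / (c'%:~R * t + d%:~R) + k%:~R.
  by rewrite /a' /b' !rmorphB !rmorphM /=; field.
rewrite Delta_int //.
have -> : (a'%:~R * t + b'%:~R) / (c'%:~R * t + d%:~R) =
   - ((c'%:~R * t + d%:~R) / ((- a')%:~R * t + (- b')%:~R))^-1.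
  by rewrite !rmorphN /= mulNr -opprD invrN mulrN invrN opprK invf_div.
rewrite (Delta_inv BH) hB expr_div_n.
by move: j1; set y := _ + (- b')%:~R => j1; field.
Qed.

Lemma Delta_moebius A t : SL2Z A -> 0 < complex.Im t ->
  Delta (moebius A t) = ((A 1 0)%:~R * t + (A 1 1)%:~R) ^+ 12 * Delta t.
Proof. by move=> AS tH; apply: Delta_frac => //; exact: SL2Z_det. Qed.

End DeltaModular.

(** * Expansions of x and y at the roots of unity *)

Section LambertSeries.
Variable R : realType.
Local Notation C := R[i].
Implicit Types (x q w X : C).

Section Family.
Variables (ga : C) (eb : nat -> nat) (k : nat).
Hypothesis ga1 : cabs ga <= 1.
Hypothesis eb1 : forall i, (0 < eb i)%N.
Hypothesis ebi : forall i, (i <= eb i)%N.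

Definition lamc (i m : nat) : C := m.+1%:R ^+ k * ga ^+ m.+1.
Definition lame (i m : nat) : nat := (eb i * m.+1)%N.
Definition lamcoef : nat -> C := dfcoef lamc lame.

Let lame1 i m : (i <= lame i m)%N.
Proof. by have := ebi i; rewrite /lame; nia. Qed.

Let lame2 i m : (m <= lame i m)%N.
Proof. by have := eb1 i; rewrite /lame; nia. Qed.

Let lamc_bound i m : cabs (lamc i m) <= 1 * m.+1%:R ^+ k.
Proof.
rewrite /lamc mul1r cabsM !cabsX cabs_nat ler_piMr ?exprn_ge0 //.
by rewrite exprn_ile1 ?cabs_ge0.
Qed.

(** With exponents eb in arithmetic progression this covers both the
    expansion at infinity and those at the division points. *)
Lemma lambert : exists f, pser lamcoef f /\ forall X, cabs X < 1 ->
  hs (fun p : nat * nat => p.2.+1%:R ^+ k * (ga * X ^+ eb p.1) ^+ p.2.+1) (f X).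
Proof.
have [f hf] := dfam_fun lame1 lame2 lamc_bound; exists f; split.
  by rewrite /lamcoef; exact: (pser_dfam lame1 lame2 lamc_bound hf).
move=> X X1; apply: hs_ext (hf X X1) => p.
by rewrite /dfam /lamc /lame exprMn -exprM; ring.
Qed.

Let gaX X i : cabs X < 1 -> cabs (ga * X ^+ eb i) < 1.
Proof.
move=> X1; rewrite cabsM cabsX.
have h : cabs X ^+ eb i < 1 by rewrite exprn_ilt1 ?cabs_ge0 // -lt0n.
apply: le_lt_trans h; by rewrite ler_piMl // exprn_ge0 ?cabs_ge0.
Qed.

Lemma lambert_row1 X s : cabs X < 1 ->
  hs (fun p : nat * nat => p.2.+1%:R ^+ 1 * (ga * X ^+ eb p.1) ^+ p.2.+1) s ->
  hs (fun i => ga * X ^+ eb i / (1 - ga * X ^+ eb i) ^+ 2) s.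
Proof. by move=> X1 h; apply: hs_fubini h _ => i; exact: hs_row1 (gaX _ X1). Qed.

Lemma lambert_row2 X s : cabs X < 1 ->
  hs (fun p : nat * nat => p.2.+1%:R ^+ 2 * (ga * X ^+ eb p.1) ^+ p.2.+1) s ->
  hs (fun i => ga * X ^+ eb i * (1 + ga * X ^+ eb i) / (1 - ga * X ^+ eb i) ^+ 3) s.
Proof. by move=> X1 h; apply: hs_fubini h _ => i; exact: hs_row2 (gaX _ X1). Qed.

End Family.

Definition qcoefx (b : C) (n : nat) : C :=
  (if n is 0%N then 12%:R^-1 + b / (1 - b) ^+ 2 else 0) +
  (lamcoef b succn 1 n + lamcoef b^-1 succn 1 n + - 2 * lamcoef 1 succn 1 n).

Definition qcoefy (b : C) (n : nat) : C :=
  (if n is 0%N then (b + b ^+ 2) / (2 * (1 - b) ^+ 3) else 0) +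
  2^-1 * (lamcoef b succn 2 n + -1 * lamcoef b^-1 succn 2 n).

Lemma pser_xser (b : C) : cabs b = 1 -> pser (qcoefx b) (xser b).
Proof.
move=> b1; have b0 : b != 0 by rewrite -cabs_gt0 b1.
have bV1 : cabs b^-1 = 1 by rewrite cabsV b1 invr1.
have bl : cabs b <= 1 by rewrite b1.
have bVl : cabs b^-1 <= 1 by rewrite bV1.
have o1 : cabs (1 : C) <= 1 by rewrite cabs1.
have [A [pA hA]] := @lambert b succn 1 bl (fun=> isT) leqnSn.
have [B [pB hB]] := @lambert b^-1 succn 1 bVl (fun=> isT) leqnSn.
have [D [pD hD]] := @lambert 1 succn 1 o1 (fun=> isT) leqnSn.
have h := pserD (pser_cst (12%:R^-1 + b / (1 - b) ^+ 2)) (pserD (pserD pA pB) (pserZ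
  (- 2) pD)).
move=> X X1; have [h1 h2] := h X X1; split; first exact: h1.
have -> : xser b X = 12%:R^-1 + b / (1 - b) ^+ 2 + (A X + B X + - 2 * D X);
  last exact: h2.
have bX : cabs (b * X) < 1 by rewrite cabsM b1 mul1r.
have bVX : cabs (b^-1 * X) < 1 by rewrite cabsM bV1 mul1r.
have e1 : forall i, (0 < i.+1)%N by [].
have rD := lambert_row1 o1 e1 X1 (hD X X1).
rewrite (xserE (D := D X) b0 X1 bX bVX (lambert_row1 bl e1 X1 (hA X X1))
  (lambert_row1 bVl e1 X1 (hB X X1))); first by ring.
by apply: hs_ext rD => i; rewrite mul1r.
Qed.

Lemma pser_yser (b : C) : cabs b = 1 -> pser (qcoefy b) (yser b).
Proof.
move=> b1; have b0 : b != 0 by rewrite -cabs_gt0 b1.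
have bV1 : cabs b^-1 = 1 by rewrite cabsV b1 invr1.
have bl : cabs b <= 1 by rewrite b1.
have bVl : cabs b^-1 <= 1 by rewrite bV1.
have [A [pA hA]] := @lambert b succn 2 bl (fun=> isT) leqnSn.
have [B [pB hB]] := @lambert b^-1 succn 2 bVl (fun=> isT) leqnSn.
have h := pserD (pser_cst ((b + b ^+ 2) / (2 * (1 - b) ^+ 3))) (pserZ 2^-1 (pserD pA
  (pserZ (-1) pB))).
move=> X X1; have [h1 h2] := h X X1; split; first exact: h1.
have -> : yser b X = (b + b ^+ 2) / (2 * (1 - b) ^+ 3) + 2^-1 * (A X + -1 * B X);
  last exact: h2.
have bX : cabs (b * X) < 1 by rewrite cabsM b1 mul1r.
have bVX : cabs (b^-1 * X) < 1 by rewrite cabsM bV1 mul1r.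
have e1 : forall i, (0 < i.+1)%N by [].
by rewrite (yserE b0 X1 bX bVX (lambert_row2 bl e1 X1 (hA X X1))
  (lambert_row2 bVl e1 X1 (hB X X1))) mulN1r.
Qed.

(** * Expansions at the division points *)

Section DivisionPoints.
Variables (l a : nat) (b : C).
Hypothesis b1 : cabs b = 1.
Hypothesis a0 : (0 < a)%N.
Hypothesis al : (a < l)%N.

Let eA i := (a + l * i)%N.
Let eB i := (l * i.+1 - a)%N.
Let eD i := (l * i.+1)%N.

Let b0 : b != 0. Proof. by rewrite -cabs_gt0 b1. Qed.
Let bV1 : cabs b^-1 = 1. Proof. by rewrite cabsV b1 invr1. Qed.
Let bl : cabs b <= 1. Proof. by rewrite b1. Qed.
Let bVl : cabs b^-1 <= 1. Proof. by rewrite bV1. Qed.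
Let eA1 i : (0 < eA i)%N. Proof. by rewrite /eA; lia. Qed.
Let eA2 i : (i <= eA i)%N. Proof. by rewrite /eA; nia. Qed.
Let eB1 i : (0 < eB i)%N. Proof. by rewrite /eB; nia. Qed.
Let eB2 i : (i <= eB i)%N. Proof. by rewrite /eB; nia. Qed.
Let eD1 i : (0 < eD i)%N. Proof. by rewrite /eD; nia. Qed.
Let eD2 i : (i <= eD i)%N. Proof. by rewrite /eD; nia. Qed.

Let bounds X : X != 0 -> cabs X < 1 -> [/\ b * X ^+ a != 0, cabs (X ^+ l) < 1,
  cabs (b * X ^+ a * X ^+ l) < 1 & cabs ((b * X ^+ a)^-1 * X ^+ l) < 1].
Proof.
move=> X0 X1; have p n : (0 < n)%N -> cabs (X ^+ n) < 1.
  by move=> n0; rewrite cabsX exprn_ilt1 ?cabs_ge0 // -lt0n.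
split; first by rewrite mulf_neq0 // expf_neq0.
- by apply: p; lia.
- by rewrite -mulrA -exprD cabsM b1 mul1r p //; lia.
have -> : (b * X ^+ a)^-1 * X ^+ l = b^-1 * X ^+ (l - a).
  rewrite invfM -mulrA -{1}(subnKC (ltnW al)) [X ^+ (a + _)]exprD mulKf //.
  by rewrite expf_neq0.
by rewrite cabsM bV1 mul1r p //; lia.
Qed.

Let rowA X i : b * X ^+ a * (X ^+ l) ^+ i = b * X ^+ eA i.
Proof. by rewrite -mulrA -exprM -exprD. Qed.

Let rowB X i : X != 0 -> (b * X ^+ a)^-1 * (X ^+ l) ^+ i.+1 = b^-1 * X ^+ eB i.
Proof.
move=> X0; rewrite invfM -exprM -mulrA; congr (_ * _).
have -> : (l * i.+1 = a + eB i)%N by rewrite /eB; nia.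
by rewrite [X ^+ (a + _)]exprD mulKf // expf_neq0.
Qed.

(** For w = b X^a and q = X^l with 0 < a < l, the three Lambert series of
    xserE are series in X with the positive exponents a + l i, l (i + 1) - a
    and l (i + 1); the isolated term w / (1 - w)^2 completes the first one, as
    its term i = 0. *)
Lemma xser_division : exists c f, pser c f /\ forall X, X != 0 -> cabs X < 1 ->
  xser (b * X ^+ a) (X ^+ l) = f X.
Proof.
have [A [pA hA]] := lambert 1 bl eA1 eA2.
have [B [pB hB]] := lambert 1 bVl eB1 eB2.
have o1 : cabs (1 : C) <= 1 by rewrite cabs1.
have [D [pD hD]] := lambert 1 o1 eD1 eD2.
eexists; exists (fun X => 12%:R^-1 + ((A X + B X) + - 2 * D X)); split.
  exact: pserD (pser_cst _) (pserD (pserD pA pB) (pserZ (- 2) pD)).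
move=> X X0 X1; have [w0 q1 wq wVq] := bounds X0 X1.
have rA := lambert_row1 bl eA1 X1 (hA X X1).
have rA' := hs_nat_shift rA.
have rB := lambert_row1 bVl eB1 X1 (hB X X1).
have rD := lambert_row1 o1 eD1 X1 (hD X X1).
rewrite (xserE (A := A X - b * X ^+ eA 0 / (1 - b * X ^+ eA 0) ^+ 2) (B := B X)
  (D := D X) w0 q1 wq wVq).
- by rewrite -(rowA X 0) expr0 mulr1; ring.
- by apply: hs_ext rA' => i; rewrite rowA.
- by apply: hs_ext rB => i; rewrite rowB.
- by apply: hs_ext rD => i; rewrite -exprM mul1r.
Qed.

Lemma yser_division : exists c f, pser c f /\ forall X, X != 0 -> cabs X < 1 ->
  yser (b * X ^+ a) (X ^+ l) = f X.
Proof.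
have [A [pA hA]] := lambert 2 bl eA1 eA2.
have [B [pB hB]] := lambert 2 bVl eB1 eB2.
eexists; exists (fun X => 2^-1 * (A X + -1 * B X)); split.
  exact: pserZ 2^-1 (pserD pA (pserZ (-1) pB)).
move=> X X0 X1; have [w0 q1 wq wVq] := bounds X0 X1.
have rA := lambert_row2 bl eA1 X1 (hA X X1).
have rA' := hs_nat_shift rA.
have rB := lambert_row2 bVl eB1 X1 (hB X X1).
rewrite (yserE (A := A X - b * X ^+ eA 0 * (1 + b * X ^+ eA 0) / (1 - b * X ^+ eA 0) ^+ 3)
  (B := B X) w0 q1 wq wVq).
- rewrite -(rowA X 0) expr0 mulr1 [(2 * _)^-1]invfM.
  by move: ((1 - b * X ^+ a) ^+ 3)^-1 => z; ring.
- by apply: hs_ext rA' => i; rewrite rowA.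
- by apply: hs_ext rB => i; rewrite rowB.
Qed.

End DivisionPoints.

End LambertSeries.

(** * Coefficients as rational functions of the root of unity *)

Section RationalCoefficients.
Variable R : realType.
Local Notation C := R[i].
Variable l : nat.
Hypothesis l0 : (0 < l)%N.

(** One polynomial serves all the nontrivial l-th roots of unity: by
    equivariant_gauss, the sums over these roots are then equivariant. *)
Definition ratfun (F : C -> C) := exists P : {poly rat}, forall b,
  b ^+ l = 1 -> b != 1 -> F b = (map_poly ratr P).[b].

Lemma ratfun_ext F G : (forall b, b ^+ l = 1 -> b != 1 -> F b = G b) ->
  ratfun F -> ratfun G.
Proof. by move=> FG [P h]; exists P => b b1 b2; rewrite -FG // h. Qed.

Lemma ratfunD F G : ratfun F -> ratfun G -> ratfun (fun b => F b + G b).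
Proof.
by move=> [P hP] [Q hQ]; exists (P + Q) => b b1 b2; rewrite rmorphD hornerD hP // hQ.
Qed.

Lemma ratfunM F G : ratfun F -> ratfun G -> ratfun (fun b => F b * G b).
Proof.
by move=> [P hP] [Q hQ]; exists (P * Q) => b b1 b2; rewrite rmorphM hornerM hP // hQ.
Qed.

Lemma ratfun_rat (x : rat) : ratfun (fun=> ratr x).
Proof. by exists x%:P => b _ _; rewrite map_polyC hornerC. Qed.

Lemma ratfun_nat n : ratfun (fun=> n%:R).
Proof. by apply: ratfun_ext (ratfun_rat n%:R) => b _ _; rewrite ratr_nat. Qed.

Lemma ratfun_natV n : ratfun (fun=> n%:R^-1).
Proof. by apply: ratfun_ext (ratfun_rat n%:R^-1) => b _ _;
  rewrite fmorphV rmorph_nat. Qed.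

Lemma ratfun_id : ratfun id.
Proof. by exists 'X => b _ _; rewrite map_polyX hornerX. Qed.

Lemma ratfunN F : ratfun F -> ratfun (fun b => - F b).
Proof. by move=> [P hP]; exists (- P) => b b1 b2; rewrite rmorphN hornerN hP. Qed.

Lemma ratfunX F n : ratfun F -> ratfun (fun b => F b ^+ n).
Proof.
move=> rF; elim: n => [|n IH]; first exact: ratfun_nat 1.
by apply: ratfun_ext (ratfunM rF IH) => b _ _; rewrite exprS.
Qed.

Lemma ratfun_sum (I : Type) (s : seq I) (F : I -> C -> C) :
  (forall i, ratfun (F i)) -> ratfun (fun b => \sum_(i <- s) F i b).
Proof.
move=> rF; elim: s => [|i s IH].
  by apply: ratfun_ext (ratfun_nat 0) => b _ _; rewrite big_nil.
by apply: ratfun_ext (ratfunD (rF i) IH) => b _ _; rewrite big_cons.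
Qed.

Lemma ratfunV : ratfun (fun b => b^-1).
Proof.
apply: ratfun_ext (ratfunX l.-1 ratfun_id) => b bl _ /=.
have b0 : b != 0.
  apply: contra_eq_neq bl => ->; rewrite expr0n gtn_eqF //; exact/eqP/nesym/eqP/oner_neq0.
by apply: (mulfI b0); rewrite -exprS prednK // bl mulfV.
Qed.

(** (1 - b) times the sum of j b^j over j < l is - l, when b^l = 1 and b is
    not 1. *)
Lemma ratfun_sub1V : ratfun (fun b => (1 - b)^-1).
Proof.
have h : ratfun (fun b => - (l%:R^-1 * \sum_(j <- iota 0 l) j%:R * b ^+ j)).
  apply: ratfunN; apply: ratfunM; first exact: ratfun_natV.
  apply: ratfun_sum => j; apply: ratfunM; first exact: ratfun_nat.
  exact: ratfunX ratfun_id.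
apply: ratfun_ext h => b bl b1 /=.
have d0 : 1 - b != 0 by rewrite subr_eq0 eq_sym.
have lC : l%:R != 0 :> C by rewrite pnatr_eq0 -lt0n.
have E n : (1 - b) * ((1 - b) * \sum_(j <- iota 0 n) j%:R * b ^+ j) =
    b - n%:R * b ^+ n * (1 - b) - b ^+ n.+1.
  elim: n => [|n IH]; first by rewrite big_nil expr1; ring.
  rewrite -[in iota _ _]addn1 iotaD big_cat /= big_seq1 add0n !mulrDr IH.
  by rewrite !exprS -natr1; ring.
have E1 : (1 - b) * \sum_(j <- iota 0 l) j%:R * b ^+ j = - l%:R.
  apply: (mulfI d0); rewrite E exprS bl; ring.
by apply: (mulfI d0); rewrite mulfV // mulrN mulrCA E1 mulrN opprK mulVf.
Qed.

Lemma ratfun_lamcoef F k n : ratfun F -> ratfun (fun b => lamcoef (F b) succn k n).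
Proof.
move=> rF; apply: ratfun_sum => p; apply: ratfunM; last exact: ratfunX.
by apply: ratfunX; exact: ratfun_nat.
Qed.

Lemma ratfun_qcoefx n : ratfun (fun b => qcoefx b n).
Proof.
have r1 : ratfun (fun b => 12%:R^-1 + b / (1 - b) ^+ 2).
  apply: ratfunD (ratfun_natV 12) (ratfunM ratfun_id _).
  by apply: ratfun_ext (ratfunX 2 ratfun_sub1V) => b _ _; rewrite exprVn.
apply: ratfunD; first by case: n => [|n]; [exact: r1|exact: ratfun_nat 0].
apply: ratfunD.
  by apply: ratfunD; apply: ratfun_lamcoef; [exact: ratfun_id|exact: ratfunV].
by apply: ratfunM; [exact: ratfunN (ratfun_nat 2)|exact: ratfun_lamcoef (ratfun_nat 1)].
Qed.

Lemma ratfun_qcoefy n : ratfun (fun b => qcoefy b n).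
Proof.
have r1 : ratfun (fun b => (b + b ^+ 2) / (2 * (1 - b) ^+ 3)).
  apply: ratfun_ext (ratfunM (ratfunD ratfun_id (ratfunX 2 ratfun_id))
    (ratfunM (ratfun_natV 2) (ratfunX 3 ratfun_sub1V))) => b _ _.
  by rewrite invfM exprVn.
apply: ratfunD; first by case: n => [|n]; [exact: r1|exact: ratfun_nat 0].
apply: ratfunM; first exact: ratfun_natV 2.
apply: ratfunD; first exact: ratfun_lamcoef ratfun_id.
by apply: ratfunM; [exact: ratfunN (ratfun_nat 1)|exact: ratfun_lamcoef ratfunV].
Qed.

End RationalCoefficients.

Lemma pser_sum (R : realType) (I : Type) (r : seq I) (c : I -> nat -> R[i])
  (f : I -> R[i] -> R[i]) :
  (forall i, pser (c i) (f i)) ->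
  pser (fun n => \sum_(i <- r) c i n) (fun x => \sum_(i <- r) f i x).
Proof.
move=> h; elim: r => [|i r IH].
  move=> x x1; rewrite big_nil; have [h1 h2] := pser_cst 0 x1.
  split; [apply: asum_ext h1|apply: hs_ext h2] => -[|n]; by rewrite big_nil.
move=> x x1; rewrite big_cons; have [h1 h2] := pserD (h i) IH x1.
by split; [apply: asum_ext h1|apply: hs_ext h2] => n;
  rewrite [\sum_(_ <- _ :: _) _]big_cons.
Qed.

(** * Equivariant combinations of roots of unity *)

Section Isotypic.
Variable R : realType.
Local Notation C := R[i].
Variables (l : nat) (zeta : C) (K : C -> Prop).
Hypothesis l_prime : prime l.
Hypothesis zetaP : l.-primitive_root zeta.
Hypothesis Krat : forall x : rat, K (ratr x).
Hypothesis KD : forall x y, K x -> K y -> K (x + y).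
Hypothesis KM : forall x y, K x -> K y -> K (x * y).

Implicit Types (psi phi : {unit 'F_l} -> C) (a b : {unit 'F_l}) (s t : 'F_l).

Lemma K_nat n : K n%:R.
Proof. by have := Krat n%:R; rewrite ratr_nat. Qed.

Lemma K_opp x : K x -> K (- x).
Proof. by move=> Kx; rewrite -mulN1r; apply: KM => //; have := Krat (-1);
  rewrite rmorphN1. Qed.

Lemma K_sum (I : Type) (r : seq I) (P : pred I) (F : I -> C) :
  (forall i, P i -> K (F i)) -> K (\sum_(i <- r | P i) F i).
Proof. by move=> KF; apply: big_ind => //; exact: K_nat 0. Qed.

Lemma zeta_nat n : zeta ^+ (n%:R : 'F_l)%R = zeta ^+ n.
Proof. by rewrite val_Fp_nat // prim_expr_mod. Qed.

Lemma zetaD s t : zeta ^+ (s + t)%R = zeta ^+ s * zeta ^+ t.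
Proof. by rewrite -[s]natr_Zp -[t]natr_Zp -natrD !zeta_nat exprD. Qed.

Lemma zetaM s n : zeta ^+ (s * n%:R)%R = (zeta ^+ s) ^+ n.
Proof. by rewrite -[s]natr_Zp -natrM !zeta_nat exprM. Qed.

(** The combinations z of the powers of zeta with coefficients in K on which
    the units of F_l act through psi. The condition bears on the coefficients f
    rather than on z: it is then stable under sums and products, whatever the
    linear relations between the powers of zeta. *)
Definition equivariant psi (z : C) := exists f : 'F_l -> C,
  [/\ forall s, K (f s), forall a s, f (\val a * s) = psi a * f s &
      z = \sum_s f s * zeta ^+ s].

Lemma equivariant_ext psi phi z : psi =1 phi -> equivariant psi z -> equivariant phi z.
Proof. by move=> e [f [h1 h2 h3]]; exists f; split=> // a s; rewrite h2 e. Qed.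

Lemma equivariantD psi z w : equivariant psi z -> equivariant psi w ->
  equivariant psi (z + w).
Proof.
move=> [f [f1 f2 ->]] [g [g1 g2 ->]]; exists (fun s => f s + g s); split.
- by move=> s; apply: KD.
- by move=> a s; rewrite f2 g2 mulrDr.
- by rewrite -big_split; apply: eq_bigr => s _; rewrite mulrDl.
Qed.

Lemma equivariant0 psi : equivariant psi 0.
Proof.
exists (fun=> 0); split; first by move=> s; exact: K_nat 0.
- by move=> a s; rewrite mulr0.
- by rewrite big1 // => s _; rewrite mul0r.
Qed.

Lemma val_unit_neq0 a : \val a != 0 :> 'F_l.
Proof. by rewrite -unitfE; exact: (valP a). Qed.

Lemma val_unit_inj a : injective (fun s : 'F_l => \val a * s).
Proof. exact: mulfI (val_unit_neq0 a). Qed.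

(** The coefficients of a product are the convolution on the additive group
    of F_l. *)
Lemma equivariantM psi phi z w : equivariant psi z -> equivariant phi w ->
  equivariant (fun a => psi a * phi a) (z * w).
Proof.
move=> [f [f1 f2 ->]] [g [g1 g2 ->]].
exists (fun u => \sum_s f s * g (u - s)); split.
- by move=> u; apply: K_sum => s _; exact: KM.
- move=> a u; rewrite (reindex_inj (@val_unit_inj a)) mulr_sumr.
  by apply: eq_bigr => s _; rewrite f2 -mulrBr g2; ring.
rewrite mulr_suml.
have e s : f s * zeta ^+ s * (\sum_t g t * zeta ^+ t) =
    \sum_u f s * g (u - s) * zeta ^+ u.
  rewrite mulr_sumr (reindex_inj (addIr (- s))); apply: eq_bigr => u _.
  by rewrite mulrACA -zetaD [s + _]addrC subrK.
rewrite (eq_bigr _ (fun s _ => e s)) exchange_big; apply: eq_bigr => u _.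
by rewrite mulr_suml.
Qed.

Lemma equivariant1 : equivariant (fun=> 1) 1.
Proof.
exists (fun s => (s == 0)%:R); split; first by move=> s; exact: K_nat.
- by move=> a s; rewrite mul1r mulf_eq0 (negbTE (val_unit_neq0 a)).
- by rewrite (bigD1 (0 : 'F_l)) //= ?eqxx mul1r expr0 big1 ?addr0 // => s /negbTE->;
  rewrite mul0r.
Qed.

Lemma zeta_sum : \sum_s zeta ^+ (s : 'F_l) = 0.
Proof.
have e : zeta * \sum_s zeta ^+ (s : 'F_l) = \sum_s zeta ^+ (s : 'F_l).
  rewrite [RHS](reindex_inj (addrI 1)) mulr_sumr; apply: eq_bigr => s _.
  by rewrite zetaD -[1]/(1%:R) zeta_nat expr1.
apply/eqP; move/eqP: e; rewrite -subr_eq0 -[X in _ - X]mul1r -mulrBl mulf_eq0.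
case/orP=> //; rewrite subr_eq0 => /eqP z1.
have := eq_prim_root_expr zetaP 1 0.
by rewrite expr1 expr0 z1 eqxx mod0n modn_small // prime_gt1.
Qed.

(** Invariant coefficients are constant on the nonzero residues, over which
    the powers of zeta sum up to -1. *)
Lemma equivariant_trivial z : equivariant (fun=> 1) z -> K z.
Proof.
move=> [f [f1 f2 ->]].
have fE s : s != 0 -> f s = f 1.
  rewrite -unitfE => us; have := f2 (FinRing.unit _ us) 1.
  by rewrite mulr1 mul1r.
have -> : \sum_s f s * zeta ^+ s = f 0 - f 1.
  have e : \sum_(s | s != 0 :> 'F_l) zeta ^+ s = -1.
    have := zeta_sum; rewrite (bigD1 (0 : 'F_l)) //= expr0 => /eqP.
    by rewrite addrC addr_eq0 => /eqP.
  rewrite (bigD1 (0 : 'F_l)) //= expr0 mulr1; congr (_ + _).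
  rewrite -mulrN1 -e mulr_sumr; apply: eq_bigr => s s0; by rewrite fE.
by apply: KD => //; exact: K_opp.
Qed.

(** Grouping the terms of the polynomials by the residue s = a j. *)
Lemma equivariant_gauss psi (P : {poly rat}) :
  (forall a b, psi (a * b)%g = psi a * psi b) -> (forall a, K (psi a)) ->
  equivariant psi (\sum_a psi a * (map_poly ratr P).[zeta ^+ (val a : 'F_l)]).
Proof.
move=> psiM psiK.
exists (fun s => \sum_a \sum_(j < size P)
  psi a * ratr P`_j * (\val a * j%:R == s)%:R); split.
- move=> s; apply: K_sum => a _; apply: K_sum => j _.
  by apply: KM; [exact: KM|exact: K_nat].
- move=> b s; rewrite (reindex_inj (mulgI b)) mulr_sumr; apply: eq_bigr => a _.
  rewrite mulr_sumr; apply: eq_bigr => j _.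
  rewrite psiM FinRing.val_unitM -[_ * _ * j%:R]mulrA (inj_eq (mulfI (val_unit_neq0 b))).
  by ring.
under [RHS]eq_bigr => s _ do rewrite mulr_suml.
rewrite exchange_big; apply: eq_bigr => a _ /=.
under [RHS]eq_bigr => s _ do rewrite mulr_suml.
rewrite exchange_big /= (horner_coef_wide _ (size_poly _ _)) mulr_sumr.
apply: eq_bigr => j _; rewrite (bigD1 (\val a * j%:R)) //= eqxx mulr1.
rewrite [X in _ + X]big1 ?addr0; last first.
  by move=> s /negbTE sj; rewrite eq_sym sj mulr0 mul0r.
by rewrite zetaM coef_map mulrA.
Qed.

Definition eqv_pser psi (f : C -> C) :=
  exists2 c, pser c f & forall n, equivariant psi (c n).

Lemma eqv_pser_ext psi phi f : psi =1 phi -> eqv_pser psi f -> eqv_pser phi f.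
Proof. by move=> e [c h1 h2]; exists c => // n; exact: equivariant_ext e (h2 n). Qed.

Lemma eqv_pserM psi phi f g : eqv_pser psi f -> eqv_pser phi g ->
  eqv_pser (fun a => psi a * phi a) (fun x => f x * g x).
Proof.
move=> [c fc hc] [d gd hd]; exists (conv c d); first exact: pserM.
move=> n; apply: big_ind => [||i _]; [exact: equivariant0|exact: equivariantD|].
exact: equivariantM.
Qed.

Lemma eqv_pser_gauss psi (c : C -> nat -> C) (V : C -> C -> C) :
  (forall a b, psi (a * b)%g = psi a * psi b) -> (forall a, K (psi a)) ->
  (forall b : C, cabs b = 1 -> pser (c b) (V b)) ->
  (forall n, ratfun l (fun b : C => c b n)) ->
  eqv_pser psi (fun q => \sum_a psi a * V (zeta ^+ (val a : 'F_l)) q).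
Proof.
move=> psiM psiK cV cr.
have zl a : (zeta ^+ (val a : 'F_l)) ^+ l = 1 by rewrite exprAC
  (prim_expr_order zetaP) expr1n.
exists (fun n => \sum_a psi a * c (zeta ^+ (val a : 'F_l)) n).
  apply: pser_sum => a; apply: pserZ; apply: cV.
  have : cabs (zeta ^+ (val a : 'F_l)) ^+ l = 1 by rewrite -cabsX zl cabs1.
  move/eqP; rewrite pexpr_eq1 ?cabs_ge0 ?prime_gt0 // => /eqP //.
move=> n; have [P hP] := cr n.
suff -> : \sum_a psi a * c (zeta ^+ (val a : 'F_l)) n =
    \sum_a psi a * (map_poly ratr P).[zeta ^+ (val a : 'F_l)] by exact: equivariant_gauss.
apply: eq_bigr => a _; rewrite hP // -[X in _ != X](expr0 zeta) (eq_prim_root_expr zetaP).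
have := val_unit_neq0 a; apply: contra => /eqP; rewrite mod0n => am.
have := ltn_ord (\val a : 'F_l); rewrite [X in (_ < X)%N]Fp_cast // => al.
by rewrite modn_small // in am; apply/eqP/val_inj.
Qed.

End Isotypic.

(** * Sums over the torsion points *)

Section DiscFunctions.
Variable R : realType.
Local Notation C := R[i].
Implicit Types (f g : C -> C) (X : C).

Definition disc_derivable f := forall X, cabs X < 1 -> exists D, cderiv_at f X D.

Lemma disc_ext f g : f =1 g -> disc_derivable f -> disc_derivable g.
Proof. by move=> fg df X /df[D h]; exists D; exact: cderiv_eq fg h. Qed.

Lemma disc_cst (z : C) : disc_derivable (fun=> z).
Proof. by move=> X _; exists 0; exact: cderiv_cst. Qed.

Lemma discM f g : disc_derivable f -> disc_derivable g ->
  disc_derivable (fun X => f X * g X).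
Proof. by move=> df dg X X1; have [[D h] [E k]] := (df X X1, dg X X1); eexists;
  exact: cderivM h k. Qed.

Lemma discD f g : disc_derivable f -> disc_derivable g ->
  disc_derivable (fun X => f X + g X).
Proof. by move=> df dg X X1; have [[D h] [E k]] := (df X X1, dg X X1); eexists;
  exact: cderivD h k. Qed.

Lemma discX f n : disc_derivable f -> disc_derivable (fun X => f X ^+ n).
Proof.
move=> df; elim: n => [|n IH]; first exact: disc_cst 1.
by apply: disc_ext (discM df IH) => X; rewrite exprS.
Qed.

Lemma disc_sum (I : Type) (r : seq I) (f : I -> C -> C) :
  (forall i, disc_derivable (f i)) -> disc_derivable (fun X => \sum_(i <- r) f i X).
Proof.
move=> df; elim: r => [|i r IH].
  by apply: disc_ext (disc_cst 0) => X; rewrite big_nil.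
by apply: disc_ext (discD (df i) IH) => X; rewrite big_cons.
Qed.

Lemma disc_pser a f : pser a f -> disc_derivable f.
Proof. by move=> fa X; exact: pser_cderiv fa. Qed.

Lemma disc_comp_exp f n : (0 < n)%N -> disc_derivable f ->
  disc_derivable (fun X => f (X ^+ n)).
Proof.
move=> n0 df X X1; have [E hE] : exists E, cderiv_at (fun Y : C => Y ^+ n) X E.
  by apply: (@discX id n) X1 => Y _; exists 1; exact: cderiv_id.
have [|D hD] := df (X ^+ n).
  by rewrite cabsX exprn_ilt1 ?cabs_ge0 // -lt0n.
by exists (D * E); exact: cderiv_comp hE hD.
Qed.

Lemma disc_cexp f : disc_derivable f -> disc_derivable (fun X => cexp (f X)).
Proof.
move=> df X X1; have [D hD] := df X X1; eexists; exact: cderiv_comp hD (cderiv_cexp _).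
Qed.

End DiscFunctions.

Section TorsionSums.
Variable R : realType.
Local Notation C := R[i].
Variables (l : nat) (zeta : C) (K : C -> Prop).
Hypothesis l_prime : prime l.
Hypothesis zetaP : l.-primitive_root zeta.
Hypothesis Krat : forall x : rat, K (ratr x).
Hypothesis KD : forall x y, K x -> K y -> K (x + y).
Hypothesis KM : forall x y, K x -> K y -> K (x * y).

Implicit Types (psi phi : {unit 'F_l} -> C) (a b u : {unit 'F_l}).
Implicit Types (V : C -> C -> C) (A : 'M[int]_2) (t : C).

Let l0 : (0 < l)%N. Proof. exact: prime_gt0. Qed.
Let lC : l%:R != 0 :> C. Proof. by rewrite pnatr_eq0 -lt0n. Qed.

Lemma e2pi_divX (m : int) : e2pi (m%:~R / l%:R : C) ^+ l = 1.
Proof. by rewrite -e2piMn mulrC divfK // e2pi_int. Qed.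

Lemma cabs_root_unity (z : C) : z ^+ l = 1 -> cabs z = 1.
Proof.
move=> zl; have : cabs z ^+ l = 1 by rewrite -cabsX zl cabs1.
by move/eqP; rewrite pexpr_eq1 ?cabs_ge0 // => /eqP.
Qed.

Lemma e2pi_div_prim : l.-primitive_root (e2pi (l%:R^-1 : C)).
Proof.
rewrite /primitive_root_of_unity l0 /=; apply/forallP => i.
apply/eqP; rewrite unity_rootE.
have [->|il] := eqVneq i.+1 l.
  by have := e2pi_divX 1; rewrite mul1r => ->; rewrite eqxx.
apply: contra_neqF il => /eqP; rewrite -e2piMn => /e2pi_eq1[n].
move/(congr1 ( *%R^~ l%:R)); rewrite divfK // -[i.+1%:R]/(i.+1%:Z%:~R : C).
rewrite -[l%:R]/(l%:Z%:~R : C) -rmorphM /= => /eqP; rewrite eqr_int => /eqP e.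
have : (l %| i.+1)%N by rewrite -[(l %| _)%N]/(l%:Z %| i.+1%:Z)%Z e dvdz_mull.
by move=> /dvdn_leq -/(_ isT) h; apply/eqP; rewrite eqn_leq ltn_ord.
Qed.

(** The roots of unity of order l are the e2pi (kap / l): the torsion points
    can be written with any of them. *)
Lemma zeta_e2pi : exists kap : nat, zeta = e2pi (l%:R^-1) ^+ kap /\ ~~ (l %| kap)%N.
Proof.
have [i zi] := prim_rootP e2pi_div_prim (prim_expr_order zetaP).
exists i; split=> //; apply/negP => /dvdnP[m im].
have := eq_prim_root_expr zetaP 1 0.
rewrite expr1 expr0 zi im mulnC exprM (prim_expr_order e2pi_div_prim) expr1n eqxx.
by rewrite mod0n modn_small // prime_gt1.
Qed.

Definition jfac A t : C := (A 1 0)%:~R * t + (A 1 1)%:~R.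

Lemma val_unit_lt a : ((\val a : 'F_l) < l)%N.
Proof. by have := ltn_ord (\val a : 'F_l); rewrite [X in (_ < X)%N]Fp_cast. Qed.

Lemma val_unit_gt0 a : (0 < (\val a : 'F_l))%N.
Proof.
by rewrite lt0n; apply: contra (val_unit_neq0 a) => /eqP h; apply/eqP/val_inj.
Qed.

Lemma unit_of_nat (m : nat) : ~~ (l %| m)%N -> exists u : {unit 'F_l}, \val u = m%:R.
Proof.
move=> lm; have um : (m%:R : 'F_l) \is a GRing.unit by rewrite unitFpE // prime_coprime.
by exists (FinRing.unit 'F_l um).
Qed.

(** The common properties of x (of weight w = 2) and y (of weight w = 3) from
    which the sums over the torsion points are studied. *)
Definition torsion_family V (w : nat) :=
  [/\ exists2 qc, forall b : C, cabs b = 1 -> pser (qc b) (V b) &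
        forall n, ratfun l (fun b : C => qc b n),
      forall A t (mu : int), SL2Z A -> 0 < complex.Im t -> ~~ (l%:Z %| mu)%Z ->
        V (e2pi (mu%:~R / l%:R)) (e2pi (moebius A t)) =
        jfac A t ^+ w * V (div_value A t l mu) (e2pi t) &
      forall (a : nat) (b : C), cabs b = 1 -> (0 < a < l)%N -> exists c f, pser c f /\
        forall X, X != 0 -> cabs X < 1 -> V (b * X ^+ a) (X ^+ l) = f X].

Lemma torsion_family_xser : torsion_family (@xser R) 2.
Proof.
split.
- by exists (@qcoefx R) => [b b1|n]; [exact: pser_xser|exact: ratfun_qcoefx].
- by move=> A t mu AS tH lmu; exact: xser_moebius.
- by move=> a b b1 /andP[a0 al]; exact: xser_division.
Qed.

Lemma torsion_family_yser : torsion_family (@yser R) 3.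
Proof.
split.
- by exists (@qcoefy R) => [b b1|n]; [exact: pser_yser|exact: ratfun_qcoefy].
- by move=> A t mu AS tH lmu; exact: yser_moebius.
- by move=> a b b1 /andP[a0 al]; exact: yser_division.
Qed.

Lemma e2pi_div_expn t : e2pi (t / l%:R) ^+ l = e2pi t.
Proof. by rewrite -e2piMn mulrC divfK. Qed.

Lemma e2pi_div_lt1 t : 0 < complex.Im t -> cabs (e2pi (t / l%:R)) < 1.
Proof.
move=> tH; have : cabs (e2pi (t / l%:R)) ^+ l < 1 by rewrite -cabsX e2pi_div_expn
  cabs_e2pi_lt1.
by rewrite expr_lt1 ?cabs_ge0.
Qed.

(** When the exponent of e2pi (t / l) is 0, the division point is a root of
    unity and the expansion at infinity applies, with e2pi t = X^l. *)
Lemma division_fun V w A (mu : int) : torsion_family V w ->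
  exists f, disc_derivable f /\ forall t, 0 < complex.Im t ->
    V (div_value A t l mu) (e2pi t) = f (e2pi (t / l%:R)).
Proof.
move=> [[qc qcV _] _ Vdiv]; pose b : C := e2pi ((A 1 1 * mu)%:~R / l%:R).
have b1 : cabs b = 1 by apply: cabs_root_unity; exact: e2pi_divX.
have [e0|e0] := posnP (div_exp A l mu).
  exists (fun X => V b (X ^+ l)); split.
    exact: disc_comp_exp l0 (disc_pser (qcV b b1)).
  by move=> t tH; rewrite /div_value e0 mulr1 e2pi_div_expn.
have [|c [f [cf hf]]] := Vdiv (div_exp A l mu) b b1.
  by rewrite e0 (div_exp_lt _ _ l0).
exists f; split; first exact: disc_pser cf.
move=> t tH; rewrite -hf ?e2pi_neq0 ?e2pi_div_lt1 //.
by rewrite e2pi_div_expn.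
Qed.

(** The functions f of q such that t |-> f (e2pi t) behaves as a modular form
    of weight w: its q-expansion has psi-equivariant coefficients, it has the
    character psi^-1 on Gamma0(l), through the lower-right entry u of the
    matrix modulo l, and it is holomorphic at all cusps as a function of
    e2pi (t / l). *)
Definition automorphic psi (w : nat) (f : C -> C) :=
  [/\ eqv_pser zeta K psi f,
      forall A t u (m : nat), Gamma0 l A -> 0 < complex.Im t ->
        \val u = m%:R -> (l%:Z %| (A 1 1 - m%:Z)%R)%Z ->
        f (e2pi (moebius A t)) = jfac A t ^+ w * (psi u)^-1 * f (e2pi t) &
      forall A, SL2Z A -> exists2 N, disc_derivable N & forall t, 0 < complex.Im t ->
        f (e2pi (moebius A t)) = jfac A t ^+ w * N (e2pi (t / l%:R))].

Lemma automorphic_ext psi phi w f : psi =1 phi ->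
  automorphic psi w f -> automorphic phi w f.
Proof.
move=> e [h1 h2 h3]; split=> //; first exact: eqv_pser_ext e h1.
by move=> A t u m; rewrite -e; exact: h2.
Qed.

Lemma automorphicM psi phi w v f g : automorphic psi w f -> automorphic phi v g ->
  automorphic (fun a => psi a * phi a) (w + v)%N (fun x => f x * g x).
Proof.
move=> [f1 f2 f3] [g1 g2 g3]; split.
- exact: eqv_pserM.
- move=> A t u m A0 tH um Am.
  rewrite (f2 A t u m) // (g2 A t u m) // exprD invfM.
  by move: (psi u)^-1 (phi u)^-1 => x y; ring.
- move=> A AS; have [N dN hN] := f3 A AS; have [M dM hM] := g3 A AS.
  exists (fun X => N X * M X); first exact: discM.
  by move=> t tH; rewrite hN // hM // exprD; ring.
Qed.

Lemma automorphic1 : automorphic (fun=> 1) 0 (fun=> 1).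
Proof.
split.
- exists (fun n => if n is 0%N then 1 else 0); first exact: pser_cst.
  by case=> [|n]; [exact: equivariant1|exact: equivariant0].
- by move=> *; rewrite invr1 !mulr1.
- by move=> A AS; exists (fun=> 1); [exact: disc_cst|move=> t tH; rewrite mulr1].
Qed.

Lemma automorphicX psi w f k : automorphic psi w f ->
  automorphic (fun a => psi a ^+ k) (k * w)%N (fun x => f x ^+ k).
Proof.
move=> hf; elim: k => [|k IH]; first exact: automorphic1.
have [h1 h2 h3] := automorphicM hf IH; split.
- have [c c1 c2] := h1; exists c => [x x1|n].
    by rewrite exprS; exact: c1.
  by apply: equivariant_ext (c2 n) => a; rewrite exprS.
- move=> A t u m A0 tH um Am; rewrite [_ ^+ k.+1]exprS (h2 A t u m) //.
  by rewrite [f _ ^+ k.+1]exprS [psi _ ^+ k.+1]exprS mulSn.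
- move=> A /h3[N dN hN]; exists N => // t tH; rewrite exprS hN //.
Qed.

Definition torsion_sum V psi (q : C) : C :=
  \sum_a psi a * V (zeta ^+ (val a : 'F_l)) q.

(** A matrix of Gamma0(l) multiplies the torsion points by its lower-right
    entry u, and reindexing by a |-> u a gives the factor (psi u)^-1. *)
Lemma automorphic_torsion_sum V w psi : torsion_family V w ->
  (forall a b, psi (a * b)%g = psi a * psi b) ->
  (forall a, psi a != 0) -> (forall a, K (psi a)) ->
  automorphic psi w (torsion_sum V psi).
Proof.
move=> fV psiM psi0 psiK; have [[qc qcV qcR] Vm _] := fV.
have [kap [zk lk]] := zeta_e2pi.
have zE (m : nat) : zeta ^+ m = e2pi ((kap * m)%N%:Z%:~R / l%:R).
  by rewrite zk -exprM -e2piMn.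
have lmu a : ~~ (l%:Z %| (kap * (\val a : 'F_l))%N%:Z)%Z.
  rewrite dvdzE /= Euclid_dvdM // (negbTE lk) /=; apply/negP => /dvdn_leq.
  by move=> /(_ (val_unit_gt0 a)); rewrite leqNgt val_unit_lt.
split.
- exact: (eqv_pser_gauss l_prime zetaP Krat KD KM psiM psiK qcV qcR).
- move=> A t u m [AS Al] tH um Am.
  rewrite /torsion_sum [in RHS](reindex_inj (mulgI u)) mulr_sumr.
  apply: eq_bigr => a _; rewrite [in LHS]zE Vm // psiM FinRing.val_unitM.
  have -> : div_value A t l (kap * (\val a : 'F_l))%N%:Z =
      zeta ^+ (\val u * \val a : 'F_l)%R.
    rewrite /div_value.
    have -> : div_exp A l (kap * (\val a : 'F_l))%N%:Z = 0%N.
      by rewrite /div_exp; apply/eqP; rewrite absz_eq0; apply/eqP/dvdz_mod0P;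
        rewrite dvdz_mulr.
    rewrite mulr1 mulrC -[\val a]natr_Zp zetaM // um zeta_nat // -exprM zE.
    have [d dE] : exists d : int, A 1 1 = m%:Z + d * l%:Z.
      by have /dvdzP[d hd] := Am; exists d; rewrite -hd; ring.
    rewrite -[RHS](e2piDint _ (d * (kap * (\val a : 'F_l))%N%:Z)); congr e2pi.
    rewrite dE natr_Zp !PoszM !rmorphM /= !rmorphD /= !rmorphM /=.
    by field.
  by field; exact: psi0.
- move=> A AS; have [f hf] := choice (fun a : {unit 'F_l} =>
    division_fun A (kap * (\val a : 'F_l))%N%:Z fV).
  exists (fun X => \sum_a psi a * f a X).
    by apply: disc_sum => a; apply: discM (disc_cst _) (hf a).1.
  move=> t tH; rewrite /torsion_sum mulr_sumr; apply: eq_bigr => a _.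
  by rewrite zE Vm // (hf a).2 //; ring.
Qed.

(** The nontrivial l-th roots of unity are the powers of zeta by the units. *)
Lemma p1E q : p1 l q = torsion_sum (@xser R) (fun=> 1) q.
Proof.
rewrite /p1 (reindex_fsbig (fun a : {unit 'F_l} => zeta ^+
  (\val a : 'F_l)) [set: {unit 'F_l}]).
  have -> : [set: {unit 'F_l}] = [set` index_enum {unit 'F_l}].
    by apply/seteqP; split=> // a _ /=; rewrite mem_index_enum.
  rewrite -fsbig_seq ?index_enum_uniq //; apply: eq_bigr => a _; by rewrite mul1r.
split.
- move=> a _; split; first by rewrite exprAC (prim_expr_order zetaP) expr1n.
  apply/eqP; rewrite -[1 in X in _ != X](expr0 zeta) (eq_prim_root_expr zetaP).
  by rewrite mod0n modn_small ?val_unit_lt // -lt0n val_unit_gt0.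
- move=> a b _ _ /eqP; rewrite (eq_prim_root_expr zetaP) !modn_small ?val_unit_lt //.
  by move=> /eqP h; apply/val_inj/val_inj.
- move=> z [zl z1]; have [i zi] := prim_rootP zetaP zl.
  have [|u uE] := @unit_of_nat i.
    apply/negP => li; case: z1; rewrite zi -(prim_expr_mod zetaP).
    by rewrite (eqP (li : i %% l == 0)%N).
  by exists u => //; rewrite uE zeta_nat.
Qed.

End TorsionSums.

(** The lower-right entry is invertible modulo l, by the determinant. *)
Lemma Gamma0_unit (l : nat) (A : 'M[int]_2) : prime l ->
  Gamma0 l A -> exists (u : {unit 'F_l}) (m : nat),
  \val u = m%:R /\ (l%:Z %| (A 1 1 - m%:Z)%R)%Z.
Proof.
move=> l_prime [AS Al]; pose m := absz (modz (A 1 1) l%:Z).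
have l0 := prime_gt0 l_prime.
have mE : m%:Z = modz (A 1 1) l%:Z by rewrite /m gez0_abs // modz_ge0 //; lia.
have Am : (l%:Z %| (A 1 1 - m%:Z)%R)%Z.
  by rewrite mE {1}(divz_eq (A 1 1) l%:Z) addrK dvdz_mull.
have [|u um] := @unit_of_nat l l_prime m; last by exists u, m.
apply/negP => lm; have : (l%:Z %| 1%:Z)%Z.
  rewrite -[1%:Z](SL2Z_det AS) rpredB //; last exact: dvdz_mull.
  by apply: dvdz_mull; rewrite -[A 1 1](subrK m%:Z) rpredD.
by rewrite dvdzE /= dvdn1 => /eqP l1; have := prime_gt1 l_prime; rewrite l1.
Qed.

(** * Quotients by powers of the discriminant *)

Section QuotientByDelta.
Variable R : realType.
Local Notation C := R[i].
Variables (l : nat) (zeta : C) (K : C -> Prop).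
Hypothesis l_prime : prime l.
Hypothesis zetaP : l.-primitive_root zeta.
Hypothesis Krat : forall x : rat, K (ratr x).
Hypothesis KD : forall x y, K x -> K y -> K (x + y).
Hypothesis KM : forall x y, K x -> K y -> K (x * y).

Lemma near_cabs (z : C) (r : R) : 0 < r ->
  \forall w \near (z : R[i]^o), cabs (w - z) < r.
Proof.
move=> r0; apply/nbhs_ballP; exists r%:C%C => /=; first by rewrite ltcR.
by move=> w; rewrite -ball_normE /= normcE_cabs ltcR cabsBC.
Qed.

Lemma near_upper (z : C) : 0 < complex.Im z ->
  \forall w \near (z : R[i]^o), 0 < complex.Im w.
Proof.
move=> zH; apply: filterS (near_cabs z zH) => w h.
have := le_lt_trans (cabs_Im (w - z)) h.
rewrite ltr_norml => /andP[+ _]; case: w z {zH h} => [a b] [c d] /=; lra.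
Qed.

Lemma K_natV n : K (n%:R^-1).
Proof. by have := Krat n%:R^-1; rewrite fmorphV rmorph_nat. Qed.

Lemma K_conv (a b : nat -> C) : (forall n, K (a n)) -> (forall n, K (b n)) ->
  forall n, K (conv a b n).
Proof. by move=> Ka Kb n; apply: (K_sum Krat KD) => i _; exact: KM. Qed.

(** The recursion only involves rational operations. *)
Lemma K_expcoef (a : nat -> C) : (forall n, K (a n)) -> forall n, K (expcoef a n).
Proof.
move=> Ka n; elim/ltn_ind: n => -[|n] IH; first exact: (K_nat Krat 1).
have n0 : n.+1%:R != 0 :> C by rewrite pnatr_eq0.
have -> : expcoef a n.+1 = n.+1%:R^-1 * conv (dcoef a) (expcoef a) n.
  by rewrite -expcoefS mulKf.
apply: KM; first exact: K_natV.
apply: (K_sum Krat KD) => i _; apply: KM; last by apply: IH; rewrite ltnS leq_subr.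
by apply: KM; first exact: (K_nat Krat).
Qed.

Lemma K_eulcoef n : K (eulcoef R n).
Proof. by apply: (K_sum Krat KD) => p _; exact: K_natV. Qed.

Lemma eulcoef0 : eulcoef R 0 = 0.
Proof.
by rewrite /eulcoef /dfcoef big_seq big1 // => p; rewrite (mem_dfib eule_ge1 eule_ge2).
Qed.

Section Quotient.
Variables (e : nat) (F J : C -> C).
Hypothesis autF : automorphic zeta K (fun _ : {unit 'F_l} => 1) (12 * e)%N F.
Hypothesis JE : forall t, J t = F (e2pi t) / Delta t ^+ e.

Let g (X : C) := (24 * e)%:R * eulerlog X.
Let H X := F X * cexp (g X).

Let pser_g : pser (fun n => (24 * e)%:R * eulcoef R n) g.
Proof. by apply: pserZ; exact: pser_eulerlog. Qed.

Let DeltaV t : 0 < complex.Im t ->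
  (Delta t ^+ e)^-1 = (e2pi t ^+ e)^-1 * cexp (g (e2pi t)).
Proof.
move=> tH; rewrite DeltaE // exprMn invfM; congr (_ * _).
by rewrite -cexpMn -cexpN mulrN opprK mulrA -natrM mulnC.
Qed.

Let JH t : 0 < complex.Im t -> J t = H (e2pi t) / e2pi t ^+ e.
Proof. by move=> tH; rewrite JE DeltaV // /H; ring. Qed.

Let q1 (t : C) : 0 < complex.Im t -> cabs (e2pi t) < 1.
Proof. by rewrite cabs_e2pi_lt1. Qed.

Let disc_g : disc_derivable (fun X => cexp (g X)).
Proof. exact: disc_cexp (disc_pser pser_g). Qed.

Let disc_H : disc_derivable H.
Proof. by have [[c Fc _] _ _] := autF; exact: discM (disc_pser Fc) disc_g. Qed.

Lemma quotient_holomorphic : holomorphic_on (@upper_half_plane R) J.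
Proof.
move=> z zH; rewrite /upper_half_plane /= in zH.
have [D hD] := disc_H (q1 zH).
have h1 := cderiv_comp (cderiv_e2pi z) hD.
have h2 := cderiv_comp (cderivX e (cderiv_id _)) (cderiv_inv (expf_neq0 e (e2pi_neq0 z))).
have h3 := cderivM h1 (cderiv_comp (cderiv_e2pi z) h2).
apply: cderiv_derivable; apply: (cderiv_ext zH) h3 => h hz.
have /JH-> // : 0 < complex.Im (z + h).
have := le_lt_trans (cabs_Im h) hz; rewrite ltr_norml => /andP[+ _].
by rewrite ImD; lra.
Qed.

Lemma quotient_meromorphic : meromorphic_on (@upper_half_plane R) J.
Proof.
move=> z zH; exists 0%N, J; split.
  by apply: filterS (near_upper zH) => w; exact: quotient_holomorphic.
by apply: nearW => w; rewrite expr0 mul1r.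
Qed.

Let Delta_moebiusX A (t : C) : SL2Z A -> 0 < complex.Im t ->
  Delta (moebius A t) ^+ e = jfac A t ^+ (12 * e) * Delta t ^+ e.
Proof. by move=> AS tH; rewrite Delta_moebius // exprMn -exprM. Qed.

Lemma quotient_invariant A t : Gamma0 l A -> 0 < complex.Im t ->
  J (moebius A t) = J t.
Proof.
move=> A0 tH; have [AS _] := A0; have [_ F0 _] := autF.
have [u [m [um Am]]] := Gamma0_unit l_prime A0.
have j0 : jfac A t ^+ (12 * e) != 0 by rewrite expf_neq0 // moebius_den_neq0.
have alg (j f d : C) : j != 0 -> j / 1 * f / (j * d) = f / d.
  by move=> jn0; rewrite invr1 mulr1 invfM mulrACA mulfV // mul1r.
apply: etrans (JE _) _; apply: etrans _ (esym (JE _)).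
exact: etrans (congr2 (fun x y => x / y) (F0 A t u m A0 tH um Am)
  (Delta_moebiusX AS tH)) (alg _ _ _ j0).
Qed.

(** The automorphy factors of F and Delta^e cancel; with X = e2pi (t / l) the
    denominator is X^(l e) times a unit. *)
Lemma quotient_cusps : meromorphic_at_cusps J.
Proof.
move=> A AS; have [_ _ /(_ A AS)[N dN hN]] := autF.
have l0 := prime_gt0 l_prime.
pose G X := N X * cexp (g (X ^+ l)).
have dG : disc_derivable G := discM dN (disc_comp_exp l0 disc_g).
exists l, (fun X => G X / X ^+ (l * e)), 0; split=> //.
- exists (l * e)%N, G; split.
    apply: filterS (near_cabs 0 ltr01) => X; rewrite subr0 => X1.
    by have [D hD] := dG X X1; exact: cderiv_derivable hD.
  rewrite near_withinE; apply: nearW => X X0.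
  by rewrite subr0 mulrC divfK // expf_neq0.
- move=> t tH _; rewrite (JE (moebius A t)) (hN t tH) (Delta_moebiusX AS tH) invfM
  (DeltaV tH).
  have j0 : jfac A t ^+ (12 * e) != 0 by rewrite expf_neq0 // moebius_den_neq0.
  have alg (j X Q : C) : j != 0 -> X ^+ l = Q ->
      j * N X * (j^-1 * (Q ^- e * cexp (g Q))) = G X / X ^+ (l * e).
    by move=> jn0 <-; rewrite mulrACA mulfV // mul1r [_^-1 * _]mulrC mulrA exprM.
  exact: alg j0 (e2pi_div_expn l_prime t).
Qed.

(** Delta^e is q^e exp (- 24 e L), and exp (24 e L) has an expansion with
    rational coefficients. *)
Lemma quotient_q_expansion : exists (N : nat) (c : nat -> C),
  has_q_expansion J N c /\ forall m, K (c m).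
Proof.
have [[c Fc Ec] _ _] := autF.
pose a n : C := (24 * e)%:R * eulcoef R n.
have a0 : a 0%N = 0 by rewrite /a eulcoef0 mulr0.
have pH : pser (conv c (expcoef a)) H := pserM Fc (pser_exp pser_g a0).
exists e, (conv c (expcoef a)); split.
  move=> t tH; have [_ h] := pH _ (q1 tH).
  have h' := hsZr (e2pi t ^+ e)^-1 h; rewrite -JH // in h'.
  apply: hs_cvg; apply: hs_ext h' => m.
  by rewrite -mulrA expfzDr ?e2pi_neq0 // -invr_expz.
apply: K_conv => n.
  by apply: (equivariant_trivial l_prime zetaP Krat KD KM); exact: Ec.
by apply: K_expcoef => m; apply: KM; [exact: (K_nat Krat)|exact: K_eulcoef].
Qed.

End Quotient.

End QuotientByDelta.

(** * The theorem *)

Section Adjoin.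
Variable R : realType.
Local Notation C := R[i].
Implicit Type z : C.

Lemma Q_adjoin_rat z (x : rat) : Q_adjoin z (ratr x).
Proof. by exists x%:P; rewrite map_polyC hornerC. Qed.

Lemma Q_adjoinD z (x y : C) : Q_adjoin z x -> Q_adjoin z y -> Q_adjoin z (x + y).
Proof. by move=> [p ->] [q ->]; exists (p + q); rewrite rmorphD hornerD. Qed.

Lemma Q_adjoinM z (x y : C) : Q_adjoin z x -> Q_adjoin z y -> Q_adjoin z (x * y).
Proof. by move=> [p ->] [q ->]; exists (p * q); rewrite rmorphM hornerM. Qed.

Lemma Q_adjoin_unity_root n z (x : C) : n.-primitive_root z -> x ^+ n = 1 ->
  Q_adjoin z x.
Proof.
move=> zP /(prim_rootP zP)[i ->]; exists 'X^i.
by rewrite map_polyXn hornerXn.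
Qed.

End Adjoin.

Lemma e_Delta_weight n k r : r_admissible n k r ->
  (k * (if odd n then 2 else 3) + (if odd n then 2 else 3) + r * 2 =
   12 * e_Delta n k r)%N.
Proof.
by rewrite /r_admissible /e_Delta; case: (odd n) => /dvdnP[m mE]; rewrite mE mulnK //;
  lia.
Qed.

Theorem lemma3p1 (R : realType) (l n k r : nat) (zeta_l zeta_n : R[i])
    (chi : {unit 'F_l} -> R[i])
    (l_prime : prime l) (n_dvd : (n %| l - 1)%N)
    (zeta_l_prim : l.-primitive_root zeta_l)
    (zeta_n_prim : n.-primitive_root zeta_n)
    (chi_char : mu_character n chi) (chi_order : character_order n chi)
    (k_odd : ~~ odd n -> odd k)
    (r_min : is_min (r_admissible n k) r) :
  let J := jacobi_sum zeta_l n chi k r in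
  [/\ modular_function l J,
      holomorphic_on (@upper_half_plane R) J &
      exists (N : nat) (c : nat -> R[i]),
        has_q_expansion J N c /\ forall m, Q_adjoin zeta_n (c m)].
Proof.
move=> J; have [chiM chi_root] := chi_char.
have chi1 a : chi a ^+ n = 1 by apply/eqP; rewrite -unity_rootE.
have n0 := prim_order_gt0 zeta_n_prim.
have chi0 a : chi a != 0.
  by apply/eqP => c0; have := chi1 a; rewrite c0 expr0n gtn_eqF // => /eqP;
    rewrite eq_sym oner_eq0.
pose K := Q_adjoin zeta_n.
have KD x y : K x -> K y -> K (x + y) by exact: Q_adjoinD.
have KM x y : K x -> K y -> K (x * y) by exact: Q_adjoinM.
have Krat (x : rat) : K (ratr x) by exact: Q_adjoin_rat.
pose V := if odd n then @xser R else @yser R; pose w := (if odd n then 2 else 3)%N.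
have fV : torsion_family l V w.
  by rewrite /V /w; case: (odd n);
    [exact: torsion_family_xser|exact: torsion_family_yser].
have G1 : automorphic zeta_l K chi w (torsion_sum zeta_l V chi).
  apply: automorphic_torsion_sum => // a.
  exact: Q_adjoin_unity_root zeta_n_prim (chi1 a).
have G2 : automorphic zeta_l K (fun a => chi a ^- k) w
    (torsion_sum zeta_l V (fun a => chi a ^- k)).
  apply: automorphic_torsion_sum => // [a b|a|a].
  - by rewrite chiM exprMn invfM.
  - by rewrite invr_eq0 expf_neq0.
  - apply: Q_adjoin_unity_root zeta_n_prim _.
    by rewrite exprVn exprAC chi1 expr1n invr1.
have P1 : automorphic zeta_l K (fun _ : {unit 'F_l} => 1) 2 (p1 l).
  have -> : p1 l = torsion_sum zeta_l (@xser R) (fun _ : {unit 'F_l} => 1).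
    by apply/funext => q; exact: p1E l_prime zeta_l_prim q.
  apply: automorphic_torsion_sum => //; first exact: torsion_family_xser.
  - by move=> a b; rewrite mulr1.
  - by move=> _; exact: (K_nat Krat 1).
have autM := automorphicM l_prime zeta_l_prim Krat KD KM.
have autX := automorphicX l_prime zeta_l_prim Krat KD KM.
have [r_adm _] := r_min.
pose F q := Gsum zeta_l n chi q ^+ k * Gsum zeta_l n
  (fun a => chi a ^- k) q * p1 l q ^+ r.
have autF : automorphic zeta_l K (fun _ : {unit 'F_l} => 1) (12 * e_Delta n k r)%N F.
  rewrite -(e_Delta_weight r_adm).
  apply: automorphic_ext (autM _ _ _ _ _ _ (autM _ _ _ _ _ _ (autX _ _ _ k G1) G2)
    (autX _ _ _ r P1)) => a.
  by rewrite expr1n mulr1 mulfV // expf_neq0.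
have JE t : J t = F (e2pi t) / Delta t ^+ e_Delta n k r by [].
split.
- split.
  + exact: quotient_meromorphic autF JE.
  + move=> A t A0 tH; exact: (quotient_invariant l_prime autF JE A0 tH).
  + exact: (quotient_cusps l_prime autF JE).
- exact: quotient_holomorphic autF JE.
- exact: (quotient_q_expansion l_prime zeta_l_prim Krat KD KM autF JE).
Qed.
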